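(* Let $d\in\mathbb{N}$, let $L$ be a Lévy basis on $\mathbb{R}^d$, and let $(Y_t)_{t\in\mathbb{Z}^d}$ be a $\{0,1\}$-valued stationary $\alpha$-mixing random field which is independent of $L$ and satisfies $P(Y_0=1)>0$. Assume moreover that there exists $\delta>0$ such that (i) for every $u,v\in\mathbb{N}$, $\alpha_Y(k;u,v)\,k^d\to0$ as $k\to\infty$; (ii) for every $u,v\in\mathbb{N}$ with $u+v\le4$, $\sum_{k=0}^\infty k^{d-1}\alpha_Y(k;u,v)<\infty$, and $\sum_{k=0}^\infty k^{d-1}\alpha_Y(k;1,1)^{\delta/(2+\delta)}<\infty$. Let $\Gamma_n:=\{t\in[-n,n)^d\cap\mathbb{Z}^d:\ Y_t=1\}$ for $n\in\mathbb{N}$. Let $X_t=\int_{\mathbb{R}^d}f(t-u)\,dL(u)$, $t\in\mathbb{R}^d$, where $\mathbb{E}|L([0,1]^d)|^{2+\delta}<\infty$ and $f\in L^1(\mathbb{R}^d)\cap L^{2+\delta}(\mathbb{R}^d)$ is real-valued. If $$\sum_{t\in\mathbb{Z}^d}\mathbb{E}[Y_0Y_t]\int_{\mathbb{R}^d}|f(-u)|\,|f(t-u)|\,\lambda^d(du)<\infty,$$ then, as $n\to\infty$, $$\frac{1}{\sqrt{|\Gamma_n|}}\sum_{t\in\Gamma_n}(X_t-\beta)\ \xrightarrow{d}\ N\Big(0,\ \sum_{t\in\mathbb{Z}^d}\frac{1}{\mathbb{E}Y_0}\operatorname{cov}\big(Y_t(X_t-\beta),Y_0(X_0-\beta)\big)\Big),$$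 where $\beta=\mathbb{E}L([0,1]^d)\int_{\mathbb{R}^d}f(u)\,\lambda^d(du)$. In the special case that $Y$ is $h$-dependent for some finite $h>0$, the same conclusion holds when the conditions $\mathbb{E}|L([0,1]^d)|^{2+\delta}<\infty$ and $f\in L^1(\mathbb{R}^d)\cap L^{2+\delta}(\mathbb{R}^d)$ are replaced by $\mathbb{E}|L([0,1]^d)|^2<\infty$ and $f\in L^1(\mathbb{R}^d)\cap L^2(\mathbb{R}^d)$.
   Context: $\lambda^d$ is Lebesgue measure on $\mathbb{R}^d$; $|A|$ is the number of elements of a finite set $A$; $N(a,b)$ is the normal distribution with mean $a$ and variance $b\ge0$ ($b=0$ meaning the Dirac measure at $a$); $\xrightarrow{d}$ is convergence in distribution; $\operatorname{dist}(A,B)=\inf\{\|x-y\|:x\in A,y\in B\}$ with the Euclidean norm. On the event $\Gamma_n=\emptyset$, the normalised sum is set to $0$. For $\sigma$-fields $\mathcal{F},\mathcal{G}$, $\alpha(\mathcal{F},\mathcal{G}):=\sup\{|P(A)P(B)-P(A\cap B)|:A\in\mathcal{F},B\in\mathcal{G}\}$. For $u,v\in\mathbb{N}$, $$\alpha_Y(k;u,v):=\sup\{\alpha(\sigma(Y_t,t\in A),\sigma(Y_t,t\in B)):\ A,B\subset\mathbb{Z}^d,\ \operatorname{dist}(A,B)\ge k,\ |A|\le u,\ |B|\le v\}.$$ $Y$ is $\alpha$-mixing if $\alpha_Y(k;u,v)\to0$ as $k\to\infty$ for every $u,v\in\mathbb{N}$. $Y$ is stationary if its finite-dimensional distributions are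 invariant under shifts of $\mathbb{Z}^d$. A stationary field $Y$ is $h$-dependent ($h>0$) if for all finite $A,B\subset\mathbb{Z}^d$ with $\operatorname{dist}(A,B)>h$ the $\sigma$-fields $\sigma(Y_s:s\in A)$ and $\sigma(Y_s:s\in B)$ are independent. Lévy basis: a family $(L(A))_{A\in\mathcal{B}_b(\mathbb{R}^d)}$ of real random variables indexed by the bounded Borel subsets of $\mathbb{R}^d$ such that (i) $L(\bigcup_n A_n)=\sum_n L(A_n)$ a.s. for pairwise disjoint $(A_n)_{n\in\mathbb{N}_0}\subset\mathcal{B}_b(\mathbb{R}^d)$ with $\bigcup_n A_n\in\mathcal{B}_b(\mathbb{R}^d)$; (ii) $L(A_1),\dots,L(A_n)$ are independent for pairwise disjoint $A_1,\dots,A_n\in\mathcal{B}_b(\mathbb{R}^d)$; (iii) there are $a\ge 0$, $\gamma\in\mathbb{R}$ and a Lévy measure $\nu$ on $\mathbb{R}$ (i.e. $\nu(\{0\})=0$, $\int\min\{1,x^2\}\nu(dx)<\infty$) such that $\mathbb{E}e^{izL(A)}=\exp(\psi(z)\lambda^d(A))$ for all $z\in\mathbb{R}$, $A\in\mathcal{B}_b(\mathbb{R}^d)$, where $\psi(z)=i\gamma z-\frac12 az^2+\int_{\mathbb{R}}(e^{ixz}-1-ixz\mathbf{1}_{[-1,1]}(x))\nu(dx)$. Integral: for a simple function $f=\sum_{j=1}^n x_j\mathbf{1}_{A_j}$ with $x_j\in\mathbb{R}$, $A_j\in\mathcal{B}_b(\mathbb{R}^d)$, and Borel $A$, $\int_A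 f\,dL:=\sum_j x_jL(A_j\cap A)$. A Borel function $f:\mathbb{R}^d\to\mathbb{R}$ is integrable with respect to $L$ if there are simple functions $f_n\to f$ $\lambda^d$-a.e. such that $\int_A f_n\,dL$ converges in probability for every Borel set $A$; the limit is $\int_A f\,dL$. If $f\in L^1(\mathbb{R}^d)\cap L^2(\mathbb{R}^d)$ and $\mathbb{E}L([0,1]^d)^2<\infty$, then $f$ is integrable with respect to $L$ and $\int_{\mathbb{R}^d}f\,dL$ has finite second moment. *)

(* Defs.v *)
From HB Require Import structures.
From mathcomp Require Import all_boot all_order all_algebra finmap.
From mathcomp Require Import all_classical all_reals all_analysis.
From mathcomp Require Import measurable_realfun complex.

Set Implicit Arguments.
Unset Strict Implicit.
Unset Printing Implicit Defensive.

Import Order.TTheory GRing.Theory Num.Theory.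
Import numFieldNormedType.Exports.

Local Open Scope classical_set_scope.
Local Open Scope ring_scope.

(* Matrices over [R] carry the Borel sigma-algebra of their topology. *)
Section borel_matrix.
Variables (R : realType) (m n : nat).

HB.instance Definition _ := @isMeasurable.Build
  (sigma_display (@open 'M[R]_(m, n))) 'M[R]_(m, n)
  <<s (@open 'M[R]_(m, n)) >> (@sigma_algebra0 _ setT _)
  (@sigma_algebraC _ (@open 'M[R]_(m, n))) (@sigma_algebra_bigcup _ setT _).

Lemma measurable_coord_mx (i : 'I_m) (j : 'I_n) :
  measurable_fun [set: 'M[R]_(m, n)] (fun x : 'M[R]_(m, n) => x i j).
Proof.
apply: (measurability _ (measurable_realfun.RGenOpens.measurableE R)) => _ [_ [a [b ->]] <-].
rewrite setTI; apply: sub_sigma_algebra.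
apply: open_comp; last exact: interval_open.
by move=> x _; exact: coord_continuous.
Qed.

Lemma open_bigcup_ball (O : set 'M[R]_(m, n)) : open O ->
  O = \bigcup_(p in [set p : 'M[rat]_(m, n) * nat |
        ball (map_mx ratr p.1 : 'M[R]_(m, n)) p.2.+1%:R^-1 `<=` O])
        ball (map_mx ratr p.1 : 'M[R]_(m, n)) p.2.+1%:R^-1.
Proof.
move=> oO; apply/seteqP; split; last by move=> x [p /= pO px]; exact: pO.
move=> x Ox.
have /nbhs_ballP[e /= e0 eO] : nbhs x O by exact: open_nbhs_nbhs.
have [k ke] : exists k, k.+1%:R^-1 < e / 2.
  have e20 : 0 < e / 2 by rewrite divr_gt0.
  exists (Num.truncn (e / 2)^-1).
  by rewrite invf_plt ?posrE// truncnS_gt.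
have hq (i : 'I_m) (j : 'I_n) : exists q : rat, `|x i j - ratr q| < k.+1%:R^-1.
  have : x i j - k.+1%:R^-1 < x i j + k.+1%:R^-1.
    by rewrite ltrBlDr -addrA ltrDl addr_gt0// invr_gt0.
  move=> /rat_in_itvoo[q]; rewrite in_itv/= => /andP[q1 q2].
  exists q; rewrite ltr_norml; apply/andP; split.
    by rewrite ltrBrDr addrC -ltrBrDr opprK.
  by rewrite ltrBlDr addrC -ltrBlDr.
pose q : 'M[rat]_(m, n) := \matrix_(i, j) xget 0 [set q | `|x i j - ratr q| < k.+1%:R^-1].
have qP i j : `|x i j - ratr (q i j)| < k.+1%:R^-1.
  by rewrite mxE; exact: (xgetPex 0 (hq i j)).
exists (q, k) => /=.
  move=> y [_ qy]; apply: eO; split=> // i j.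
  have := qy i j; rewrite mxE /ball/= => H.
  rewrite (splitr e).
  rewrite -(subrKA (ratr (q i j))).
  by rewrite (le_lt_trans (ler_normD _ _))// ltrD// (lt_trans _ ke).
by split=> // i j; rewrite mxE /ball/= distrC.
Qed.

Lemma measurable_fun_mx d (T : measurableType d) (f : T -> 'M[R]_(m, n)) :
  (forall i j, measurable_fun [set: T] (fun x => f x i j)) ->
  measurable_fun [set: T] f.
Proof.
move=> mf; apply: (@measurability _ _ _ _ _ _ (@open 'M[R]_(m, n))) => //.
move=> _ [U oU <-]; rewrite setTI (open_bigcup_ball oU) preimage_bigcup.
rewrite bigcup_mkcond; apply: countable_bigcupT_measurable => [|p].
  exact: countableP.
case: ifPn => // _.
rewrite (_ : _ @^-1` _ = \bigcap_(ij in [set: 'I_m * 'I_n])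
    ((fun x => f x ij.1 ij.2) @^-1`
       ball ((map_mx ratr p.1 : 'M[R]_(m, n)) ij.1 ij.2) p.2.+1%:R^-1)); last first.
  apply/seteqP; split=> [x [_ H] [i j] _|x H]; first exact: H.
  by split=> [|i j]; [rewrite invr_gt0|exact: (H (i, j))].
apply: fin_bigcap_measurable => [|[i j] _].
  exact: finite_finset.
rewrite -[X in measurable X]setTI; apply: mf => //.
by apply: open_measurable; exact: ball_open.
Qed.

End borel_matrix.

Section lebesgue_rV.
Variable R : realType.

Definition cons_rV (d : nat) (p : R * 'rV[R]_d) : 'rV[R]_d.+1 :=
  \row_i oapp (p.2 ord0) p.1 (unlift ord0 i).

Definition uncons_rV (d : nat) (x : 'rV[R]_d.+1) : R * 'rV[R]_d :=
  (x ord0 ord0, \row_i x ord0 (lift ord0 i)).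

Lemma cons_rV0 d p i : @cons_rV d p i ord0 = p.1.
Proof. by rewrite mxE unlift_none. Qed.

Lemma cons_rVS d p i j : @cons_rV d p i (lift ord0 j) = p.2 ord0 j.
Proof. by rewrite mxE liftK. Qed.

Lemma cons_rVK d : cancel (@cons_rV d) (@uncons_rV d).
Proof.
move=> [a x]; rewrite /uncons_rV cons_rV0; congr (_, _).
by apply/rowP => i; rewrite mxE cons_rVS.
Qed.

Lemma measurable_cons_rV d : measurable_fun [set: R * 'rV[R]_d] (@cons_rV d).
Proof.
apply: measurable_fun_mx => i j; have [k ->|->] := unliftP ord0 j.
  under eq_fun do rewrite cons_rVS.
  exact: (measurableT_comp (measurable_coord_mx _ k)).
by under eq_fun do rewrite cons_rV0; exact: measurable_fst.
Qed.

Lemma measurable_uncons_rV d : measurable_fun [set: 'rV[R]_d.+1] (@uncons_rV d).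
Proof.
apply: measurable_fun_pair; first exact: measurable_coord_mx.
apply: measurable_fun_mx => i j /=.
under eq_fun do rewrite mxE.
exact: measurable_coord_mx.
Qed.

Let sigma_finite_prod d1 d2 (T1 : measurableType d1) (T2 : measurableType d2)
    (m1 : {sigma_finite_measure set T1 -> \bar R})
    (m2 : {sigma_finite_measure set T2 -> \bar R}) :
  sigma_finite setT (m1 \x m2)%E.
Proof.
have /sigma_finiteP[F [TF ndF Foo]] := sigma_finiteT m1.
have /sigma_finiteP[G [TG ndG Goo]] := sigma_finiteT m2.
exists (fun n => F n `*` G n).
 rewrite -setXTT TF TG predeqE => -[x y]; split.
    move=> [/= [n _ Fnx] [k _ Gky]]; exists (maxn n k) => //; split.
    - by move: x Fnx; exact/subsetPset/ndF/leq_maxl.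
    - by move: y Gky; exact/subsetPset/ndG/leq_maxr.
  by move=> [n _ []/= ? ?]; split; exists n.
move=> k; have [? ?] := Foo k; have [? ?] := Goo k.
split; first exact: measurableX.
by rewrite product_measure1E// lte_mul_pinfty// ge0_fin_numE.
Qed.

Section succ.
Variables (d : nat) (mu : {sigma_finite_measure set 'rV[R]_d -> \bar R}).

Definition lebesgue_rV_succ : set 'rV[R]_d.+1 -> \bar R :=
  pushforward (@lebesgue_measure R \x mu)%E (@cons_rV d).

Let leb0 : lebesgue_rV_succ set0 = 0%E.
Proof. by rewrite /lebesgue_rV_succ /pushforward preimage_set0 measure0. Qed.

Let leb_ge0 A : (0 <= lebesgue_rV_succ A)%E.
Proof. by rewrite /lebesgue_rV_succ /pushforward; exact: measure_ge0. Qed.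

Let leb_sigma_additive : semi_sigma_additive lebesgue_rV_succ.
Proof.
exact: (@measure_semi_sigma_additive _ _ _
  (measure_function_pushforward__canonical__measure_function_Measure
   (@lebesgue_measure R \x mu)%E (@measurable_cons_rV d))).
Qed.

HB.instance Definition _ := isMeasure.Build _ _ _ lebesgue_rV_succ
  leb0 leb_ge0 leb_sigma_additive.

Let leb_sigma_finite : sigma_finite setT lebesgue_rV_succ.
Proof.
have [F FT mF] := sigma_finite_prod (@lebesgue_measure R) mu.
exists (fun i => @uncons_rV d @^-1` F i).
  by rewrite -preimage_bigcup -FT preimage_setT.
move=> i; have [mFi Fioo] := mF i; split.
  by rewrite -[X in measurable X]setTI; exact: measurable_uncons_rV.
rewrite /lebesgue_rV_succ /pushforward -comp_preimage.
by rewrite (_ : _ \o _ = id) //; apply/funext => x; exact: cons_rVK.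
Qed.

HB.instance Definition _ := Measure_isSigmaFinite.Build _ _ _
  lebesgue_rV_succ leb_sigma_finite.

End succ.

(* Iterated product of [lebesgue_measure], transported along [cons_rV]; see
   [lebesgue_rV_box] for its values on boxes. *)
Fixpoint lebesgue_rV (d : nat) :
    {sigma_finite_measure set 'rV[R]_d -> \bar R} :=
  match d with
  | 0 => \d_(0 : 'rV[R]_0)
  | d'.+1 => lebesgue_rV_succ (lebesgue_rV d')
  end.

Lemma lebesgue_rV_box d (a b : 'rV[R]_d) : (forall i, a ord0 i <= b ord0 i) ->
  lebesgue_rV d [set x | forall i, x ord0 i \in `[a ord0 i, b ord0 i]] =
  (\prod_(i < d) (b ord0 i - a ord0 i))%:E.
Proof.
elim: d a b => [|d IH] a b ab /=.
  rewrite big_ord0 diracE mem_set// => -[] //.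
rewrite /lebesgue_rV_succ /pushforward.
pose a' := (uncons_rV a).2; pose b' := (uncons_rV b).2.
have E i : a' ord0 i = a ord0 (lift ord0 i) by rewrite mxE.
have E' i : b' ord0 i = b ord0 (lift ord0 i) by rewrite mxE.
have -> : @cons_rV d @^-1` [set x : 'rV[R]_d.+1 | forall i, x ord0 i \in `[a ord0 i, b ord0 i]]
    = `[a ord0 ord0, b ord0 ord0] `*`
      [set x : 'rV[R]_d | forall i, x ord0 i \in `[a' ord0 i, b' ord0 i]].
  apply/seteqP; split => [[x y] /= H|[x y] /= [H1 H2] i].
    split=> [|i]; first by have := H ord0; rewrite cons_rV0.
    by have := H (lift ord0 i); rewrite E E' cons_rVS.
  have [j ->|->] := unliftP ord0 i; last by rewrite cons_rV0.
  by rewrite cons_rVS -E -E'.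
rewrite product_measure1E//; last first.
  rewrite (_ : [set x : 'rV[R]_d | _] = \bigcap_(i in [set: 'I_d])
     ((fun x : 'rV[R]_d => x ord0 i) @^-1` `[a' ord0 i, b' ord0 i])); last first.
    by apply/seteqP; split => [x H i _|x H i]; exact: H.
  apply: fin_bigcap_measurable => [|i _]; first exact: finite_finset.
  by rewrite -[X in measurable X]setTI; exact: measurable_coord_mx.
rewrite IH; last by move=> i; rewrite E E'.
have : @lebesgue_measure R `[a ord0 ord0, b ord0 ord0] = (b ord0 ord0 - a ord0 ord0)%:E.
  rewrite lebesgue_measure_itv/= lte_fin.
  case: ltP => //; rewrite le_eqVlt ltNge ab orbF => /eqP ->.
  by rewrite subrr.
rewrite /= => ->; rewrite big_ord_recl EFinM.
by congr (_ * _%:E)%E; apply: eq_bigr => i _; rewrite E E'.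
Qed.

End lebesgue_rV.

Section independence.
Context {disp} {T : measurableType disp} {R : realType} (P : probability T R).
Local Open Scope ereal_scope.

Definition independent_systems (F G : set (set T)) :=
  forall A B, F A -> G B -> P (A `&` B) = P A * P B.

(* Taking some of the [B i] equal to [setT] gives the product rule for every
   subfamily. *)
Definition mutually_independent n (Z : 'I_n -> T -> R) :=
  forall B : 'I_n -> set R, (forall i, measurable (B i)) ->
    P (\bigcap_(i in [set: 'I_n]) (Z i @^-1` B i)) =
    \prod_(i < n) P (Z i @^-1` B i).

Definition sigma_family (I : Type) (D : set I) (Z : I -> T -> R) :
    set (set T) :=
  <<s \bigcup_(i in D) preimage_set_system setT (Z i) measurable >>.

End independence.

Section convergence.
Context {disp} {T : measurableType disp} {R : realType} (P : probability T R).

Definition cvg_in_probability (Z : nat -> T -> R) (W : T -> R) :=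
  forall e, 0 < e -> P [set w | e <= `|Z n w - W w|] @[n --> \oo] --> 0%E.

Definition cvg_in_distribution (Z : nat -> {RV P >-> R})
    (mu : probability (measurableTypeR R) R) :=
  forall g : R -> R, continuous g -> bounded_fun g ->
    \int[P]_w g (Z n w) @[n --> \oo] --> \int[mu]_x g x.

(* [normal_prob m s] takes the standard deviation and is not degenerate at
   [s = 0]. *)
Definition normal_law (m v : R) : probability (measurableTypeR R) R :=
  if v == 0 then (@dirac _ (measurableTypeR R) m R : probability (measurableTypeR R) R)
  else (normal_prob m (Num.sqrt v) : probability (measurableTypeR R) R).

End convergence.

Section complex_integral.
Context {R : realType}.
Local Open Scope complex_scope.

Definition cexp (z : R[i]) : R[i] :=
  (expR (complex.Re z) * cos (complex.Im z)) +i*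
  (expR (complex.Re z) * sin (complex.Im z)).

Definition Cintegral {disp} {T : measurableType disp}
    (mu : {measure set T -> \bar R}) (g : T -> R[i]) : R[i] :=
  (\int[mu]_x complex.Re (g x)) +i* (\int[mu]_x complex.Im (g x)).

Definition is_levy_measure (nu : {measure set (measurableTypeR R) -> \bar R}) :=
  nu [set 0] = 0%E /\
  (\int[nu]_x (Num.min 1 (x ^+ 2))%:E < +oo)%E.

(* The integrand is integrable with respect to any Levy measure, so that
   [Cintegral] takes no default value here. *)
Definition levy_exponent (a gamma : R)
    (nu : {measure set (measurableTypeR R) -> \bar R}) (z : R) : R[i] :=
  'i * (gamma * z)%:C - (2^-1 * a * z ^+ 2)%:C +
  Cintegral nu (fun x : measurableTypeR R =>
    cexp ('i * (x * z)%:C) - 1 - 'i * (x * z * \1_(`[-1, 1]) x)%:C).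

End complex_integral.

Section levy_basis.
Context {disp} {T : measurableType disp} {R : realType} (P : probability T R).
Context (d : nat).

Definition bounded_borel : set (set 'rV[R]_d) :=
  [set A : set 'rV[R]_d | measurable A /\ bounded_set A].

Implicit Type L : set 'rV[R]_d -> {RV P >-> R}.

(* [L A] is unconstrained when [A] is not a bounded Borel set. *)
Record is_levy_basis L : Prop := IsLevyBasis {
  levy_additive : forall A : nat -> set 'rV[R]_d,
    (forall n, bounded_borel (A n)) -> trivIset setT A ->
    bounded_borel (\bigcup_n A n) ->
    {ae P, forall w,
      series (fun n => L (A n) w) n @[n --> \oo] --> L (\bigcup_n A n) w} ;
  levy_independent : forall n (A : 'I_n -> set 'rV[R]_d),
    (forall i, bounded_borel (A i)) -> trivIset setT A ->
    mutually_independent P (fun i => L (A i)) ;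
  levy_khintchine : exists (a gamma : R)
      (nu : {measure set (measurableTypeR R) -> \bar R}),
    [/\ 0 <= a, is_levy_measure nu &
     forall (z : R) A, bounded_borel A ->
       Cintegral P (fun w => cexp ('i * (z * L A w)%:C)%C) =
       cexp (levy_exponent a gamma nu z * (fine (lebesgue_rV R d A))%:C)%C]
}.

(* Formal representation of [\sum_j x_j \1_(A_j)]. *)
Record simple_function : Type := SimpleFunction {
  sf_size : nat ;
  sf_coef : 'I_sf_size -> R ;
  sf_set : 'I_sf_size -> set 'rV[R]_d ;
  sf_setP : forall j, bounded_borel (sf_set j)
}.

Definition simple_eval (s : simple_function) (x : 'rV[R]_d) : R :=
  \sum_(j < sf_size s) sf_coef j * \1_(sf_set j) x.

Definition simple_integral L (s : simple_function) (A : set 'rV[R]_d)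
    (w : T) : R :=
  \sum_(j < sf_size s) sf_coef j * L (sf_set j `&` A) w.

(* [W] is a version of the integral of [f] over [A] with respect to [L]. *)
Definition is_levy_integral L (f : 'rV[R]_d -> R) (A : set 'rV[R]_d)
    (W : {RV P >-> R}) :=
  measurable_fun [set: 'rV[R]_d] f /\
  exists s : nat -> simple_function,
    [/\ {ae lebesgue_rV R d, forall x, simple_eval (s n) x @[n --> \oo] --> f x},
        (forall B, measurable B -> exists WB : {RV P >-> R},
           cvg_in_probability P (fun n => simple_integral L (s n) B) WB) &
        cvg_in_probability P (fun n => simple_integral L (s n) A) W].

Definition unit_cube : set 'rV[R]_d :=
  [set x | forall i, x ord0 i \in `[0, 1]].

End levy_basis.

Section lattice.
Context {R : realType} (d : nat).
Local Notation Zd := 'rV[int]_d.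

Definition of_lattice (t : Zd) : 'rV[R]_d := map_mx intr t.

Definition euclidean_norm (x : 'rV[R]_d) : R :=
  Num.sqrt (\sum_(i < d) x ord0 i ^+ 2).

(* Equal to [+oo] when [A] or [B] is empty. *)
Definition lattice_dist (A B : set Zd) : \bar R :=
  ereal_inf [set (euclidean_norm (of_lattice x - of_lattice y))%:E
            | x in A & y in B].

(* The lattice points of [[-n, n)^d]. *)
Definition window (n : nat) : set Zd :=
  [set t | forall i, (- n%:Z <= t ord0 i < n%:Z)%R].

Lemma finite_window n : finite_set (window n).
Proof.
apply: (@sub_finite_set _ _ ((fun s : 'rV['I_(n + n)]_d =>
   \row_i ((s ord0 i : nat)%:Z - n%:Z) : Zd) @` setT)); last first.
  by apply: finite_image; exact: finite_finset.
move=> t tn /=.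
have H i : (`|(t ord0 i + n%:Z)%R|%N < n + n)%N.
  have /andP[t1 t2] := tn i.
  rewrite -ltz_nat gez0_abs; last by rewrite -lerBlDr sub0r.
  by rewrite PoszD ltrD2r.
exists (\row_i Ordinal (H i)) => //; apply/rowP => i; rewrite !mxE/= gez0_abs.
  by rewrite addrK.
by have /andP[t1 t2] := tn i; rewrite -lerBlDr sub0r.
Qed.

End lattice.
Arguments of_lattice R {d} t.
Arguments lattice_dist R {d} A B.

Section random_field.
Context {disp} {T : measurableType disp} {R : realType} (P : probability T R).
Context (d : nat).
Local Notation Zd := 'rV[int]_d.
Implicit Types (Y X : Zd -> {RV P >-> R}).

Definition alpha_coef (F G : set (set T)) : \bar R :=
  ereal_sup [set `|P A * P B - P (A `&` B)|%E | A in F & B in G].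

Definition alpha_field Y (k u v : nat) : \bar R :=
  ereal_sup [set alpha_coef (sigma_family [set` AB.1] Y)
                            (sigma_family [set` AB.2] Y)
            | AB in [set AB : {fset Zd} * {fset Zd} |
                [/\ (k%:R%:E <= lattice_dist R [set` AB.1] [set` AB.2])%E,
                    (#|` AB.1| <= u)%N & (#|` AB.2| <= v)%N]]].

Definition alpha_mixing Y :=
  forall u v, (0 < u)%N -> (0 < v)%N ->
    alpha_field Y k u v @[k --> \oo] --> 0%E.

Definition stationary Y :=
  forall n (t : 'I_n -> Zd) (h : Zd) (B : set (n.-tuple R)), measurable B ->
    P [set w | B [tuple Y (t i + h) w | i < n]] =
    P [set w | B [tuple Y (t i) w | i < n]].

Definition h_dependent Y (h : R) :=
  forall A B : {fset Zd}, (h%:E < lattice_dist R [set` A] [set` B])%E ->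
    independent_systems P (sigma_family [set` A] Y) (sigma_family [set` B] Y).

Definition sampled Y (n : nat) (w : T) : set Zd :=
  [set t | window n t /\ Y t w = 1].

(* As [0^-1 = 0], this is [0] when [sampled Y n w] is empty. *)
Definition normalized_sum Y X (beta : R) (n : nat) (w : T) : R :=
  (Num.sqrt #|` fset_set (sampled Y n w)|%:R)^-1 *
  \sum_(t \in sampled Y n w) (X t w - beta).

Section measurable_normalized_sum.
Variables (Y X : Zd -> {RV P >-> R}) (beta : R) (n : nat).

Let fsbig_sampled (w : T) (g : Zd -> R) :
  \sum_(t \in sampled Y n w) g t =
  \sum_(t <- fset_set (@window d n)) \1_[set 1] (Y t w) * g t.
Proof.
rewrite [RHS](@fsbig_seq _ 0%R +%R)//.
have -> : [set` fset_set (@window d n)] = @window d n.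
  exact/fset_setK/finite_window.
transitivity (\sum_(t \in sampled Y n w) \1_[set 1] (Y t w) * g t).
  by apply: eq_fsbigr => t /set_mem[_ /= ->]; rewrite indicE mem_set ?mul1r.
apply: fsbig_widen => [t []//|t [wt /= nt]].
by rewrite indicE memNset ?mul0r// => Yt; exact: nt.
Qed.

Let measurable_sampled (g : Zd -> T -> R) :
  (forall t, measurable_fun setT (g t)) ->
  measurable_fun setT (fun w => \sum_(t \in sampled Y n w) g t w).
Proof.
move=> mg; under eq_fun do rewrite fsbig_sampled.
apply: measurable_sum => t; apply: measurable_funM => //.
apply: measurableT_comp => //; exact: measurable_indic.
Qed.

Lemma measurable_normalized_sum :
  measurable_fun setT (normalized_sum Y X beta n).
Proof.
rewrite /normalized_sum.
have cardE w : #|` fset_set (sampled Y n w)|%:R =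
    \sum_(t \in sampled Y n w) (1 : R).
  have fin : finite_set (sampled Y n w).
    by apply: sub_finite_set (@finite_window d n) => t [].
  transitivity (\sum_(t <- fset_set (sampled Y n w)) (1 : R)).
    by rewrite card_fset_sum1 natr_sum.
  by apply/esym; exact: (@fsbig_finite R 0 +%R Zd _ (fun=> 1) fin).
apply: measurable_funM.
  under eq_fun => w.
    rewrite -powR12_sqrt// -powRN cardE. over.
  apply: (measurableT_comp (measurable_powR _)).
  by apply: measurable_sampled => t.
by apply: measurable_sampled => t; exact: measurable_funB.
Qed.

HB.instance Definition _ := isMeasurableFun.Build _ _ _ _
  (normalized_sum Y X beta n) measurable_normalized_sum.

End measurable_normalized_sum.

(* Sum of a real series over the lattice; meaningful when [summable setT a]. *)
Definition lattice_sum (a : Zd -> \bar R) : R :=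
  fine (\esum_(t in [set: Zd]) a^\+ t - \esum_(t in [set: Zd]) a^\- t)%E.

End random_field.

(* Main.v *)
(** Conditionally on [Y], the normalised sum over the sampled set [G] is the
    stochastic integral of [z / sqrt |G| * g_G], with
    [g_G u = sum_(t in G) f (t - u)], so its characteristic function is the
    exponential of the integral of the Levy exponent of that kernel.  Finite
    second moments make the exponent equal to [i mu z - v z^2 / 2] up to an error
    that is quadratic everywhere and small with respect to [z^2] near [0].
    Truncating [f] to a bounded function of bounded support bounds [g_G] up to a
    rest that is small in [L^2], whence, after centring, the exponent is close to
    [- v z^2 / 2 * |G|^-1 \int g_G^2].  Here [\int g_G^2] is the sum of
    [gamma (t - s)] over [s, t] in [G], where [gamma] is the autocorrelation of
    [f]; mixing gives a law of large numbers for the products [Y_s Y_(s + h)], so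
    that [|G|^-1 \int g_G^2] converges in [L^1] to
    [(E Y_0)^-1 sum_h E[Y_0 Y_h] gamma h].

    An identity [E e^(i z W) = e^(a + i b)] is encoded without complex numbers as
    [E cos (z W + t) = e^a cos (b + t)] for all [t]; conditioning on an event [D]
    amounts to inserting [\1_D] on the left and [P D] on the right.  *)

Require Import Defs.
From HB Require Import structures.
From mathcomp Require Import all_boot all_order all_algebra finmap.
From mathcomp Require Import all_classical all_reals all_analysis.
From mathcomp Require Import measurable_realfun complex zify ring lra.

Set Implicit Arguments.
Unset Strict Implicit.
Unset Printing Implicit Defensive.

Import Order.TTheory GRing.Theory Num.Theory.
Import numFieldNormedType.Exports.

Local Open Scope classical_set_scope.
Local Open Scope ring_scope.

(** * Real-valued integrals *)

(** The integral with respect to [L] is defined through simple functions converging almost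
    everywhere, with no domination, so the limit of their characteristic functions is not immediate.
    What helps is convergence over every Borel set: testing it on one set built by a gliding hump
    shows that the integrals come arbitrarily late close to those of a dominated sequence, for which
    dominated convergence applies to the exponent.

    Moments are read from difference quotients of characteristic functions at [0], with Fatou's
    lemma for square integrability. This serves the basis, its Levy measure, and the products
    [X_0 X_t], the latter by polarisation on the event [Y_0 = Y_t = 1].

    The conditional characteristic function is compared with the normal one by a bound linear in the
    errors of the sampled density, of the quadratic form and of the truncation, so that smallness in
    mean of these three suffices. The constant in front of the truncation error does not depend on
    the truncation level, which can therefore be chosen after it. Convergence in distribution then
    follows by Gaussian smoothing of test functions. *)

Section integral_tools.
Context d (T : measurableType d) (R : realType).
Variable mu : {measure set T -> \bar R}.
Local Notation intble f := (mu.-integrable setT (EFin \o f)).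
Implicit Types f g : T -> R.

Lemma le_integrable_real f g : measurable_fun setT f ->
  (forall x, `|f x| <= g x) -> intble g -> intble f.
Proof.
move=> mf fg ig; apply: le_integrable ig => //; first exact/measurable_EFinP.
by move=> x _ /=; rewrite lee_fin (le_trans (fg x))// ler_norm.
Qed.

Lemma integrable_real_meas f : intble f -> measurable_fun setT f.
Proof. by move=> /measurable_int/measurable_EFinP. Qed.

Lemma integrableD_real f g : intble f -> intble g -> intble (fun x => f x + g x).
Proof.
by move=> fi gi; have := integrableD measurableT fi gi; apply: eq_integrable.
Qed.

Lemma integrableZ_real k f : intble f -> intble (fun x => k * f x).
Proof.
by move=> fi; have := integrableZl measurableT k fi; apply: eq_integrable.
Qed.

Lemma integrableN_real f : intble f -> intble (fun x => - f x).
Proof.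
by move=> fi; have := integrableN fi; apply: eq_integrable.
Qed.

Lemma integrableB_real f g : intble f -> intble g -> intble (fun x => f x - g x).
Proof. by move=> fi gi; apply: integrableD_real => //; exact: integrableN_real. Qed.

Lemma integrable_abs f : intble f -> intble (fun x => `|f x|).
Proof. by move=> fi; have := integrable_norm fi; apply: eq_integrable. Qed.

Lemma integrable_sum_real I (s : seq I) (f : I -> T -> R) :
  (forall i, intble (f i)) -> intble (fun x => \sum_(i <- s) f i x).
Proof.
move=> fi; have := integrable_sum measurableT s (P := xpredT) (fun i _ => fi i).
by apply: eq_integrable => // x _ /=; rewrite sumEFin.
Qed.

Lemma Rintegral_sum I (s : seq I) (f : I -> T -> R) :
  (forall i, intble (f i)) ->
  \int[mu]_x (\sum_(i <- s) f i x) = \sum_(i <- s) \int[mu]_x f i x.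
Proof.
move=> fi; elim: s => [|i s IH].
  by rewrite big_nil; under eq_Rintegral do rewrite big_nil; rewrite /Rintegral integral0.
rewrite big_cons -IH -RintegralD//; last exact: integrable_sum_real.
by apply: eq_Rintegral => x _; rewrite big_cons.
Qed.

Lemma RintegralN f : intble f -> \int[mu]_x (- f x) = - \int[mu]_x f x.
Proof.
move=> fi; rewrite -mulN1r -RintegralZl//.
by apply: eq_Rintegral => x _; rewrite mulN1r.
Qed.

Lemma Rintegral_abs_le f g : measurable_fun setT f -> (forall x, `|f x| <= g x) ->
  intble g -> `|\int[mu]_x f x| <= \int[mu]_x g x.
Proof.
move=> mf fg ig; have fi := le_integrable_real mf fg ig.
rewrite (le_trans (le_normr_Rintegral _ _))// le_Rintegral//.
exact: integrable_abs.
Qed.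

Lemma Rintegral_EFin f : intble f -> (\int[mu]_x (f x)%:E)%E = (\int[mu]_x f x)%:E.
Proof. by move=> fi; rewrite /Rintegral fineK//; exact: integrable_fin_num. Qed.

Lemma Rintegral_dct_ae (f_ : nat -> T -> R) f g :
  (forall n, measurable_fun setT (f_ n)) -> measurable_fun setT f ->
  {ae mu, forall x, f_ n x @[n --> \oo] --> f x} ->
  intble g -> (forall n x, `|f_ n x| <= g x) ->
  intble f /\ \int[mu]_x f_ n x @[n --> \oo] --> \int[mu]_x f x.
Proof.
move=> mf_ mf cf ig fg.
have cf' : {ae mu, forall x, setT x -> (fun n => (f_ n x)%:E) @ \oo --> (f x)%:E}.
  apply: filterS cf => x cx _; exact/fine_cvgP/(conj _ cx)/nearW.
have fg' : {ae mu, forall x n, setT x -> (`|(f_ n x)%:E| <= (g x)%:E)%E}.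
  by apply: aeW => x n _; rewrite lee_fin.
have mf_' n : measurable_fun setT (fun x => (f_ n x)%:E) by exact/measurable_EFinP.
have mf' : measurable_fun setT (fun x => (f x)%:E) by exact/measurable_EFinP.
have [fi _ cvi] := dominated_convergence measurableT mf_' mf' cf' ig fg'.
split=> //; rewrite /Rintegral.
apply: fine_cvg; rewrite fineK; last exact: integrable_fin_num.
exact: cvi.
Qed.

Lemma Rintegral_dct (f_ : nat -> T -> R) f g :
  (forall n, measurable_fun setT (f_ n)) ->
  (forall x, f_ n x @[n --> \oo] --> f x) ->
  intble g -> (forall n x, `|f_ n x| <= g x) ->
  [/\ measurable_fun setT f, intble f &
      \int[mu]_x f_ n x @[n --> \oo] --> \int[mu]_x f x].
Proof.
move=> mf_ cf ig fg; have mf : measurable_fun setT f.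
  by apply: (@measurable_fun_cvg _ _ _ _ f_) => // x _; exact: cf.
by have [] := @Rintegral_dct_ae f_ f g mf_ mf (aeW mu cf) ig fg.
Qed.

End integral_tools.

Lemma integrable_bounded d (T : measurableType d) (R : realType)
    (mu : {finite_measure set T -> \bar R}) (f : T -> R) (M : R) :
  measurable_fun setT f -> (forall x, `|f x| <= M) ->
  mu.-integrable setT (EFin \o f).
Proof.
move=> mf fM; apply: measurable_bounded_integrable => //.
  by rewrite -ge0_fin_numE//; exact: fin_num_measure.
exists M; split; first exact: num_real.
by move=> N MN x _ /=; exact: le_trans (fM x) (ltW MN).
Qed.

Lemma Rintegral_prob_cst d (T : measurableType d) (R : realType)
    (P : probability T R) (c : R) : \int[P]_x c = c.
Proof.
transitivity (c * fine (P setT)); first exact: Rintegral_cst.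
by rewrite probability_setT mulr1.
Qed.

(** * The normal characteristic function *)

Section gaussian.
Context (R : realType).
Notation leb := (@lebesgue_measure R).

Lemma measurable_cos_lin (z t : R) : measurable_fun setT (fun x : R => cos (z * x + t)).
Proof.
apply: (measurableT_comp (f := @cos R)).
  by apply: continuous_measurable_fun; exact: continuous_cos.
by apply: measurable_funD => //; exact: measurable_funM.
Qed.

(** With [w = (y - x)^2 / (8 s^2)] the two densities carry [e^(-4w)] and [e^(-w)], the wider one
    with half the peak, and [w e^(-3w) <= 1/2] follows from [1 + 3w <= e^(3w)]. Second moment and
    decay of the density are thus read from the mass and the peak of a wider one. *)
Lemma normal_sq_le (x s y : R) : 0 < s ->
  (y - x) ^+ 2 * normal_pdf x s y <= 8 * s ^+ 2 * normal_pdf x (2 * s) y.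
Proof.
move=> s0; have s20 : 0 < 2 * s by rewrite mulr_gt0.
rewrite !normal_pdfE ?gt_eqF// /normal_peak /normal_fun.
have -> : (Num.sqrt ((2 * s) ^+ 2 * pi *+ 2))^-1 = 2^-1 * (Num.sqrt (s ^+ 2 * pi *+ 2))^-1.
  rewrite exprMn -mulrA -mulrnAr sqrtrM ?sqr_ge0// sqrtr_sqr ger0_norm//.
  by rewrite invfM.
set p := (Num.sqrt _)^-1; have p0 : 0 <= p by rewrite invr_ge0 sqrtr_ge0.
set u := (y - x) ^+ 2; pose w := u / (8 * s ^+ 2).
have s2 : s ^+ 2 != 0 by rewrite expf_neq0// gt_eqF.
have -> : - u / (s ^+ 2 *+ 2) = - (3 * w) - w.
  by rewrite /w -mulr_natr; field; rewrite expf_eq0 in s2.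
have -> : - u / ((2 * s) ^+ 2 *+ 2) = - w.
  by rewrite /w -mulr_natr; field; rewrite expf_eq0 in s2.
have -> : u = 8 * s ^+ 2 * w by rewrite /w; field; rewrite expf_eq0 in s2.
have w0 : 0 <= w by rewrite divr_ge0 ?sqr_ge0// mulr_ge0// sqr_ge0.
have e1 : expR (- (3 * w)) * w <= 2^-1.
  rewrite mulrC expRN ler_pdivrMr ?expR_gt0//.
  by have := expR_ge1Dx (3 * w); lra.
rewrite expRD (_ : _ * (_ * (_ * _)) =
  (expR (- (3 * w)) * w) * (8 * s ^+ 2 * (p * expR (- w)))); last by ring.
rewrite [leRHS](_ : _ = 2^-1 * (8 * s ^+ 2 * (p * expR (- w)))); last by ring.
apply: ler_wpM2r e1; apply: mulr_ge0; first by rewrite mulr_ge0// sqr_ge0.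
by rewrite mulr_ge0// expR_ge0.
Qed.

Lemma normal_sq_int (x s : R) : 0 < s ->
  leb.-integrable setT (EFin \o (fun y => (y - x) ^+ 2 * normal_pdf x s y)) /\
  \int[leb]_y ((y - x) ^+ 2 * normal_pdf x s y) <= 8 * s ^+ 2.
Proof.
move=> s0.
have i2 : leb.-integrable setT (EFin \o (fun y => 8 * s ^+ 2 * normal_pdf x (2 * s) y)).
  by apply: integrableZ_real; exact: integrable_normal_pdf.
have i1 : leb.-integrable setT (EFin \o (fun y => (y - x) ^+ 2 * normal_pdf x s y)).
  apply: le_integrable_real i2.
    apply: measurable_funM; last exact: measurable_normal_pdf.
    by apply: measurable_funX; exact: measurable_funB.
  move=> y; rewrite ger0_norm; first exact: normal_sq_le.
  by apply: mulr_ge0; [exact: sqr_ge0|exact: normal_pdf_ge0].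
split=> //.
rewrite (le_trans (le_Rintegral measurableT i1 i2 _))//.
  by move=> y _; exact: normal_sq_le.
rewrite RintegralZl//; last exact: integrable_normal_pdf.
by rewrite /Rintegral integral_normal_pdf mulr1.
Qed.

Lemma normal_abs_int (s : R) : 0 < s ->
  leb.-integrable setT (EFin \o (fun y => `|y| * normal_pdf 0 s y)).
Proof.
move=> s0.
have ig : leb.-integrable setT (EFin \o
    (fun y => normal_pdf 0 s y + (y - 0) ^+ 2 * normal_pdf 0 s y)).
  by apply: integrableD_real; [exact: integrable_normal_pdf|have [] := normal_sq_int 0 s0].
apply: le_integrable_real ig.
  by apply: measurable_funM; [exact: normr_measurable|exact: measurable_normal_pdf].
move=> y; rewrite normrM normr_id (ger0_norm (normal_pdf_ge0 _ _ _)) subr0.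
rewrite -[X in _ <= X + _]mul1r -mulrDl; apply: ler_wpM2r; first exact: normal_pdf_ge0.
by rewrite -(real_normK (num_real y)); have := sqr_ge0 (`|y| - 1); nra.
Qed.

Lemma normal_pdf_is_derive (s x : R) : s != 0 ->
  is_derive x 1 (normal_pdf 0 s) (- (x / s ^+ 2) * normal_pdf 0 s x).
Proof.
move=> s0; rewrite normal_pdfE// /normal_fun.
have s20 : s ^+ 2 != 0 by rewrite expf_neq0.
have -> : (fun x0 => normal_peak s * expR (- (x0 - 0) ^+ 2 / (s ^+ 2 *+ 2))) =
   normal_peak s *: (fun x0 => expR ((- (s ^+ 2 *+ 2)^-1) * x0 ^+ 2)).
  apply/funext => y /=; rewrite fctE /GRing.scale/=; congr (_ * expR _).
  by rewrite subr0 !mulNr [_^-1 * _]mulrC.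
apply: is_derive_eq.
rewrite subr0 /GRing.scale/= !mulr1.
rewrite [in RHS](_ : - x ^+ 2 / (s ^+ 2 *+ 2) = - (s ^+ 2 *+ 2)^-1 * x ^+ 2); last by rewrite !mulNr mulrC.
by field.
Qed.

(** Integration by parts on the line: over [[-(n+1), n+1]] the integral is a difference of boundary
    values of [H], and dominated convergence by [|h|] lets the interval grow. *)
Lemma Rintegral_derive_eq0 (H h : R -> R) :
  (forall x, is_derive x (1 : R) H (h x)) -> continuous h ->
  leb.-integrable setT (EFin \o h) ->
  H n.+1%:R @[n --> \oo] --> 0 -> H (- n.+1%:R) @[n --> \oo] --> 0 ->
  \int[leb]_x h x = 0.
Proof.
move=> dH ch ih H1 H2.
have mh : measurable_fun setT h by exact: continuous_measurable_fun.
pose I (n : nat) : set R := [set` `[- n.+1%:R, n.+1%:R]].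
have [||||_ _ c] := @Rintegral_dct _ _ _ leb (fun n x => \1_(I n) x * h x) h (fun x => `|h x|).
- by move=> n; apply: measurable_funM => //; apply: measurable_indic; exact: measurable_itv.
- move=> x; apply: cvg_near_cst; exists (Num.truncn `|x|) => // n /= xn.
  rewrite indicE mem_set ?mul1r// /I/= in_itv/= -ler_norml.
  by rewrite (le_trans (ltW (truncnS_gt `|x|)))// ler_nat ltnS.
- exact: integrable_abs.
- by move=> n x; rewrite normrM ler_piMl// indicE; case: (_ \in _) => //=; rewrite ?normr1 ?normr0.
have e n : \int[leb]_x (\1_(I n) x * h x) = H n.+1%:R - H (- n.+1%:R).
  have := @continuous_FTC2 R h H (- n.+1%:R) n.+1%:R.
  have lt0 : - n.+1%:R < n.+1%:R :> R by rewrite (@lt_trans _ _ 0)// ?oppr_lt0.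
  move=> /(_ lt0 (continuous_subspaceT ch)) FTC.
  have cH : continuous H.
    move=> x; apply: differentiable_continuous; apply/derivable1_diffP.
    by have [] := dH x.
  rewrite /Rintegral -[RHS]/(fine ((H n.+1%:R)%:E - (H (- n.+1%:R))%:E)%E) -FTC.
  - congr fine; rewrite [RHS]integral_mkcond; apply: eq_integral => x _.
    by rewrite patchE indicE /I; case: (x \in _); rewrite ?mul1r ?mul0r.
  - split => [x _||]; first by have [] := dH x.
    + exact/cvg_at_right_filter/cH.
    + exact/cvg_at_left_filter/cH.
  - by move=> x _; rewrite derive1E; have [_ ->] := dH x.
have c' : \int[leb]_x (\1_(I n) x * h x) @[n --> \oo] --> (0 : R).
  by under eq_fun do rewrite e; have := cvgB H1 H2; rewrite subr0; exact.
exact: (cvg_unique _ c c').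
Qed.

Lemma normal_pdf_decay (s x : R) : 0 < s -> 1 <= x ^+ 2 ->
  normal_pdf 0 s x <= 8 * s ^+ 2 * normal_peak (2 * s) / x ^+ 2.
Proof.
move=> s0 x1; rewrite ler_pdivlMr; last by rewrite (lt_le_trans _ x1).
have := normal_sq_le 0 x s0; rewrite subr0 mulrC => /le_trans; apply.
apply: ler_wpM2l; first by rewrite mulr_ge0// sqr_ge0.
by apply: normal_pdf_ub; rewrite gt_eqF// mulr_gt0.
Qed.

Lemma cvg_harmonic_sq (c : R) : c / n.+1%:R ^+ 2 @[n --> \oo] --> 0.
Proof.
rewrite -[X in _ --> X](mulr0 c); apply: cvgM; first exact: cvg_cst.
rewrite -[X in _ --> X](mulr0 (0 : R)).
under eq_fun do rewrite expr2 invfM.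
by apply: cvgM; exact: cvg_harmonic.
Qed.

(** The integral of [G z x = e^(s^2 z^2 / 2) cos(z x + t) p(x)] over [x] does not depend on [z].
    Since [p' = - (x / s^2) p], the [z]-derivative of the integrand is [e^(s^2 z^2 / 2)] times the
    [x]-derivative of [s^2 sin(z x + t) p(x)], which integrates to [0]; at [z = 0] the value is
    [cos t]. *)
Lemma normal_cf (s z t : R) : 0 < s ->
  \int[leb]_x (cos (z * x + t) * normal_pdf 0 s x) =
  expR (- (s ^+ 2 * z ^+ 2 / 2)) * cos t.
Proof.
move=> s0; have sN0 : s != 0 by rewrite gt_eqF.
have s2N0 : s ^+ 2 != 0 by rewrite expf_neq0.
pose p := normal_pdf 0 s.
have mp : measurable_fun setT p by exact: measurable_normal_pdf.
have p0 x : 0 <= p x by exact: normal_pdf_ge0.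
have ip : leb.-integrable setT (EFin \o p) by exact: integrable_normal_pdf.
have iap := normal_abs_int s0.
pose G (z x : R) := expR (s ^+ 2 / 2 * z ^+ 2) * (cos (z * x + t) * p x).
pose G' (z x : R) := expR (s ^+ 2 / 2 * z ^+ 2) *
  (s ^+ 2 * z * (cos (z * x + t) * p x) - sin (z * x + t) * x * p x).
have mG y : measurable_fun setT (G y).
  by apply: measurable_funM => //; apply: measurable_funM => //; exact: measurable_cos_lin.
have iG y : leb.-integrable setT (EFin \o G y).
  apply: le_integrable_real (integrableZ_real (expR (s ^+ 2 / 2 * y ^+ 2)) ip) => [|x]; first exact: mG.
  rewrite /G !normrM (ger0_norm (expR_ge0 _)) (ger0_norm (p0 x)).
  by apply: ler_wpM2l; [exact: expR_ge0|rewrite ler_piMl// cos_max].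
have dG y x : is_derive y (1 : R) (G ^~ x) (G' y x).
  rewrite /G /G'; apply: is_derive_eq.
  rewrite /GRing.scale/= !mulr1 ?mulr0 ?addr0.
  by field.
have sin_meas y : measurable_fun setT (fun x : R => sin (y * x + t)).
  apply: (measurableT_comp (f := @sin R)).
    by apply: continuous_measurable_fun; exact: continuous_sin.
  by apply: measurable_funD => //; exact: measurable_funM.
have D0 y : is_derive y (1 : R) (fun z => \int[leb]_x G z x) 0.
  (* [M] bounds [|z'|] for [z'] in []y - 1, y + 1[], so that [B] dominates the [z]-derivative near
     [y] and the integral may be differentiated under the sign. *)
  pose M := `|y| + 1.
  have M0 : 0 <= M by rewrite addr_ge0.
  pose B x := expR (s ^+ 2 / 2 * M ^+ 2) * (s ^+ 2 * M * p x + `|x| * p x).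
  have iB : leb.-integrable setT (EFin \o B).
    by apply: integrableZ_real; apply: integrableD_real => //; exact: integrableZ_real.
  have B0 x : 0 <= B x.
    by rewrite mulr_ge0 ?expR_ge0// addr_ge0// mulr_ge0// mulr_ge0// sqr_ge0.
  have I1 : `]y - 1, y + 1[%classic y by rewrite /= in_itv/=; lra.
  have der1 z' x : `]y - 1, y + 1[%classic z' -> setT x -> derivable (G ^~ x) z' 1.
    by move=> _ _; have [] := dG z' x.
  have GB z' x : `]y - 1, y + 1[%classic z' -> setT x -> `|partial1of2 G z' x| <= B x.
    move=> /= zI _; have zM : `|z'| <= M.
      move: zI; rewrite in_itv/= => /andP[z1 z2].
      rewrite -(subrK y z') (le_trans (ler_normD _ _))// addrC lerD2l.
      by rewrite ler_norml; apply/andP; split; lra.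
    rewrite partial1of2E; have [_ ->] := dG z' x.
    rewrite /G' /B normrM (ger0_norm (expR_ge0 _)); apply: ler_pM => //.
    - rewrite ler_expR ler_wpM2l// ?divr_ge0 ?sqr_ge0//.
      by rewrite -(real_normK (num_real z')) lerXn2r ?nnegrE.
    - rewrite (le_trans (ler_normB _ _))// lerD//.
        rewrite normrM [X in X * _]normrM [X in _ * X]normrM (ger0_norm (sqr_ge0 s)) (ger0_norm (p0 x)).
        apply: ler_pM; [by rewrite mulr_ge0// sqr_ge0|exact: mulr_ge0| |].
          by apply: ler_wpM2l => //; exact: sqr_ge0.
        by rewrite ler_piMl// cos_max.
      by rewrite !normrM (ger0_norm (p0 x)) ler_wpM2r// ler_piMl// sin_max.
  have E := @differentiation_under_integral R _ _ leb G setT measurableT y _ _ I1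
    (fun x _ => iG x) der1 B B0 iB GB.
  have DD := @derivable_under_integral R _ _ leb G setT measurableT y _ _ I1
    (fun x _ => iG x) der1 B B0 iB GB.
  apply: DeriveDef => //; rewrite -derive1E E.
  transitivity (\int[leb]_x (expR (s ^+ 2 / 2 * y ^+ 2) *
     (s ^+ 2 * y * (cos (y * x + t) * p x) - sin (y * x + t) * x * p x))).
    by apply: eq_Rintegral => x _; rewrite partial1of2E; have [_ ->] := dG y x.
  pose h x := s ^+ 2 * y * (cos (y * x + t) * p x) - sin (y * x + t) * x * p x.
  have ih : leb.-integrable setT (EFin \o h).
    have ig : leb.-integrable setT (EFin \o (fun x => s ^+ 2 * `|y| * p x + `|x| * p x)).
      by apply: integrableD_real => //; exact: integrableZ_real.
    apply: le_integrable_real ig => [|x].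
    - apply: measurable_funB.
        apply: measurable_funM => //; apply: measurable_funM => //; exact: measurable_cos_lin.
      apply: measurable_funM; last exact: mp.
      by apply: measurable_funM; [exact: sin_meas|exact: measurable_id].
    - rewrite (le_trans (ler_normB _ _))// lerD//.
        rewrite normrM [X in X * _]normrM [X in _ * X]normrM (ger0_norm (sqr_ge0 s)) (ger0_norm (p0 x)).
        apply: ler_wpM2l; first by rewrite mulr_ge0// sqr_ge0.
        by rewrite ler_piMl// cos_max.
      by rewrite !normrM (ger0_norm (p0 x)) ler_wpM2r// ler_piMl// sin_max.
  rewrite RintegralZl// -[X in _ * X]/(\int[leb]_x h x).
  suff -> : \int[leb]_x h x = 0 by rewrite mulr0.
  refine (@Rintegral_derive_eq0 (fun x => s ^+ 2 * (sin (y * x + t) * p x)) h _ _ ih _ _).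
  - move=> x; rewrite /h.
    have dp := normal_pdf_is_derive x sN0; rewrite -/p in dp.
    apply: is_derive_eq; rewrite /GRing.scale/= ?mulr1 ?mulr0 ?addr0.
    by field.
  - have cp : continuous p by exact: continuous_normal_pdf.
    have cl : continuous (fun x : R => y * x + t).
      by move=> x; apply: cvgD; [apply: cvgM; [exact: cvg_cst|exact: cvg_id]|exact: cvg_cst].
    move=> x; apply: cvgB.
      apply: cvgM; first exact: cvg_cst.
      apply: cvgM; last exact: cp.
      by apply: (cvg_comp _ _ (cl x)); exact: continuous_cos.
    apply: cvgM; last exact: cp.
    apply: cvgM; last exact: cvg_id.
    by apply: (cvg_comp _ _ (cl x)); exact: continuous_sin.
  - apply/cvgr0Pnorm_le => e e0.
    have := cvg_harmonic_sq (s ^+ 2 * (8 * s ^+ 2 * normal_peak (2 * s))).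
    move=> /cvgr0Pnorm_le/(_ e e0); apply: filterS => n; apply: le_trans.
    rewrite normrM (ger0_norm (sqr_ge0 s)) -mulrA [leRHS]normrM (ger0_norm (sqr_ge0 s)).
    rewrite ler_wpM2l ?sqr_ge0// normrM (ger0_norm (p0 _)).
    rewrite (le_trans (y := p n.+1%:R))//; first by rewrite ler_piMl// sin_max.
    rewrite (le_trans (normal_pdf_decay _ _))// ?ler_norm//.
    by rewrite expr_ge1// ler1n.
  - apply/cvgr0Pnorm_le => e e0.
    have := cvg_harmonic_sq (s ^+ 2 * (8 * s ^+ 2 * normal_peak (2 * s))).
    move=> /cvgr0Pnorm_le/(_ e e0); apply: filterS => n; apply: le_trans.
    rewrite normrM (ger0_norm (sqr_ge0 s)) -mulrA [leRHS]normrM (ger0_norm (sqr_ge0 s)).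
    rewrite ler_wpM2l ?sqr_ge0// normrM (ger0_norm (p0 _)).
    rewrite (le_trans (y := p (- n.+1%:R)))//; first by rewrite ler_piMl// sin_max.
    rewrite (le_trans (normal_pdf_decay _ _))// sqrrN ?ler_norm//.
    by rewrite expr_ge1// ler1n.
have := @is_derive_0_is_cst R (fun z => \int[leb]_x G z x) z 0 D0.
rewrite /G RintegralZl//; last first.
  have := integrableZ_real (expR (- (s ^+ 2 / 2 * z ^+ 2))) (iG z).
  apply: eq_integrable => // x _ /=; congr EFin; rewrite /G mulrA -expRD addNr.
  by rewrite expR0 mul1r.
have -> : \int[leb]_x G 0 x = cos t.
  rewrite /G expr0n/= mulr0 expR0.
  under eq_Rintegral do rewrite mul1r mul0r add0r.
  by rewrite RintegralZl// /Rintegral integral_normal_pdf mulr1.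
move=> <-; rewrite mulrA -expRD (_ : - _ + _ = 0) ?expR0 ?mul1r//.
by field.
Qed.

End gaussian.

(** * Convergence of characteristic functions *)

Section normal_prob_integral.
Context (R : realType).
Notation leb := (@lebesgue_measure R).

(** The Radon-Nikodym derivative with respect to Lebesgue measure agrees almost everywhere with the
    density, because both have the same integral over every measurable set. *)
Lemma integral_normal_prob (m s : R) (g : R -> R) (M : R) :
  measurable_fun setT g -> (forall x, `|g x| <= M) ->
  \int[normal_prob m s]_x g x = \int[leb]_x (g x * normal_pdf m s x).
Proof.
move=> mg gM; rewrite /Rintegral; congr fine.
have ig : (normal_prob m s).-integrable setT (EFin \o g).
  exact: (@integrable_bounded _ _ _ (normal_prob m s) g M).
rewrite -(Radon_Nikodym_change_of_variables (@normal_prob_dominates R m s) measurableT ig).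
have ae : ae_eq leb setT
    (Radon_Nikodym (charge_of_finite_measure (normal_prob m s)) leb) (EFin \o normal_pdf m s).
  apply: integral_ae_eq => //.
  - by apply: Radon_Nikodym_integrable; exact: normal_prob_dominates.
  - by apply/measurable_EFinP; exact: measurable_normal_pdf.
  - move=> E _ mE.
    by rewrite -Radon_Nikodym_integral//; exact: normal_prob_dominates.
apply: ae_eq_integral => //.
- apply: emeasurable_funM; first exact/measurable_EFinP.
  apply: (@measurable_int _ _ _ leb).
  by apply: Radon_Nikodym_integrable; exact: normal_prob_dominates.
- apply/measurable_EFinP; apply: measurable_funM => //; exact: measurable_normal_pdf.
- apply: filterS ae => x /= h _; rewrite h//.
Qed.
End normal_prob_integral.

(** Domination by a function of [y] alone makes [k] integrable for the product, as the first factor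
    has mass [1]; Fubini's theorem then applies. *)
Lemma Rintegral_swap d1 d2 (T1 : measurableType d1) (T2 : measurableType d2)
    (R : realType) (P : probability T1 R) (m2 : {sigma_finite_measure set T2 -> \bar R})
    (k : T1 -> T2 -> R) (h : T2 -> R) :
  measurable_fun setT (fun x : T1 * T2 => k x.1 x.2) ->
  m2.-integrable setT (EFin \o h) -> (forall x y, `|k x y| <= h y) ->
  [/\ \int[P]_x \int[m2]_y k x y = \int[m2]_y \int[P]_x k x y,
      measurable_fun setT (fun x => \int[m2]_y k x y) &
      measurable_fun setT (fun y => \int[P]_x k x y)].
Proof.
move=> mk ih kh.
have mk1 x : measurable_fun setT (k x).
  exact: (measurableT_comp mk (measurable_pair1 x)).
have mk2 y : measurable_fun setT (k ^~ y).
  exact: (measurableT_comp mk (measurable_pair2 y)).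
have i1 x : m2.-integrable setT (EFin \o k x) by exact: le_integrable_real ih.
have i2 y : P.-integrable setT (EFin \o k ^~ y).
  exact: (@integrable_bounded _ _ _ P (k ^~ y) (h y)).
have mk' : measurable_fun setT (fun x : T1 * T2 => (k x.1 x.2)%:E).
  exact/measurable_EFinP.
have ik : (P \x m2)%E.-integrable setT (fun x : T1 * T2 => (k x.1 x.2)%:E).
  apply/(integrable21ltyP P m2 mk'); move/integrableP: ih => [mh]; apply: le_lt_trans.
  apply: ge0_le_integral => //.
  - by move=> y _; exact: integral_ge0.
  - by apply: (@measurable_fun_fubini_tonelli_G _ _ _ _ _ P (fun x : T1 * T2 => `|(k x.1 x.2)%:E|%E)) => //; exact: measurableT_comp.
  - exact: measurableT_comp.
  move=> y _; rewrite (@le_trans _ _ (\int[P]_x (`|h y|)%:E)%E)//.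
    apply: ge0_le_integral => //.
    - by apply: measurableT_comp => //; apply/measurable_EFinP; exact: (mk2 y).
    - by move=> x _ /=; rewrite lee_fin (le_trans (kh x y))// ler_norm.
  rewrite (@le_trans _ _ ((`|h y|)%:E * P setT)%E)//; first by rewrite integral_cst.
  by rewrite probability_setT mule1.
split.
- rewrite /Rintegral; under eq_integral do rewrite -/(Rintegral _ _ _) -Rintegral_EFin//.
  rewrite (@Fubini _ _ _ _ _ P m2 _ ik)/=; congr fine.
  by apply: eq_integral => y _; rewrite Rintegral_EFin.
- by apply: measurableT_comp => //; exact: (measurable_fubini_F ik).
- by apply: measurableT_comp => //; exact: (measurable_fubini_G ik).
Qed.

Section modulus.
Context (R : realType).

(** Compactness gives a uniform [eta] on [[-(A+1), A+1]]. The margin [1] together with [eta < 1]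
    settles the rest: for [x] outside that interval, [y] is outside [[-A, A]] and both values
    vanish. *)
Lemma cpt_support_modulus (g : R -> R) (A e : R) : continuous g ->
  (forall x, A < `|x| -> g x = 0) -> 0 < e ->
  exists2 eta, 0 < eta & forall x y, `|y - x| < eta -> `|g y - g x| < e.
Proof.
move=> cg g0 e0.
have /compact_near_coveringP nc := @segment_compact R (- (A + 1)) (A + 1).
have : \forall eta \near (0 : R)^'+,
   [set` `[- (A + 1), A + 1]] `<=` [set x | forall y, `|y - x| < eta -> `|g y - g x| < e].
  apply: (nc R (0 : R)^'+ (fun eta x => forall y, `|y - x| < eta -> `|g y - g x| < e)).
  move=> x _.
  have e20 : 0 < e / 2 by rewrite divr_gt0.
  have := cg x => /cvgrPdist_lt/(_ _ e20)/nbhs_ballP[r /= r0 rP].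
  have r20 : 0 < r / 2 by rewrite divr_gt0.
  exists (ball x (r / 2), [set eta | eta < r / 2]) => /=.
    by split; [exact: nbhsx_ballx|exact: nbhs_right_lt].
  move=> [x' eta] /= [xx' er] y yx'.
  have h1 : `|g x - g x'| < e / 2.
    by apply: rP; apply: lt_trans xx' _; rewrite ltr_pdivrMr// ltr_pMr// ltr1n.
  have h2 : `|g x - g y| < e / 2.
    apply: rP; rewrite /ball/= (splitr r) -(subrKA x') (le_lt_trans (ler_normD _ _))//.
    by apply: ltrD => //; rewrite distrC; exact: lt_trans er.
  rewrite (splitr e) -(subrKA (g x)) (le_lt_trans (ler_normD _ _))//.
  by rewrite ltrD// distrC.
move=> H; have : \forall eta \near (0 : R)^'+, [/\ 0 < eta, eta < 1 &
   [set` `[- (A + 1), A + 1]] `<=` [set x | forall y, `|y - x| < eta -> `|g y - g x| < e]].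
  near=> eta; split; near: eta.
  - exact: nbhs_right_gt.
  - exact: nbhs_right_lt.
  - exact: H.
move=> /filter_ex[eta [eta0 eta1 etaP]]; exists eta => // x y xy.
have [xA|xA] := leP `|x| (A + 1).
  by apply: etaP => //=; rewrite in_itv/= -ler_norml.
have yA : A < `|y|.
  have : `|x| <= `|y| + `|y - x|.
    by rewrite -{1}(subKr y x) (le_trans (ler_normB _ _))//.
  lra.
by rewrite !g0 ?subrr ?normr0//; lra.
Unshelve. all: by end_near.
Qed.

(** Below the modulus [eta] the term [e] suffices, beyond it [2 M <= 2 M (y - x)^2 / eta^2]. A bound
    of this quadratic form can be integrated against a normal density of small variance. *)
Lemma cpt_support_sq_modulus (g : R -> R) (A M e : R) : continuous g ->
  (forall x, `|g x| <= M) -> (forall x, A < `|x| -> g x = 0) -> 0 < e ->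
  exists2 B, 0 <= B & forall x y, `|g y - g x| <= e + B * (y - x) ^+ 2.
Proof.
move=> cg gM g0 e0; have [eta eta0 etaP] := cpt_support_modulus cg g0 e0.
have M0 : 0 <= M by rewrite (le_trans _ (gM 0)).
exists (2 * M / eta ^+ 2); first by rewrite divr_ge0 ?sqr_ge0// mulr_ge0.
move=> x y; have [xy|xy] := ltP `|y - x| eta.
  rewrite (le_trans (ltW (etaP _ _ xy)))// lerDl mulr_ge0 ?sqr_ge0//.
  by rewrite divr_ge0 ?sqr_ge0// mulr_ge0.
rewrite (le_trans (ler_normB _ _))// (@le_trans _ _ (2 * M))//.
  by rewrite mulr_natl mulr2n lerD.
rewrite ler_wpDl ?(ltW e0)// mulrAC ler_pdivlMr ?exprn_gt0//.
rewrite ler_wpM2l ?mulr_ge0// -(real_normK (num_real (y - x))).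
by rewrite lerXn2r ?nnegrE// ltW.
Qed.
End modulus.

Section levy_continuity.
Context (R : realType).
Notation leb := (@lebesgue_measure R).

Section one_variable.
Context d (T : measurableType d) (P : probability T R) (S : T -> R).
Hypothesis mS : measurable_fun setT S.

(** A Gaussian is its own Fourier transform: [normal_cf] read backwards writes the kernel as a
    mixture of [cos(z (y - S))], so that its expectation is determined by the characteristic
    function of [S]. *)
Lemma gauss_kernel_cf (s y : R) : 0 < s ->
  let k z := \int[P]_w (cos (z * y - z * S w) * normal_pdf 0 s z) in
  measurable_fun setT k /\
  \int[P]_w expR (- (s ^+ 2 * (y - S w) ^+ 2 / 2)) = \int[leb]_z k z.
Proof.
move=> s0 k.
have [E _ mk] : [/\ \int[P]_w \int[leb]_z (cos (z * y - z * S w) * normal_pdf 0 s z) =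
   \int[leb]_z k z, measurable_fun setT (fun w => \int[leb]_z (cos (z * y - z * S w) * normal_pdf 0 s z))
   & measurable_fun setT k].
  apply: (@Rintegral_swap _ _ _ _ _ P leb
     (fun w z => cos (z * y - z * S w) * normal_pdf 0 s z) (normal_pdf 0 s)).
  - apply: measurable_funM.
      apply: (measurableT_comp (f := @cos R)).
        by apply: continuous_measurable_fun; exact: continuous_cos.
      apply: measurable_funB; first by apply: measurable_funM; [exact: measurable_snd|].
      apply: measurable_funM; first exact: measurable_snd.
      exact: measurableT_comp.
    apply: (measurableT_comp (f := normal_pdf 0 s)); last exact: measurable_snd.
    exact: measurable_normal_pdf.
  - exact: integrable_normal_pdf.
  - move=> w z; rewrite normrM (ger0_norm (normal_pdf_ge0 _ _ _)).
    by apply: ler_piMl; [exact: normal_pdf_ge0|exact: cos_max].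
split=> //; rewrite -E; apply: eq_Rintegral => w _.
have := normal_cf (y - S w) 0 s0; rewrite cos0 mulr1 => <-.
by apply: eq_Rintegral => z _; congr (cos _ * _); ring.
Qed.

(** The convolution of [g] with the centred normal density of standard deviation [s]. *)
Definition smoothing (s : R) (g : R -> R) (x : R) : R :=
  \int[leb]_y (g y * normal_pdf x s y).

Lemma smoothing_swap (s : R) (g : R -> R) (M : R) : 0 < s ->
  leb.-integrable setT (EFin \o g) ->
  let k y := \int[P]_w (g y * normal_pdf (S w) s y) in
  [/\ measurable_fun setT (fun w => smoothing s g (S w)), measurable_fun setT k &
  \int[P]_w smoothing s g (S w) = \int[leb]_y k y].
Proof.
move=> s0 ig k.
have [] := @Rintegral_swap _ _ _ _ _ P leb
    (fun w y => g y * normal_pdf (S w) s y) (fun y => `|g y| * normal_peak s).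
- apply: measurable_funM.
    by apply: (measurableT_comp (f := g)); [exact: integrable_real_meas ig|exact: measurable_snd].
  rewrite (_ : (fun x => _) = (fun x : T * R => normal_pdf 0 s (x.2 - S x.1))).
    apply: (measurableT_comp (f := normal_pdf 0 s)); first exact: measurable_normal_pdf.
    apply: measurable_funB; first exact: measurable_snd.
    by apply: measurableT_comp => //; exact: measurable_fst.
  by apply/funext => x; rewrite !normal_pdfE ?gt_eqF// /normal_fun subr0.
- have := integrableZ_real (normal_peak s) (integrable_abs ig).
  by apply: eq_integrable => // y _ /=; rewrite mulrC.
- move=> w y; rewrite normrM (ger0_norm (normal_pdf_ge0 _ _ _)).
  by apply: ler_wpM2l => //; apply: normal_pdf_ub; rewrite gt_eqF.
by [].
Qed.

Lemma smoothing_close (s : R) (g : R -> R) (M e B : R) (x : R) : 0 < s ->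
  measurable_fun setT g -> (forall x, `|g x| <= M) -> 0 <= B ->
  (forall x y, `|g y - g x| <= e + B * (y - x) ^+ 2) ->
  `|smoothing s g x - g x| <= e + B * (8 * s ^+ 2).
Proof.
move=> s0 mg gM B0 geB.
have ipdf : leb.-integrable setT (EFin \o normal_pdf x s) by exact: integrable_normal_pdf.
have pdf0 y : 0 <= normal_pdf x s y by exact: normal_pdf_ge0.
have mpdf : measurable_fun setT (normal_pdf x s) by exact: measurable_normal_pdf.
have ig : leb.-integrable setT (EFin \o (fun y => g y * normal_pdf x s y)).
  apply: le_integrable_real (integrableZ_real M ipdf) => [|y]; first exact: measurable_funM.
  by rewrite normrM (ger0_norm (pdf0 y)) ler_wpM2r.
have -> : g x = \int[leb]_y (g x * normal_pdf x s y).
  by rewrite RintegralZl// /Rintegral integral_normal_pdf mulr1.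
rewrite /smoothing -RintegralB//; last exact: integrableZ_real.
have [isq lsq] := normal_sq_int x s0.
have ib : leb.-integrable setT (EFin \o (fun y => e * normal_pdf x s y +
    B * ((y - x) ^+ 2 * normal_pdf x s y))).
  by apply: integrableD_real; exact: integrableZ_real.
apply: (le_trans (Rintegral_abs_le _ _ ib)).
- by apply: measurable_funB; apply: measurable_funM.
- move=> y; rewrite -mulrBl normrM (ger0_norm (pdf0 y)) mulrA -mulrDl.
  exact: ler_wpM2r.
rewrite RintegralD//; [|exact: integrableZ_real|exact: integrableZ_real].
rewrite !RintegralZl// [X in e * X](_ : _ = 1); last first.
  by rewrite /Rintegral integral_normal_pdf.
by rewrite mulr1 lerD2l ler_wpM2l.
Qed.

Lemma smoothing_Rintegral_close (s : R) (g : R -> R) (M e B : R) : 0 < s ->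
  leb.-integrable setT (EFin \o g) -> (forall x, `|g x| <= M) -> 0 <= B ->
  (forall x y, `|g y - g x| <= e + B * (y - x) ^+ 2) ->
  `|\int[P]_w smoothing s g (S w) - \int[P]_w g (S w)| <= e + B * (8 * s ^+ 2).
Proof.
move=> s0 ig gM B0 geB.
have mg := integrable_real_meas ig.
have cl x := smoothing_close x s0 mg gM B0 geB.
have [msm _ _] := smoothing_swap M s0 ig.
have igS : P.-integrable setT (EFin \o (g \o S)).
  by apply: (@integrable_bounded _ _ _ P _ M) => [|w]; [exact: measurableT_comp|exact: gM].
have isS : P.-integrable setT (EFin \o (fun w => smoothing s g (S w))).
  apply: (@integrable_bounded _ _ _ P _ (M + (e + B * (8 * s ^+ 2)))) => // w.
  by rewrite -(subrK (g (S w)) (smoothing _ _ _)) (le_trans (ler_normD _ _))// addrC lerD.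
rewrite -RintegralB//.
rewrite (le_trans (Rintegral_abs_le _ (fun w => cl (S w)) _))//.
- by apply: measurable_funB => //; exact: measurableT_comp.
- exact: finite_measure_integrable_cst.
- by rewrite Rintegral_prob_cst.
Qed.
End one_variable.

Context d (T : measurableType d) (P : probability T R) (S : nat -> T -> R).
Context d0 (T0 : measurableType d0) (P0 : probability T0 R) (S0 : T0 -> R).
Hypothesis mS : forall n, measurable_fun setT (S n).
Hypothesis mS0 : measurable_fun setT S0.
Hypothesis cvg_cf : forall z t,
  \int[P]_w cos (z * S n w + t) @[n --> \oo] --> \int[P0]_w cos (z * S0 w + t).

(** The expectations of the cosines are bounded by [1] and converge for each [z], so dominated
    convergence applies against the normal density in [z]. *)
Lemma cvg_gauss_kernel (s y : R) : 0 < s ->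
  \int[P]_w expR (- (s ^+ 2 * (y - S n w) ^+ 2 / 2)) @[n --> \oo] -->
  \int[P0]_w expR (- (s ^+ 2 * (y - S0 w) ^+ 2 / 2)).
Proof.
move=> s0.
under eq_fun do rewrite (gauss_kernel_cf P (mS _) y s0).2.
rewrite (gauss_kernel_cf P0 mS0 y s0).2.
have e d' (T' : measurableType d') (Q : probability T' R) (U : T' -> R) z :
    measurable_fun setT U ->
    \int[Q]_w (cos (z * y - z * U w) * normal_pdf 0 s z) =
    (\int[Q]_w cos ((- z) * U w + z * y)) * normal_pdf 0 s z.
  move=> mU; rewrite -RintegralZr//.
    by apply: eq_Rintegral => w _; rewrite mulNr addrC.
  apply: (@integrable_bounded _ _ _ Q _ 1) => [|w]; last exact: cos_max.
  exact: (measurableT_comp (measurable_cos_lin _ _) mU).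
have [] := @Rintegral_dct _ _ _ leb
  (fun n z => \int[P]_w (cos (z * y - z * S n w) * normal_pdf 0 s z))
  (fun z => \int[P0]_w (cos (z * y - z * S0 w) * normal_pdf 0 s z)) (normal_pdf 0 s).
- by move=> n; exact: (gauss_kernel_cf P (mS n) y s0).1.
- move=> z; rewrite e//; under eq_fun do rewrite e//.
  by apply: cvgM; [exact: cvg_cf|exact: cvg_cst].
- exact: integrable_normal_pdf.
- move=> n z; rewrite e// normrM (ger0_norm (normal_pdf_ge0 _ _ _)).
  apply: ler_piMl; first exact: normal_pdf_ge0.
  rewrite -[leRHS](Rintegral_prob_cst P 1).
  apply: Rintegral_abs_le => [|w|].
  + exact: (measurableT_comp (measurable_cos_lin _ _) (mS n)).
  + exact: cos_max.
  + exact: finite_measure_integrable_cst.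
by [].
Qed.

Lemma cvg_smoothing (s : R) (g : R -> R) (M : R) : 0 < s ->
  leb.-integrable setT (EFin \o g) ->
  \int[P]_w smoothing s g (S n w) @[n --> \oo] --> \int[P0]_w smoothing s g (S0 w).
Proof.
move=> s0 ig.
under eq_fun do rewrite (let: And3 _ _ h := smoothing_swap P (mS _) M s0 ig in h).
rewrite (let: And3 _ _ h := smoothing_swap P0 mS0 M s0 ig in h).
(* Up to the factor [normal_peak s], the density of deviation [s] is the kernel of
   [cvg_gauss_kernel] with parameter [s^-1]. *)
have e d' (T' : measurableType d') (Q : probability T' R) (U : T' -> R) y :
    measurable_fun setT U ->
    \int[Q]_w (g y * normal_pdf (U w) s y) =
    g y * normal_peak s * (\int[Q]_w expR (- (s^-1 ^+ 2 * (y - U w) ^+ 2 / 2))).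
  move=> mU; rewrite -RintegralZl//.
    apply: eq_Rintegral => w _; rewrite normal_pdfE ?gt_eqF// mulrA /normal_fun.
    by congr (_ * expR _); field; rewrite gt_eqF.
  apply: (@integrable_bounded _ _ _ Q _ 1) => [|w].
    apply: measurableT_comp => //; apply: measurableT_comp => //.
    apply: measurable_funM => //; apply: measurable_funM => //.
    by apply: measurable_funX; exact: measurable_funB.
  rewrite ger0_norm ?expR_ge0// -[leRHS]expR0 ler_expR oppr_le0.
  by rewrite divr_ge0// mulr_ge0// sqr_ge0.
have [] := @Rintegral_dct _ _ _ leb
  (fun n y => \int[P]_w (g y * normal_pdf (S n w) s y))
  (fun y => \int[P0]_w (g y * normal_pdf (S0 w) s y)) (fun y => `|g y| * normal_peak s).
- by move=> n; have [] := smoothing_swap P (mS n) M s0 ig.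
- move=> y; rewrite e//; under eq_fun do rewrite e//.
  apply: cvgM; first exact: cvg_cst.
  by apply: cvg_gauss_kernel; rewrite invr_gt0.
- have := integrableZ_real (normal_peak s) (integrable_abs ig).
  by apply: eq_integrable => // y _ /=; rewrite mulrC.
- move=> n y; rewrite -[leRHS](Rintegral_prob_cst P).
  apply: Rintegral_abs_le => [|w|].
  + apply: measurable_funM => //.
    rewrite (_ : (fun x => _) = (fun w => normal_pdf 0 s (y - S n w))).
      apply: (measurableT_comp (f := normal_pdf 0 s)); first exact: measurable_normal_pdf.
      exact: measurable_funB.
    by apply/funext => x; rewrite !normal_pdfE ?gt_eqF// /normal_fun subr0.
  + rewrite normrM (ger0_norm (normal_pdf_ge0 _ _ _)).
    by apply: ler_wpM2l => //; apply: normal_pdf_ub; rewrite gt_eqF.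
  + exact: finite_measure_integrable_cst.
by [].
Qed.

(** Replacing [g] by its smoothing costs an error uniform in [n], and for the smoothed function
    convergence is known. *)
Lemma cvg_cpt_support (g : R -> R) (A M : R) : continuous g ->
  (forall x, `|g x| <= M) -> (forall x, A < `|x| -> g x = 0) ->
  \int[P]_w g (S n w) @[n --> \oo] --> \int[P0]_w g (S0 w).
Proof.
move=> cg gM g0; have mg : measurable_fun setT g by exact: continuous_measurable_fun.
have ig : leb.-integrable setT (EFin \o g).
  have i1 : leb.-integrable setT (EFin \o \1_(`[- A, A]%classic : set R)).
    exact: integrable_indic_itv.
  apply: le_integrable_real (integrableZ_real M i1) => [|x]; first exact: mg.
  rewrite indicE; case: (boolP (x \in _)) => [_|]; first by rewrite mulr1.
  rewrite notin_setE/= in_itv/= -ler_norml => /negP; rewrite -ltNge => /g0 ->.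
  by rewrite normr0 mulr0.
apply/cvgrPdist_le => e e0.
(* Each of the two smoothing errors costs [e / 5] for the modulus and [e / 5] for [8 B s^2]; the
   convergence of the smoothed integrals costs the fifth part. *)
have e40 : 0 < e / 5 by rewrite divr_gt0.
have [B B0 gB] := cpt_support_sq_modulus cg gM g0 e40.
pose s := Num.sqrt (e / 5 / (8 * (B + 1))).
have B10 : 0 < 8 * (B + 1) by rewrite mulr_gt0// ltr_wpDl.
have s0 : 0 < s by rewrite sqrtr_gt0 divr_gt0.
have Bs : B * (8 * s ^+ 2) <= e / 5.
  rewrite /s sqr_sqrtr; last by rewrite ltW// divr_gt0.
  rewrite mulrCA mulrA mulrCA ler_piMr ?ltW//.
  by rewrite ltr_pdivrMr// mul1r ltr_pM2l// ltrDl.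
have /cvgrPdist_le/(_ _ e40) := cvg_smoothing M s0 ig.
apply: filterS => n h.
have h1 := smoothing_Rintegral_close P (mS n) s0 ig gM B0 gB.
have h2 := smoothing_Rintegral_close P0 mS0 s0 ig gM B0 gB.
set a := \int[P0]_w smoothing _ _ _ in h h2; set b := \int[P]_w smoothing _ _ _ in h h1.
move: h h1 h2; rewrite !ler_norml => /andP[? ?] /andP[? ?] /andP[? ?].
by apply/andP; split; lra.
Qed.

(** A continuous trapezoid in the role of the indicator of [[-M, M]], so that [cvg_cpt_support]
    applies to the cutoff itself. *)
Definition cutoff (M x : R) : R := Num.max 0 (Num.min 1 (M + 1 - `|x|)).

Lemma continuous_cutoff M : continuous (cutoff M).
Proof.
move=> x; apply: (@continuous_max R R (fun=> 0) (fun x => Num.min 1 (M + 1 - `|x|))).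
  exact: cvg_cst.
apply: (@continuous_min R R (fun=> 1) (fun x => M + 1 - `|x|)); first exact: cvg_cst.
by apply: cvgB; [exact: cvg_cst|exact: norm_continuous].
Qed.

Lemma cutoff_ge0 M x : 0 <= cutoff M x.
Proof. by rewrite le_max lexx. Qed.

Lemma cutoff_le1 M x : cutoff M x <= 1.
Proof. by rewrite ge_max ler01 ge_min lexx. Qed.

Lemma cutoff_out M x : M + 1 < `|x| -> cutoff M x = 0.
Proof.
move=> h; apply/eqP; rewrite eq_le cutoff_ge0 andbT ge_max lexx/= ge_min.
by apply/orP; right; lra.
Qed.

Lemma cutoff_in M x : `|x| <= M -> cutoff M x = 1.
Proof.
move=> h; apply/eqP; rewrite eq_le cutoff_le1/= le_max; apply/orP; right.
by rewrite le_min lexx/=; lra.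
Qed.

Let parts (e M x0 x1 y0 y1 k : R) : `|x1 - y1| <= M * (2 * k) -> `|x0 - y0| <= M * k ->
  M * k <= e / 4 -> `|y0 - y1| <= e / 4 -> `|x0 - x1| <= e.
Proof.
rewrite !ler_norml => /andP[? ?] /andP[? ?] ? /andP[? ?].
by apply/andP; split; lra.
Qed.

(** Tightness comes from the limit being a probability: for some [A] the function [cutoff A] has
    integral close to [1] under the limit law, and its own convergence carries this over to all
    large [n]. Then [g] may be multiplied by [cutoff A]. *)
Theorem levy_continuity (g : R -> R) (M : R) : continuous g ->
  (forall x, `|g x| <= M) ->
  \int[P]_w g (S n w) @[n --> \oo] --> \int[P0]_w g (S0 w).
Proof.
move=> cg gM; have M0 : 0 <= M by rewrite (le_trans _ (gM 0)).
have mg : measurable_fun setT g by exact: continuous_measurable_fun.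
have mc A : measurable_fun setT (cutoff A).
  by apply: continuous_measurable_fun; exact: continuous_cutoff.
have cn A x : `|cutoff A x| <= 1 by rewrite ger0_norm ?cutoff_le1// cutoff_ge0.
have gcM A x : `|g x * cutoff A x| <= M.
  by rewrite normrM -[leRHS]mulr1 ler_pM.
have bound d' (T' : measurableType d') (Q : probability T' R) (U : T' -> R) A :
    measurable_fun setT U ->
    `|\int[Q]_w g (U w) - \int[Q]_w (g (U w) * cutoff A (U w))| <=
    M * (1 - \int[Q]_w cutoff A (U w)).
  move=> mU.
  have icU : Q.-integrable setT (EFin \o (fun w => cutoff A (U w))).
    by apply: (@integrable_bounded _ _ _ Q _ 1) => //; exact: measurableT_comp.
  have i1 : Q.-integrable setT (EFin \o (fun w => 1 - cutoff A (U w))).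
    by apply: integrableB_real => //; exact: finite_measure_integrable_cst.
  rewrite -RintegralB//; last 2 first.
  - by apply: (@integrable_bounded _ _ _ Q _ M) => //; exact: measurableT_comp.
  - apply: (@integrable_bounded _ _ _ Q _ M) => //.
    by apply: measurable_funM; exact: measurableT_comp.
  rewrite -[X in _ <= _ * (X - _)](Rintegral_prob_cst Q).
  rewrite -RintegralB//; last exact: finite_measure_integrable_cst.
  rewrite -RintegralZl//; apply: Rintegral_abs_le.
  - apply: measurable_funB; first exact: measurableT_comp.
    by apply: measurable_funM; exact: measurableT_comp.
  - move=> w; rewrite -{1}(mulr1 (g (U w))) -mulrBr normrM.
    rewrite (@ger0_norm _ (1 - _)) ?subr_ge0 ?cutoff_le1//.
    by rewrite ler_wpM2r// subr_ge0 cutoff_le1.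
  - exact: integrableZ_real.
have cut0 : \int[P0]_w cutoff n%:R (S0 w) @[n --> \oo] --> (1 : R).
  have [] := @Rintegral_dct _ _ _ P0 (fun n w => cutoff n%:R (S0 w)) (fun=> 1) (fun=> 1).
  - by move=> n; exact: measurableT_comp.
  - move=> w; apply: cvg_near_cst; exists (Num.truncn `|S0 w|).+1 => // n /= wn.
    by rewrite cutoff_in// (le_trans (ltW (truncnS_gt `|S0 w|)))// ler_nat.
  - exact: finite_measure_integrable_cst.
  - by [].
  by move=> _ _; rewrite Rintegral_prob_cst.
apply/cvgrPdist_le => e e0.
have e1 : 0 < e / (4 * (M + 1)) by rewrite divr_gt0// mulr_gt0// ltr_wpDl.
have [A hA] : exists A : R, 1 - \int[P0]_w cutoff A (S0 w) <= e / (4 * (M + 1)).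
  have /cvgrPdist_le/(_ _ e1)[N _ /(_ N (leqnn N))/= h] := cut0.
  by exists N%:R; rewrite (le_trans (ler_norm _)).
have e4 : 0 < e / 4 by rewrite divr_gt0.
have cA : forall x, A + 1 < `|x| -> cutoff A x = 0 by exact: cutoff_out.
have /cvgrPdist_le/(_ _ e1) c1 := cvg_cpt_support (@continuous_cutoff A) (cn A) cA.
have cgA : continuous (fun x => g x * cutoff A x).
  by move=> x; apply: cvgM; [exact: cg|exact: continuous_cutoff].
have gA x : A + 1 < `|x| -> g x * cutoff A x = 0 by move=> /cA ->; rewrite mulr0.
have /cvgrPdist_le/(_ _ e4) c2 := cvg_cpt_support cgA (gcM A) gA.
near=> n.
have d1' : `|\int[P0]_w cutoff A (S0 w) - \int[P]_w cutoff A (S n w)| <= e / (4 * (M + 1)).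
  by near: n; exact: c1.
have d2' : `|\int[P0]_w (g (S0 w) * cutoff A (S0 w)) -
              \int[P]_w (g (S n w) * cutoff A (S n w))| <= e / 4.
  by near: n; exact: c2.
have b1 := bound _ _ P (S n) A (mS n).
have b2 := bound _ _ P0 S0 A mS0.
set x1 := \int[P]_w g _ in b1 *; set x0 := \int[P0]_w g _ in b2 *.
set y1 := \int[P]_w (g _ * _) in b1 d2'; set y0 := \int[P0]_w (g _ * _) in b2 d2'.
set z1 := \int[P]_w cutoff _ _ in b1 d1'; set z0 := \int[P0]_w cutoff _ _ in b2 d1' hA.
have MM : M * (e / (4 * (M + 1))) <= e / 4.
  have M1 : 0 < M + 1 by rewrite ltr_wpDl.
  have -> : M * (e / (4 * (M + 1))) = e / 4 * (M / (M + 1)) by field; rewrite gt_eqF.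
  by apply: ler_piMr; [exact: ltW|rewrite ler_pdivrMr// mul1r lerDl].
have q1 : M * (1 - z1) <= M * (2 * (e / (4 * (M + 1)))).
  by apply: ler_wpM2l => //; move: d1'; rewrite ler_norml => /andP[]; lra.
have q2 : M * (1 - z0) <= M * (e / (4 * (M + 1))) by apply: ler_wpM2l.
exact: parts (le_trans b1 q1) (le_trans b2 q2) MM d2'.
Unshelve. all: by end_near.
Qed.

End levy_continuity.

(** * Moments from characteristic functions *)

Section trigonometric_bounds.
Context (R : realType).
Implicit Types x : R.

Lemma sin_abs_le x : `|sin x| <= `|x|.
Proof.
wlog x0 : x / 0 <= x => [H|].
  have [/H//|x0] := leP 0 x.
  by rewrite -[X in sin X]opprK sinN normrN -(normrN x); apply: H; rewrite oppr_ge0 ltW.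
have [|c _ e] := @MVT_segment R sin cos 0 x x0.
  by apply: continuous_subspaceT; exact: continuous_sin.
move: e; rewrite sin0 !subr0 => ->.
by rewrite normrM ler_piMl// cos_max.
Qed.

Lemma one_sub_cosE x : 1 - cos x = 2 * sin (x / 2) ^+ 2.
Proof.
have := cos_mulr2n (x / 2); have -> : (x / 2) *+ 2 = x by rewrite -mulr_natr divfK.
by rewrite cos2sin2 => ->; ring.
Qed.

Lemma one_sub_cos_ge0 x : 0 <= 1 - cos x.
Proof. by rewrite subr_ge0 cos_le1. Qed.

Lemma one_sub_cos_le x : 1 - cos x <= x ^+ 2 / 2.
Proof.
rewrite one_sub_cosE.
have : sin (x / 2) ^+ 2 <= (x / 2) ^+ 2.
  rewrite -(real_normK (num_real (sin _))) -(real_normK (num_real (x / 2))).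
  by rewrite lerXn2r ?nnegrE// sin_abs_le.
lra.
Qed.

Lemma sub_sin_le x : `|x - sin x| <= `|x| ^+ 3 / 2.
Proof.
wlog x0 : x / 0 <= x => [H|].
  have [/H//|x0] := leP 0 x.
  have := H (- x); rewrite oppr_ge0 (ltW x0) sinN normrN opprK => /(_ isT).
  by rewrite addrC distrC.
have [|c] := @MVT_segment R (fun x => x - sin x) (fun x => 1 - cos x) 0 x x0.
  apply: continuous_subspaceT => y; apply: cvgB; first exact: cvg_id.
  exact: continuous_sin.
rewrite in_itv/= => /andP[c0 cx]; rewrite sin0 !subr0 => ->.
rewrite normrM !(ger0_norm x0) ger0_norm ?one_sub_cos_ge0//.
rewrite exprSr mulrAC ler_wpM2r// (le_trans (one_sub_cos_le c))//.
by rewrite ler_wpM2r// lerXn2r ?nnegrE.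
Qed.

(** Cubic near [0] and quadratic at infinity: integrable as soon as [x^2] is, yet of smaller order
    than [x^2] near [0]. The Taylor remainders of sine and cosine are measured by it. *)
Definition quad_err x := x ^+ 2 * Num.min 1 `|x|.

Lemma quad_err_ge0 x : 0 <= quad_err x.
Proof. by rewrite mulr_ge0 ?sqr_ge0// le_min ler01 normr_ge0. Qed.

Lemma quad_err_le x : quad_err x <= x ^+ 2.
Proof. by rewrite ler_piMr ?sqr_ge0// ge_min lexx. Qed.

Lemma sin_sub_le x : `|x - sin x| <= 2 * quad_err x.
Proof.
rewrite /quad_err -(real_normK (num_real x)).
have [x1|x1] := leP `|x| 1.
  rewrite (le_trans (sub_sin_le x))// -exprSr.
  have : 0 <= `|x| ^+ 3 by rewrite exprn_ge0.
  lra.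
rewrite (le_trans (ler_normB _ _))//.
rewrite (le_trans (lerD (lexx _) (sin_abs_le x)))// mulr1.
have : `|x| * 1 <= `|x| * `|x| by rewrite ler_wpM2l// ltW.
lra.
Qed.

(** With [y = x / 2], the difference is [2 (y - sin y) (y + sin y)] up to sign, of order [|x|^4],
    which settles [|x| <= 1]; for larger [x] the bounds [0 <= 1 - cos x <= x^2 / 2] suffice. *)
Lemma cos_quad_le x : `|1 - cos x - x ^+ 2 / 2| <= quad_err x.
Proof.
have h0 := one_sub_cos_ge0 x; have h1 := one_sub_cos_le x.
have e : x ^+ 2 / 2 - (1 - cos x) <= `|x| ^+ 4.
  rewrite one_sub_cosE.
  rewrite (_ : _ - _ = 2 * ((x / 2 - sin (x / 2)) * (x / 2 + sin (x / 2)))); last by field.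
  apply: le_trans (ler_norm _) _; rewrite normrM ger0_norm// normrM.
  have s1 := sub_sin_le (x / 2).
  have s2 : `|x / 2 + sin (x / 2)| <= 2 * `|x / 2|.
    by rewrite (le_trans (ler_normD _ _))// mulr_natl mulr2n lerD2l sin_abs_le.
  have h : `|x / 2| = `|x| / 2 by rewrite normrM (@ger0_norm _ 2^-1) ?invr_ge0.
  have := ler_pM (normr_ge0 _) (normr_ge0 _) s1 s2; rewrite h.
  have : 0 <= `|x| ^+ 4 by rewrite exprn_ge0.
  by rewrite !exprMn; move: (`|x|) => y; rewrite !exprS expr0; nra.
rewrite /quad_err ler_norml; have [x1|x1] := leP `|x| 1.
  have : `|x| ^+ 4 <= x ^+ 2 * `|x|.
    rewrite -(real_normK (num_real x)) -exprSr.
    by rewrite -[leRHS]mulr1 exprSr ler_wpM2l ?exprn_ge0.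
  have : 0 <= x ^+ 2 * `|x| by rewrite mulr_ge0 ?sqr_ge0.
  by move=> ? ?; apply/andP; split; lra.
rewrite mulr1; have := sqr_ge0 x.
by move=> ?; apply/andP; split; lra.
Qed.

Lemma expR_quad x : x <= 0 -> `|expR x - 1 - x| <= x ^+ 2.
Proof.
move=> x0; have h := expR_ge1Dx x; rewrite ger0_norm; last by lra.
have h2 := expR_ge1Dx (- x); rewrite expRN in h2.
have e0 := expR_gt0 x.
have : (1 - x) * expR x <= 1.
  rewrite (le_trans (ler_wpM2r (ltW e0) h2))// mulVf// gt_eqF//.
by nra.
Qed.

Lemma expR_mulcos_quad (a b : R) : a <= 0 ->
  `|1 - expR a * cos b + a| <= a ^+ 2 + b ^+ 2.
Proof.
move=> a0; have h := expR_quad a0; have h1 := one_sub_cos_le b; have h2 := one_sub_cos_ge0 b.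
have e0 := expR_gt0 a; have e1 : expR a <= 1 by rewrite -expR0 ler_expR.
rewrite (_ : _ + a = - (expR a - 1 - a) + expR a * (1 - cos b)); last by ring.
rewrite (le_trans (ler_normD _ _))// normrN lerD//.
rewrite normrM (ger0_norm (ltW e0)) (ger0_norm h2).
apply: (le_trans (ler_piMl h2 e1)); have := sqr_ge0 b; lra.
Qed.

(** A Lipschitz bound for the complex exponential on the left half-plane: moduli are at most [1]
    there, so the radial and the angular change can be estimated separately. *)
Lemma expR_cos_dist (a a' b t : R) : a <= 0 -> a' <= 0 ->
  `|expR a * cos (b + t) - expR a' * cos t| <= `|a - a'| + `|b|.
Proof.
move=> a0 a'0.
have ed : `|expR a - expR a'| <= `|a - a'|.
  wlog aa' : a a' a0 a'0 / a <= a' => [H|].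
    by have [/H->//|/ltW/H h] := leP a a'; rewrite distrC [leRHS]distrC h.
  rewrite distrC [leRHS]distrC !ger0_norm ?subr_ge0 ?ler_expR//.
  have := expR_ge1Dx (a - a'); have e1 : expR a' <= 1 by rewrite -expR0 ler_expR.
  have e0 := expR_gt0 a'; rewrite (_ : expR a = expR a' * expR (a - a')); last first.
    by rewrite -expRD addrCA subrr addr0.
  by have : a - a' <= 0; [lra|nra].
have cd : `|cos (b + t) - cos t| <= `|b|.
  wlog b0 : b t / 0 <= b => [H|].
    have [/H//|b0] := leP 0 b.
    have := H (- b) (b + t); rewrite oppr_ge0 (ltW b0) => /(_ isT).
    by rewrite addrA addNr add0r distrC normrN.
  have [||c _] := @MVT_segment R cos (fun x => - sin x) t (b + t).
  - by rewrite lerDr.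
  - by apply: continuous_subspaceT; exact: continuous_cos.
  by rewrite addrK => ->; rewrite normrM normrN ler_piMl// sin_max.
have -> : expR a * cos (b + t) - expR a' * cos t =
  (expR a - expR a') * cos (b + t) + expR a' * (cos (b + t) - cos t) by ring.
rewrite (le_trans (ler_normD _ _))// lerD// normrM.
  by rewrite (le_trans (ler_piMr _ (cos_max _))).
rewrite (le_trans (ler_piMl _ _))// ger0_norm ?expR_ge0//.
by rewrite -expR0 ler_expR.
Qed.

End trigonometric_bounds.

Section moments_from_cf.
Context d (T : measurableType d) (R : realType) (P : probability T R).
Variables (A : set T) (W : T -> R) (p v : R) (al be : R -> R).
Hypothesis mA : measurable A.
Hypothesis mW : measurable_fun setT W.
Hypothesis p0 : 0 <= p.
Hypothesis v0 : 0 <= v.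
Hypothesis al0 : forall z, al z <= 0.
Hypothesis cfW : forall z t,
  \int[P]_w (\1_A w * cos (z * W w + t)) = p * (expR (al z) * cos (be z + t)).
Hypothesis al_be : forall e, 0 < e -> exists2 r : R, 0 < r & forall z, `|z| <= r ->
  `|al z + v * z ^+ 2 / 2| <= e * z ^+ 2 /\ `|be z| <= e * z ^+ 2.

Let zk (k : nat) : R := k.+1%:R^-1.
Let zk0 k : 0 < zk k. Proof. by rewrite invr_gt0. Qed.

(** Difference quotients at [z = zk k]: they tend pointwise to [\1_A W^2 / 2] and [\1_A W], while
    their expectations are explicit in [al] and [be]. *)
Let C k w := \1_A w * ((1 - cos (zk k * W w)) / zk k ^+ 2).
Let S k w := \1_A w * (sin (zk k * W w) / zk k).

Let ind01 w : \1_A w = 0 :> R \/ \1_A w = 1 :> R.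
Proof. by rewrite indicE; case: (_ \in _); [right|left]. Qed.

Let mind : measurable_fun setT (\1_A : T -> R). Proof. exact: measurable_indic. Qed.

Let icos z t : P.-integrable setT (EFin \o (fun w => \1_A w * cos (z * W w + t))).
Proof.
apply: (@integrable_bounded _ _ _ P _ 1) => [|w].
  by apply: measurable_funM => //; exact: (measurableT_comp (measurable_cos_lin _ _) mW).
by have [->|->] := ind01 w; rewrite ?mul0r ?mul1r ?normr0 ?cos_max.
Qed.

Let near_zk (Q : R -> Prop) : (exists2 r : R, 0 < r & forall z, `|z| <= r -> Q z) ->
  \forall k \near \oo, Q (zk k).
Proof.
move=> [r r0 rQ]; have /cvgr0Pnorm_le/(_ _ r0) := @cvg_harmonic R.
by apply: filterS => k /= h; exact: rQ.
Qed.

(** At [z = 0] the hypothesis [al_be] forces [al 0 = be 0 = 0]. *)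
Let pE : \int[P]_w \1_A w = p.
Proof.
have ab0 e : 0 < e -> `|al 0| <= e * 0 ^+ 2 /\ `|be 0| <= e * 0 ^+ 2.
  move=> e0; have [r r0 rP] := al_be e0.
  have [] := rP 0; first by rewrite normr0 ltW.
  by rewrite expr0n/= mulr0 mul0r addr0.
have [] := ab0 1 ltr01; rewrite expr0n/= mulr0 !normr_le0 => /eqP a0 /eqP b0.
have := cfW 0 0; rewrite a0 b0 expR0 addr0 cos0 !mulr1 => <-.
by apply: eq_Rintegral => w _; rewrite mul0r addr0 cos0 mulr1.
Qed.

Let iA : P.-integrable setT (EFin \o (\1_A : T -> R)).
Proof. by have := integrable_indic P mA; exact: eq_integrable. Qed.

Let CE k : P.-integrable setT (EFin \o C k) /\
  \int[P]_w C k w = p * ((1 - expR (al (zk k)) * cos (be (zk k))) / zk k ^+ 2).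
Proof.
pose g w : R := (zk k ^+ 2)^-1 * (\1_A w - \1_A w * cos (zk k * W w + 0)).
have ig : P.-integrable setT (EFin \o g).
  by apply: integrableZ_real; apply: integrableB_real.
have -> : C k = g by apply/funext => w; rewrite /C /g addr0; ring.
split=> //; rewrite RintegralZl//; last exact: integrableB_real.
by rewrite RintegralB// pE cfW addr0; ring.
Qed.

(** The phase [t = pi / 2] extracts the imaginary part, up to sign. *)
Let SE k : \int[P]_w S k w = p * (expR (al (zk k)) * sin (be (zk k)) / zk k).
Proof.
transitivity (\int[P]_w ((- (zk k)^-1) * (\1_A w * cos (zk k * W w + pi / 2)))).
  by apply: eq_Rintegral => w _; rewrite cosDpihalf /S; ring.
by rewrite RintegralZl// cfW cosDpihalf; ring.
Qed.

Let cvg_C w : C k w @[k --> \oo] --> \1_A w * (W w ^+ 2 / 2).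
Proof.
apply: cvgM; first exact: cvg_cst.
apply/cvgrPdist_le => e e0.
pose r := e / (`|W w| ^+ 3 + 1).
have D0 : 0 < `|W w| ^+ 3 + 1 by rewrite ltr_wpDl// exprn_ge0.
have /near_zk : exists2 r : R, 0 < r & forall z : R, `|z| <= r -> `|z| * `|W w| ^+ 3 <= e.
  exists r; first by rewrite divr_gt0.
  move=> z; rewrite /r ler_pdivlMr// => h; apply: le_trans h.
  by rewrite ler_wpM2l// lerDl.
apply: filterS => k; rewrite (ger0_norm (ltW (zk0 k))) => h.
have z0 := zk0 k; have zN : zk k != 0 by rewrite gt_eqF.
have -> : W w ^+ 2 / 2 - (1 - cos (zk k * W w)) / zk k ^+ 2 =
   - ((1 - cos (zk k * W w) - (zk k * W w) ^+ 2 / 2) / zk k ^+ 2).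
  by field.
rewrite normrN normrM normfV (ger0_norm (sqr_ge0 _)) ler_pdivrMr ?exprn_gt0//.
apply: (le_trans (cos_quad_le _)); apply: (@le_trans _ _ (`|zk k * W w| ^+ 3)).
  by rewrite /quad_err [leRHS]exprSr real_normK ?num_real// ler_wpM2l ?sqr_ge0// ge_min lexx orbT.
rewrite normrM (ger0_norm (ltW z0)) exprMn.
rewrite (_ : zk k ^+ 3 * _ = (zk k * `|W w| ^+ 3) * zk k ^+ 2); last by ring.
by rewrite ler_wpM2r// sqr_ge0.
Qed.

Let cvg_intC : \int[P]_w C k w @[k --> \oo] --> p * (v / 2).
Proof.
apply: (@cvg_trans _ ((fun k => p * ((1 - expR (al (zk k)) * cos (be (zk k))) / zk k ^+ 2)) @ \oo)).
  by under [X in _ --> X @ _]eq_fun do rewrite -(CE _).2.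
apply: cvgM; first exact: cvg_cst.
apply/cvgrPdist_le => e e0.
pose e' := Num.min (e / 2) 1.
have e'0 : 0 < e' by rewrite lt_min divr_gt0//= ltr01.
have [r r0 rP] := al_be e'0.
(* As [al] is close to [- v z^2 / 2] and [be] is small, the remainder [al^2 + be^2] of
   [expR_mulcos_quad] is at most [((v + 1)^2 + 1) z^3]; the last bound in [r1] makes this at most
   [(e / 2) z^2]. *)
pose r1 := Num.min r (Num.min 1 (e / (2 * ((v + 1) ^+ 2 + 1)))).
have D0 : 0 < 2 * ((v + 1) ^+ 2 + 1) by rewrite mulr_gt0// ltr_wpDl// sqr_ge0.
have r10 : 0 < r1 by rewrite !lt_min r0 ltr01 divr_gt0.
have : \forall k \near \oo, `|zk k| <= r1.
  by apply: (@near_zk (fun z => `|z| <= r1)); exists r1.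
apply: filterS => k; have z0 := zk0 k; rewrite (ger0_norm (ltW z0)).
rewrite !le_min => /and3P[zr z1 ze].
have [h1 h2] : `|al (zk k) + v * zk k ^+ 2 / 2| <= e' * zk k ^+ 2 /\ `|be (zk k)| <= e' * zk k ^+ 2.
  by apply: rP; rewrite (ger0_norm (ltW z0)).
have := expR_mulcos_quad (be (zk k)) (al0 (zk k)).
set a := al _ in h1 *; set b := be _ in h2 *; set z := zk k in h1 h2 *.
move=> h3; have zN : z != 0 by rewrite gt_eqF.
have z2 : 0 < z ^+ 2 by rewrite exprn_gt0.
have -> : v / 2 - (1 - expR a * cos b) / z ^+ 2 =
   ((a + v * z ^+ 2 / 2) - (1 - expR a * cos b + a)) / z ^+ 2 by field.
rewrite normrM normfV (ger0_norm (ltW z2)) ler_pdivrMr//.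
rewrite (le_trans (ler_normB _ _))// (le_trans (lerD h1 h3))//.
have e'1 : e' <= 1 by rewrite ge_min lexx orbT.
have e'2 : e' <= e / 2 by rewrite ge_min lexx.
have az : `|a| <= (v + 1) * z ^+ 2.
  rewrite -(addrK (v * z ^+ 2 / 2) a) (le_trans (ler_normB _ _))//.
  rewrite (le_trans (lerD h1 (lexx _)))// ger0_norm; last by rewrite divr_ge0 ?mulr_ge0// ltW.
  have ez : e' * z ^+ 2 <= z ^+ 2 by rewrite ler_piMl// ltW.
  have vz : 0 <= v * z ^+ 2 by rewrite mulr_ge0// ltW.
  by lra.
have bz : `|b| <= z ^+ 2 by rewrite (le_trans h2)// ler_piMl// ltW.
have a2 : a ^+ 2 <= ((v + 1) ^+ 2 * z) * z ^+ 2.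
  rewrite -(real_normK (num_real a)).
  apply: (@le_trans _ _ (((v + 1) * z ^+ 2) ^+ 2)).
    by rewrite lerXn2r ?nnegrE// mulr_ge0 ?addr_ge0// ltW.
  rewrite (_ : _ ^+ 2 = ((v + 1) ^+ 2 * z) * z ^+ 2 * z); last by ring.
  apply: ler_piMr => //; apply: mulr_ge0; last exact: ltW.
  by apply: mulr_ge0; [exact: sqr_ge0|exact: ltW].
have b2 : b ^+ 2 <= z * z ^+ 2.
  rewrite -(real_normK (num_real b)).
  apply: (@le_trans _ _ ((z ^+ 2) ^+ 2)); first by rewrite lerXn2r ?nnegrE// ltW.
  rewrite (_ : (z ^+ 2) ^+ 2 = z * z ^+ 2 * z); last by ring.
  by apply: ler_piMr => //; apply: mulr_ge0; exact: ltW.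
have ze' : z * ((v + 1) ^+ 2 + 1) <= e / 2.
  by move: ze; rewrite -/z ler_pdivlMr//; lra.
by have := ler_wpM2r (ltW z2) ze'; have := ler_wpM2r (ltW z2) e'2; lra.
Qed.

Let C_ge0 k w : 0 <= C k w.
Proof.
rewrite /C; have [->|->] := ind01 w; rewrite ?mul0r ?mul1r//.
by rewrite divr_ge0 ?one_sub_cos_ge0// sqr_ge0.
Qed.

Let mW2 : measurable_fun setT (fun w => \1_A w * (W w ^+ 2 / 2)).
Proof.
by apply: measurable_funM => //; apply: measurable_funM => //; exact: measurable_funX.
Qed.

(** No moment of [W] is assumed: the quotients [C k] are nonnegative with convergent integrals, so
    Fatou's lemma bounds the integral of their limit. *)
Let iW2 : P.-integrable setT (EFin \o (fun w => \1_A w * (W w ^+ 2 / 2))).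
Proof.
apply/integrableP; split; first exact/measurable_EFinP.
rewrite (@le_lt_trans _ _ (limn_einf (fun k => \int[P]_w (C k w)%:E)%E))//; last first.
  have c : (fun k => \int[P]_w (C k w)%:E)%E @ \oo --> (p * (v / 2))%:E.
    apply/fine_cvgP; split; last exact: cvg_intC.
    by near=> k; rewrite Rintegral_EFin; [|have [] := CE k].
  by rewrite is_cvg_limn_einfE; [rewrite (cvg_lim _ c)// ltry|apply/cvg_ex; eexists; exact: c].
have := @fatou _ _ _ P setT measurableT (fun k w => (C k w)%:E).
have mC k : measurable_fun setT (fun w => (C k w)%:E).
  by apply/measurable_EFinP; exact: integrable_real_meas (CE k).1.
move=> /(_ mC (fun k w _ => C_ge0 k w)); apply: le_trans.
rewrite le_eqVlt; apply/orP; left; apply/eqP; apply: eq_integral => w _.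
have c : (fun k => (C k w)%:E) @ \oo --> (\1_A w * (W w ^+ 2 / 2))%:E.
  by apply/fine_cvgP; split; [exact: nearW|exact: cvg_C].
rewrite is_cvg_limn_einfE; last by apply/cvg_ex; eexists; exact: c.
rewrite (cvg_lim _ c)//= ger0_norm//.
by have [->|->] := ind01 w; rewrite ?mul0r ?mul1r// divr_ge0// sqr_ge0.
Unshelve. all: by end_near.
Qed.

Lemma sq_integrable_from_cf : P.-integrable setT (EFin \o (fun w => \1_A w * W w ^+ 2)).
Proof.
have := integrableZ_real 2 iW2; apply: eq_integrable => // w _ /=.
by congr EFin; field.
Qed.

(** Once [W^2] is integrable on [A], the inequality [1 - cos x <= x^2 / 2] makes [\1_A W^2 / 2]
    dominate the quotients [C k], and the limit of their integrals is known. *)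
Lemma second_moment_from_cf : \int[P]_w (\1_A w * W w ^+ 2) = p * v.
Proof.
have [_ _ c] : [/\ measurable_fun setT (fun w => \1_A w * (W w ^+ 2 / 2)),
   P.-integrable setT (EFin \o (fun w => \1_A w * (W w ^+ 2 / 2))) &
   \int[P]_w C k w @[k --> \oo] --> \int[P]_w (\1_A w * (W w ^+ 2 / 2))].
  apply: (Rintegral_dct _ cvg_C iW2) => [k|k w]; first exact: integrable_real_meas (CE k).1.
  rewrite ger0_norm// /C; have [->|->] := ind01 w; rewrite ?mul0r ?mul1r//.
  rewrite ler_pdivrMr ?exprn_gt0// (le_trans (one_sub_cos_le _))// le_eqVlt.
  by apply/orP; left; apply/eqP; field.
have e : \int[P]_w (\1_A w * (W w ^+ 2 / 2)) = p * (v / 2) by exact: (cvg_unique _ c cvg_intC).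
transitivity (\int[P]_w (2 * (\1_A w * (W w ^+ 2 / 2)))).
  by apply: eq_Rintegral => w _; field.
by rewrite RintegralZl// e; field.
Qed.

(** [|W| <= 1 + W^2] dominates the quotients [S k], whose expectations tend to [0] because [be z] is
    of smaller order than [z^2]. *)
Lemma first_moment_from_cf : P.-integrable setT (EFin \o (fun w => \1_A w * W w)) /\
  \int[P]_w (\1_A w * W w) = 0.
Proof.
have ig : P.-integrable setT (EFin \o (fun w => 1 + \1_A w * W w ^+ 2)).
  apply: integrableD_real; last exact: sq_integrable_from_cf.
  exact: finite_measure_integrable_cst.
have sW k w : `|S k w| <= 1 + \1_A w * W w ^+ 2.
  rewrite /S; have [->|->] := ind01 w; first by rewrite !mul0r normr0 addr0.
  rewrite !mul1r normrM normfV (ger0_norm (ltW (zk0 k))) ler_pdivrMr//.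
  apply: (le_trans (sin_abs_le _)); rewrite normrM (ger0_norm (ltW (zk0 k))) mulrC.
  rewrite ler_wpM2r ?ltW// -(real_normK (num_real (W w))).
  by have := sqr_ge0 (`|W w| - 1); nra.
have [] := @Rintegral_dct _ _ _ P S (fun w => \1_A w * W w) _ _ _ ig sW.
- move=> k; apply: measurable_funM => //; apply: measurable_funM => //.
  apply: (measurableT_comp (f := @sin R)).
    by apply: continuous_measurable_fun; exact: continuous_sin.
  exact: measurable_funM.
- move=> w; apply: cvgM; first exact: cvg_cst.
  apply/cvgrPdist_le => e e0.
  have D0 : 0 < `|W w| ^+ 3 + 1 by rewrite ltr_wpDl// exprn_ge0.
  have /near_zk : exists2 r : R, 0 < r & forall z : R, `|z| <= r -> `|z| ^+ 2 * `|W w| ^+ 3 <= e.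
    exists (Num.min 1 (e / (`|W w| ^+ 3 + 1))); first by rewrite lt_min ltr01 divr_gt0.
    move=> z; rewrite le_min => /andP[z1 ze].
    have h : `|z| * (`|W w| ^+ 3 + 1) <= e by rewrite -ler_pdivlMr.
    have : 0 <= `|W w| ^+ 3 by rewrite exprn_ge0.
    by have := normr_ge0 z; nra.
  apply: filterS => k; have z0 := zk0 k; have zN : zk k != 0 by rewrite gt_eqF.
  rewrite (ger0_norm (ltW z0)) => h.
  have -> : W w - sin (zk k * W w) / zk k = (zk k * W w - sin (zk k * W w)) / zk k by field.
  rewrite normrM normfV (ger0_norm (ltW z0)) ler_pdivrMr//.
  apply: (le_trans (sub_sin_le _)); rewrite normrM (ger0_norm (ltW z0)) exprMn.
  have : 0 <= zk k ^+ 2 * `|W w| ^+ 3 by rewrite mulr_ge0 ?exprn_ge0// ltW.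
  by move: h; rewrite !exprS !expr0 => *; nra.
move=> _ iW c; split=> //.
suff c0 : \int[P]_w S k w @[k --> \oo] --> (0 : R) by exact: (cvg_unique _ c c0).
under eq_fun do rewrite SE.
rewrite -(mulr0 p); apply: cvgM; first exact: cvg_cst.
apply/cvgr0Pnorm_le => e e0.
have [r r0 rP] := al_be e0.
have : \forall k \near \oo, `|zk k| <= Num.min r 1.
  by apply: (@near_zk (fun z => `|z| <= Num.min r 1)); exists (Num.min r 1) => //; rewrite lt_min r0 ltr01.
apply: filterS => k; have z0 := zk0 k; rewrite (ger0_norm (ltW z0)) le_min => /andP[zr z1].
have [_ h] : `|al (zk k) + v * zk k ^+ 2 / 2| <= e * zk k ^+ 2 /\ `|be (zk k)| <= e * zk k ^+ 2.
  by apply: rP; rewrite (ger0_norm (ltW z0)).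
rewrite !normrM normfV (ger0_norm (ltW z0)) ler_pdivrMr//.
rewrite (@le_trans _ _ `|be (zk k)|)//.
  apply: (le_trans (ler_piMl _ _)) => //; last exact: sin_abs_le.
  by rewrite ger0_norm ?expR_ge0// -expR0 ler_expR.
apply: (le_trans h); apply: ler_wpM2l; first exact: ltW.
by rewrite expr2; apply: ler_piMl => //; exact: ltW.
Qed.

End moments_from_cf.

(** * The Levy exponent under finite second moments *)

Section complex_parts.
Context (R : realType).
Local Open Scope complex_scope.

Lemma cexp_imag (y : R) : cexp ('i * y%:C) = cos y +i* sin y.
Proof. by rewrite /cexp /=; congr (_ +i* _); rewrite !mul0r ?mul1r ?mulr0 ?subr0 ?addr0 ?add0r expR0 mul1r. Qed.

Lemma cexp_mulr (a b l : R) :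
  cexp ((a +i* b) * l%:C) = (expR (l * a) * cos (l * b)) +i* (expR (l * a) * sin (l * b)).
Proof.
rewrite /cexp /=; congr (_ +i* _); rewrite ?mulr0 ?subr0 ?addr0 ?add0r;
  by rewrite ![_ * l]mulrC.
Qed.

Lemma levy_exponentE (a gamma : R) (nu : {measure set (measurableTypeR R) -> \bar R}) z :
  levy_exponent a gamma nu z =
  (\int[nu]_x (cos (x * z) - 1) - a * z ^+ 2 / 2) +i*
  (gamma * z + \int[nu]_x (sin (x * z) - x * z * \1_(`[-1, 1]%classic) x)).
Proof.
rewrite /levy_exponent /Cintegral.
under eq_Rintegral do rewrite cexp_imag.
under [X in _ +i* X]eq_Rintegral do rewrite cexp_imag.
have e1 : \int[nu]_x complex.Re ((cos (x * z) +i* sin (x * z)) - 1 -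
    'i * (x * z * \1_(`[-1, 1]%classic) x)%:C) = \int[nu]_x (cos (x * z) - 1).
  by apply: eq_Rintegral => x _ /=; ring.
have e2 : \int[nu]_x complex.Im ((cos (x * z) +i* sin (x * z)) - 1 -
    'i * (x * z * \1_(`[-1, 1]%classic) x)%:C) =
    \int[nu]_x (sin (x * z) - x * z * \1_(`[-1, 1]%classic) x).
  by apply: eq_Rintegral => x _ /=; ring.
rewrite e1 e2; set u := \int[nu]_x _; set w := \int[nu]_x _.
apply/eqP; rewrite eq_complex /=; apply/andP; split; apply/eqP; ring.
Qed.

Lemma complex_eqP (a b a' b' : R) : a +i* b = a' +i* b' -> a = a' /\ b = b'.
Proof. by case. Qed.
End complex_parts.

Section unit_cube.
Context (R : realType) (d : nat).

Lemma measurable_box (a b : 'rV[R]_d) :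
  measurable [set x : 'rV[R]_d | forall i, x ord0 i \in `[a ord0 i, b ord0 i]].
Proof.
rewrite (_ : [set x | _] = \bigcap_(i in [set: 'I_d])
   ((fun x : 'rV[R]_d => x ord0 i) @^-1` [set` `[a ord0 i, b ord0 i]])); last first.
  by apply/seteqP; split => [x H i _|x H i]; [exact: H|exact: (H i)].
apply: fin_bigcap_measurable => [|i _]; first exact: finite_finset.
by rewrite -[X in measurable X]setTI; exact: measurable_coord_mx.
Qed.

Lemma bounded_set_box (M : R) (A : set 'rV[R]_d) :
  (forall x i, A x -> `|x ord0 i| <= M) -> bounded_set A.
Proof.
move=> H; exists (Num.max 0 M); split; first by rewrite num_real.
move=> N; rewrite gt_max => /andP[N0 MN] x Ax /=.
rewrite [X in X <= _]mx_normrE; apply: bigmax_le; first exact: ltW.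
move=> [i j] _ /=; rewrite ord1; exact: le_trans (H _ _ Ax) (ltW MN).
Qed.

Lemma bounded_set_rV (A : set 'rV[R]_d) : bounded_set A ->
  exists M : R, forall x i, A x -> `|x ord0 i| <= M.
Proof.
move=> [M [_ H]]; exists (`|M| + 1) => x i Ax.
have := H (`|M| + 1); rewrite ltr_pwDr// ?ler_norm// => /(_ isT) /(_ x Ax) /=.
apply: le_trans; rewrite [leRHS]mx_normrE.
exact: (le_bigmax _ (fun ij : 'I_1 * 'I_d => `|x ij.1 ij.2|) (ord0, i)).
Qed.

Lemma unit_cube_bounded_borel : bounded_borel (@unit_cube R d).
Proof.
split.
  have := measurable_box (0 : 'rV[R]_d) (const_mx 1).
  by under eq_set do under eq_forall do rewrite !mxE.
apply: (@bounded_set_box 1) => x i /(_ i); rewrite in_itv/= => /andP[x0 x1].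
by rewrite ger0_norm.
Qed.

Lemma unit_cube_vol : lebesgue_rV R d (@unit_cube R d) = 1%E.
Proof.
have := @lebesgue_rV_box R d 0 (const_mx 1).
under eq_set do under eq_forall do rewrite !mxE.
move=> -> => [|i]; last by rewrite !mxE.
by rewrite big1// => i _; rewrite !mxE subr0.
Qed.
End unit_cube.

(** * Integrals against a Levy measure *)

Section levy_measure.
Context (R : realType) (nu : {measure set (measurableTypeR R) -> \bar R}).
Local Notation intble f := (nu.-integrable setT (EFin \o f)).
Hypothesis lnu : is_levy_measure nu.

Let meas_cont (g : R -> R) : continuous g -> measurable_fun [set: measurableTypeR R] g.
Proof. by move=> cg; exact: (continuous_measurable_fun cg). Qed.

Let mcos z : measurable_fun [set: measurableTypeR R] (fun x : R => cos (x * z)).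
Proof.
apply: meas_cont => x; apply: (cvg_comp (fun x => x * z) cos); last exact: continuous_cos.
by apply: cvgM; [exact: cvg_id|exact: cvg_cst].
Qed.

Let msin z : measurable_fun [set: measurableTypeR R] (fun x : R => sin (x * z)).
Proof.
apply: meas_cont => x; apply: (cvg_comp (fun x => x * z) sin); last exact: continuous_sin.
by apply: cvgM; [exact: cvg_id|exact: cvg_cst].
Qed.

Let mid : measurable_fun [set: measurableTypeR R] (fun x : R => x).
Proof. by apply: meas_cont => x; exact: cvg_id. Qed.

Let mI : measurable_fun [set: measurableTypeR R] (\1_(`[-1, 1]%classic : set R) : R -> R).
Proof. by apply: measurable_indic; exact: measurable_itv. Qed.

Let imin : intble (fun x : R => Num.min 1 (x ^+ 2)).
Proof.
apply/integrableP; split.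
  by apply/measurable_EFinP; apply: measurable_minr => //; exact: measurable_funX.
have [_] := lnu; apply: le_lt_trans.
rewrite le_eqVlt; apply/orP; left; apply/eqP; apply: eq_integral => x _ /=.
by rewrite ger0_norm// le_min ler01 sqr_ge0.
Qed.

Lemma levy_cos_int z : intble (fun x : R => cos (x * z) - 1).
Proof.
apply: le_integrable_real (integrableZ_real (2 + z ^+ 2) imin) => [|x].
  exact: measurable_funB.
rewrite distrC ger0_norm ?one_sub_cos_ge0// minr_pMr ?addr_ge0 ?sqr_ge0// le_min.
have h1 := one_sub_cos_le (x * z); have h2 := cos_geN1 (x * z).
have z0 := sqr_ge0 z; have x0 := sqr_ge0 x; rewrite exprMn in h1.
have xz0 : 0 <= x ^+ 2 * z ^+ 2 by rewrite mulr_ge0.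
by apply/andP; split; lra.
Qed.

Lemma levy_sin_int z : intble (fun x : R => sin (x * z) - x * z * \1_(`[-1, 1]%classic) x).
Proof.
apply: le_integrable_real (integrableZ_real (1 + 2 * z ^+ 2) imin) => [|x].
  by apply: measurable_funB => //; apply: measurable_funM => //; exact: measurable_funM.
have z0 := sqr_ge0 z; have x0 := sqr_ge0 x.
rewrite indicE; case: (boolP (_ \in _)); rewrite ?inE ?notin_setE/= in_itv/= -ler_norml.
  move=> x1; rewrite mulr1 distrC; apply: (le_trans (sin_sub_le _)).
  rewrite min_r; last by rewrite -(real_normK (num_real x)) expr_le1.
  have := quad_err_le (x * z); rewrite exprMn => h.
  have : 0 <= x ^+ 2 * z ^+ 2 by rewrite mulr_ge0.
  lra.
move=> /negP; rewrite -ltNge => x1; rewrite mulr0 subr0 min_l; last first.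
  by rewrite -(real_normK (num_real x)) expr_ge1// ltW.
by rewrite (le_trans (sin_max _))// mulr1; lra.
Qed.

(** Fatou's lemma for the quotients [(1 - cos (x z)) / z^2] at [z = 1 / (k + 1)]. This transfers a
    finite second moment from the basis to its Levy measure. *)
Lemma levy_sq_int (m : R) :
  (\forall k \near \oo, \int[nu]_x (1 - cos (x * k.+1%:R^-1)) <= m * k.+1%:R^-1 ^+ 2) ->
  intble (fun x : R => x ^+ 2).
Proof.
move=> H; pose z (k : nat) : R := k.+1%:R^-1.
have z0 k : 0 < z k by rewrite invr_gt0.
pose C k x := (1 - cos (x * z k)) / z k ^+ 2.
have iC k : intble (C k).
  have := integrableZ_real (- (z k ^+ 2)^-1) (levy_cos_int (z k)).
  by apply: eq_integrable => // x _ /=; congr EFin; rewrite /C; ring.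
have C0 k x : 0 <= C k x by rewrite divr_ge0 ?one_sub_cos_ge0// sqr_ge0.
suff : intble (fun x : R => x ^+ 2 / 2).
  move=> /(integrableZ_real 2); apply: eq_integrable => // x _ /=.
  by congr EFin; field.
apply/integrableP; split.
  by apply/measurable_EFinP; apply: measurable_funM => //; exact: measurable_funX.
have cC x : C k x @[k --> \oo] --> x ^+ 2 / 2.
  apply/cvgrPdist_le => e e0.
  have D0 : 0 < `|x| ^+ 3 + 1 by rewrite ltr_wpDl// exprn_ge0.
  have r0 : 0 < e / (`|x| ^+ 3 + 1) by rewrite divr_gt0.
  have /cvgr0Pnorm_le/(_ _ r0) := @cvg_harmonic R.
  apply: filterS => k; rewrite /= -/(z k) (ger0_norm (ltW (z0 k))) ler_pdivlMr// => h.
  have zN : z k != 0 by rewrite gt_eqF.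
  have -> : x ^+ 2 / 2 - C k x = - ((1 - cos (x * z k) - (x * z k) ^+ 2 / 2) / z k ^+ 2).
    by rewrite /C; field.
  rewrite normrN normrM normfV (ger0_norm (sqr_ge0 _)) ler_pdivrMr ?exprn_gt0//.
  apply: (le_trans (cos_quad_le _)); apply: (@le_trans _ _ (`|x * z k| ^+ 3)).
    by rewrite /quad_err [leRHS]exprSr real_normK ?num_real// ler_wpM2l ?sqr_ge0// ge_min lexx orbT.
  rewrite normrM (ger0_norm (ltW (z0 k))) exprMn.
  rewrite (_ : `|x| ^+ 3 * _ = (z k * `|x| ^+ 3) * z k ^+ 2); last by ring.
  apply: ler_wpM2r; first exact: sqr_ge0.
  by have := z0 k; lra.
have mC k : measurable_fun [set: measurableTypeR R] (fun x => (C k x)%:E).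
  by apply/measurable_EFinP; exact: integrable_real_meas (iC k).
have F := @fatou _ _ _ nu setT measurableT (fun k x => (C k x)%:E) mC (fun k x _ => C0 k x).
apply: (@le_lt_trans _ _ (limn_einf (fun k => \int[nu]_x (C k x)%:E)%E)).
  apply: le_trans F; rewrite le_eqVlt; apply/orP; left; apply/eqP.
  apply: eq_integral => x _.
  have c : (fun k => (C k x)%:E) @ \oo --> (x ^+ 2 / 2)%:E.
    by apply/fine_cvgP; split; [exact: nearW|exact: cC].
  rewrite is_cvg_limn_einfE; last by apply/cvg_ex; eexists; exact: c.
  by rewrite (cvg_lim _ c)//= ger0_norm// divr_ge0// sqr_ge0.
apply: (@le_lt_trans _ _ m%:E); last exact: ltry.
have [N _ HN] := H.
rewrite limn_einf_lim; apply: lime_le; first exact: is_cvg_einfs.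
apply: nearW => n; have {}h := HN (maxn n N) (leq_maxr _ _); set k := maxn n N in h *.
apply: (@le_trans _ _ (\int[nu]_x (C k x)%:E)%E).
  by apply: ereal_inf_lbound; exists k => //=; exact: leq_maxl.
rewrite Rintegral_EFin// lee_fin.
have -> : \int[nu]_x C k x = (z k ^+ 2)^-1 * \int[nu]_x (1 - cos (x * z k)).
  rewrite -RintegralZl//; first by apply: eq_Rintegral => x _; rewrite /C mulrC.
  have := integrableN_real (levy_cos_int (z k)).
  by apply: eq_integrable => // x _ /=; rewrite opprB.
by rewrite mulrC ler_pdivrMr ?exprn_gt0.
Qed.

Hypothesis isq : intble (fun x : R => x ^+ 2).

(** For [|z| <= 1 / (N + 1)] the integrand is at most [z^2] times [x^2 min(1, |x| / (N + 1))], whose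
    integral tends to [0] by dominated convergence. *)
Lemma levy_quad_small (e : R) : 0 < e -> exists2 r : R, 0 < r &
  forall z : R, `|z| <= r -> \int[nu]_x quad_err (x * z) <= e * z ^+ 2.
Proof.
move=> e0; pose g (k : nat) (x : R) := x ^+ 2 * Num.min 1 (`|x| * k.+1%:R^-1).
have mg (r : R) : measurable_fun [set: measurableTypeR R] (fun x => x ^+ 2 * Num.min 1 (`|x| * r)).
  apply: measurable_funM; first exact: measurable_funX.
  by apply: measurable_minr => //; apply: measurable_funM => //.
have [_ _ ] : [/\ measurable_fun [set: measurableTypeR R] (fun=> 0 : R), intble (fun=> 0 : R) &
    \int[nu]_x g k x @[k --> \oo] --> \int[nu]_x (0 : R)].
  apply: (Rintegral_dct _ _ isq) => [k|x|k x]; first exact: mg.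
  - rewrite -(mulr0 (x ^+ 2)); apply: cvgM; first exact: cvg_cst.
    apply/cvgr0Pnorm_le => e1 e10.
    have D0 : 0 < `|x| + 1 by rewrite ltr_wpDl.
    have /cvgr0Pnorm_le/(_ _ (divr_gt0 e10 D0)) := @cvg_harmonic R.
    apply: filterS => k /=; rewrite ger0_norm ?invr_ge0// ler_pdivlMr// => h.
    have k0 : 0 <= k.+1%:R^-1 :> R by rewrite invr_ge0.
    rewrite ger0_norm; last by rewrite le_min ler01 mulr_ge0.
    rewrite ge_min; apply/orP; right; apply: le_trans h.
    by rewrite mulrDr mulr1 [leRHS]addrC mulrC lerDr.
  - rewrite /g normrM (ger0_norm (sqr_ge0 x)) ler_piMr ?sqr_ge0//.
    rewrite ger0_norm ?ge_min ?lexx// le_min ler01 mulr_ge0//.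
rewrite [X in _ --> X](_ : _ = 0); last by rewrite /Rintegral integral0.
move=> /cvgr0Pnorm_le/(_ _ e0)[N _ /(_ N (leqnn N))/= h].
have ig k : intble (g k).
  apply: le_integrable_real isq => [|x]; first exact: mg.
  rewrite /g normrM (ger0_norm (sqr_ge0 x)) ler_piMr ?sqr_ge0//.
  by rewrite ger0_norm ?ge_min ?lexx// le_min ler01 mulr_ge0.
exists N.+1%:R^-1; first by rewrite invr_gt0.
move=> z zr.
apply: (@le_trans _ _ (\int[nu]_x (z ^+ 2 * g N x))); last first.
  by rewrite RintegralZl// mulrC ler_wpM2r ?sqr_ge0// (le_trans (ler_norm _)).
have le x : `|quad_err (x * z)| <= z ^+ 2 * g N x.
  rewrite ger0_norm ?quad_err_ge0// /quad_err /g exprMn -mulrA mulrCA.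
  apply: ler_wpM2l; first exact: sqr_ge0.
  apply: ler_wpM2l; first exact: sqr_ge0.
  by rewrite normrM le_min !ge_min lexx/= ler_wpM2l ?orbT.
rewrite (le_trans (ler_norm _))//; apply: Rintegral_abs_le => //.
  apply: measurable_funM.
    by apply: measurable_funX; exact: measurable_funM.
  apply: measurable_minr => //; apply: (measurableT_comp (f := fun x : R => `|x|)).
    exact: normr_measurable.
  exact: measurable_funM.
exact: integrableZ_real.
Qed.

Lemma levy_quad_int z : intble (fun x => quad_err (x * z)) /\
  \int[nu]_x quad_err (x * z) <= \int[nu]_x (x ^+ 2) * z ^+ 2.
Proof.
have le x : `|quad_err (x * z)| <= z ^+ 2 * x ^+ 2.
  by rewrite ger0_norm ?quad_err_ge0// (le_trans (quad_err_le _))// exprMn mulrC.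
have mq : measurable_fun [set: measurableTypeR R] (fun x => quad_err (x * z)).
  apply: measurable_funM.
    by apply: measurable_funX; exact: measurable_funM.
  apply: measurable_minr => //; apply: (measurableT_comp (f := fun x : R => `|x|)).
    exact: normr_measurable.
  exact: measurable_funM.
have iz := integrableZ_real (z ^+ 2) isq.
split; first exact: le_integrable_real iz.
rewrite mulrC -RintegralZl//; apply: le_Rintegral => //.
  exact: le_integrable_real iz.
by move=> x _; apply: le_trans (ler_norm _) (le x).
Qed.

Lemma continuous_levy_integral (h : R -> R) (c : R) : 0 <= c -> continuous h ->
  (forall y, `|h y| <= c * y ^+ 2) ->
  continuous (fun z => \int[nu]_x h (x * z)).
Proof.
move=> c0 ch hb z0.
have mh z : measurable_fun [set: measurableTypeR R] (fun x => h (x * z)).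
  apply: meas_cont => x; apply: (cvg_comp (fun x => x * z) h); last exact: ch.
  by apply: cvgM; [exact: cvg_id|exact: cvg_cst].
have hz z x : `|h (x * z)| <= c * z ^+ 2 * x ^+ 2.
  by rewrite (le_trans (hb _))// exprMn mulrCA mulrC mulrAC.
have int_f z : `]z0 - 1, z0 + 1[%classic z -> nu.-integrable setT (EFin \o (fun x => h (x * z))).
  by move=> _; apply: le_integrable_real (integrableZ_real (c * z ^+ 2) isq).
have := @continuity_under_integral R _ _ nu (fun z x => h (x * z)) setT measurableT
  (z0 - 1) (z0 + 1) int_f _ (fun x => c * (`|z0| + 1) ^+ 2 * x ^+ 2)
  (integrableZ_real _ isq) _ z0; apply.
- apply: aeW => y _ z _; apply: (cvg_comp (fun z => y * z) h); last exact: ch.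
  by apply: cvgM; [exact: cvg_cst|exact: cvg_id].
- move=> z /=; rewrite in_itv/= => /andP[z1 z2]; apply: aeW => x _.
  rewrite (le_trans (hz z x))//; apply: ler_wpM2r; first exact: sqr_ge0.
  apply: ler_wpM2l => //; rewrite -(real_normK (num_real z)) lerXn2r ?nnegrE ?addr_ge0//.
  rewrite -(subrK z0 z) (le_trans (ler_normD _ _))// addrC lerD2l.
  by rewrite ler_norml; apply/andP; split; lra.
- by rewrite inE/= in_itv/=; lra.
Qed.

End levy_measure.

(* [a] and [b] are the real and imaginary parts of the Levy exponent. *)
Record levy_log_cf (R : realType) (mu v : R) (a b : R -> R) : Prop := LevyLogCf {
  llc_a_le0 : forall z, a z <= 0 ;
  llc_a_cont : continuous a ;
  llc_b_cont : continuous b ;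
  llc_v_ge0 : 0 <= v ;
  llc_quad : exists2 C, 0 <= C & forall z,
     `|a z + v * z ^+ 2 / 2| <= C * z ^+ 2 /\ `|b z - mu * z| <= C * z ^+ 2 ;
  llc_small : forall e, 0 < e -> exists2 r : R, 0 < r & forall z : R, `|z| <= r ->
     `|a z + v * z ^+ 2 / 2| <= e * z ^+ 2 /\ `|b z - mu * z| <= e * z ^+ 2
}.

Section levy_basis_log_cf.
Context {disp} {T : measurableType disp} {R : realType} (P : probability T R).
Context (d : nat) (L : set 'rV[R]_d -> {RV P >-> R}).
Hypothesis lL : is_levy_basis L.
Let L1 : {RV P >-> R} := L (@unit_cube R d).
Hypothesis L2 : ('E_P[fun w => (`|L1 w| ^+ 2)%R] < +oo)%E.

(** A finite second moment of [L1] bounds the real part of the exponent by [m z^2] near [0], hence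
    gives [nu] a finite second moment. Then [v = a + \int x^2 d nu], and the linear compensation in
    the exponent extends from [[-1, 1]] to the whole line, which changes the drift into the mean. *)
Lemma levy_basis_log_cfP : exists (a b : R -> R) (v : R),
  levy_log_cf (fine 'E_P[L1]) v a b /\
  forall A z t, bounded_borel A -> let l := fine (lebesgue_rV R d A) in
    \int[P]_w cos (z * L A w + t) = expR (l * a z) * cos (l * b z + t).
Proof.
have half (x y c : R) : x <= y / 2 * c -> 0 <= y * c -> x <= y * c /\ 2 * x <= y * c.
  by move=> ? ?; split; lra.
have twice (x y c : R) : x <= y * c -> 0 <= y * c -> x <= 2 * y * c /\ 2 * x <= 2 * y * c.
  by move=> ? ?; split; lra.
have [a [gamma [nu [a0 lnu LK]]]] := levy_khintchine lL.
pose al z := \int[nu]_x (cos (x * z) - 1) - a * z ^+ 2 / 2.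
pose be z := gamma * z + \int[nu]_x (sin (x * z) - x * z * \1_(`[-1, 1]%classic) x).
have icos z A t : P.-integrable setT (EFin \o (fun w => cos (z * L A w + t))).
  apply: (@integrable_bounded _ _ _ P _ 1) => [|w]; last exact: cos_max.
  exact: (measurableT_comp (measurable_cos_lin _ _)).
have cf A z t : bounded_borel A -> let l := fine (lebesgue_rV R d A) in
    \int[P]_w cos (z * L A w + t) = expR (l * al z) * cos (l * be z + t).
  move=> bA l; have := LK z A bA; rewrite levy_exponentE cexp_mulr /Cintegral.
  have eR : \int[P]_x complex.Re (cexp ('i * (z * L A x)%:C)%C) = \int[P]_w cos (z * L A w + 0).
    by apply: eq_Rintegral => w _; rewrite cexp_imag addr0.
  have eI : \int[P]_x complex.Im (cexp ('i * (z * L A x)%:C)%C) =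
      \int[P]_w (- cos (z * L A w + pi / 2)).
    by apply: eq_Rintegral => w _; rewrite cexp_imag cosDpihalf opprK.
  rewrite eR eI RintegralN// => /complex_eqP[e1 e2].
  transitivity (\int[P]_w (cos t * cos (z * L A w + 0) + sin t * cos (z * L A w + pi / 2))).
    by apply: eq_Rintegral => w _; rewrite cosDpihalf addr0 cosD; ring.
  rewrite RintegralD//; [|exact: integrableZ_real|exact: integrableZ_real].
  rewrite !RintegralZl// e1 -[X in sin t * X]opprK e2 cosD.
  by rewrite -/(al z) -/(be z) -/l; ring.
have cf1 z t : \int[P]_w cos (z * L1 w + t) = expR (al z) * cos (be z + t).
  have := cf _ z t (@unit_cube_bounded_borel R d); rewrite /= unit_cube_vol/=.
  by rewrite !mul1r.
have iL2 : P.-integrable setT (EFin \o (fun w => L1 w ^+ 2)).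
  apply/integrableP; split; first by apply/measurable_EFinP; exact: measurable_funX.
  apply: le_lt_trans L2; rewrite unlock le_eqVlt; apply/orP; left; apply/eqP.
  by apply: eq_integral => w _ /=; rewrite normrX.
pose m := \int[P]_w (L1 w ^+ 2).
have m0 : 0 <= m by apply: Rintegral_ge0 => w _; exact: sqr_ge0.
have cos_le0 z : \int[nu]_x (cos (x * z) - 1) <= 0.
  rewrite -oppr_ge0 -RintegralN; last exact: levy_cos_int.
  by apply: Rintegral_ge0 => x _; rewrite opprB one_sub_cos_ge0.
have al0 z : al z <= 0.
  have : 0 <= a * z ^+ 2 by rewrite mulr_ge0// sqr_ge0.
  by have := cos_le0 z; rewrite /al; lra.
(* [1 - m z^2 / 2 <= E cos(z L1) <= e^(al z)] and [(1 - al z) e^(al z) <= 1] give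
   [(1 - al z) (1 - m z^2 / 2) <= 1], which is solved for [- al z] using [m z^2 <= 1]. *)
have alb z : z ^+ 2 * m <= 1 -> - al z <= m * z ^+ 2.
  move=> zm; have e0 : 1 - z ^+ 2 / 2 * m <= expR (al z).
    apply: (@le_trans _ _ (\int[P]_w cos (z * L1 w + 0))); last first.
      by rewrite cf1 ler_piMr ?expR_ge0// cos_le1.
    rewrite -[X in X - _](Rintegral_prob_cst P) -RintegralZl// -RintegralB//; last 2 first.
    - exact: finite_measure_integrable_cst.
    - exact: integrableZ_real.
    apply: le_Rintegral => //.
    - apply: integrableB_real; last exact: integrableZ_real.
      exact: finite_measure_integrable_cst.
    - exact: icos.
    - move=> w _; rewrite addr0; have := one_sub_cos_le (z * L1 w); rewrite exprMn; lra.
  have h := expR_ge1Dx (- al z); rewrite expRN in h.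
  have ep := expR_gt0 (al z).
  have h2 : (1 - al z) * expR (al z) <= 1.
    by rewrite (le_trans (ler_wpM2r (ltW ep) h))// mulVf// gt_eqF.
  have h3 : (1 - al z) * (1 - z ^+ 2 / 2 * m) <= 1.
    by apply: le_trans h2; apply: ler_wpM2l => //; have := al0 z; lra.
  have := al0 z => ?.
  have : 0 <= (- al z) * (1 - z ^+ 2 * m) by rewrite mulr_ge0; lra.
  by lra.
have isq : nu.-integrable setT (EFin \o (fun x : R => x ^+ 2)).
  apply: (@levy_sq_int _ nu lnu m).
  have r0 : 0 < (m + 1)^-1 by rewrite invr_gt0 ltr_wpDl.
  have /cvgr0Pnorm_le/(_ _ r0) := @cvg_harmonic R.
  apply: filterS => k /=; rewrite ger0_norm ?invr_ge0//; set z := k.+1%:R^-1 => hz.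
  have z0 : 0 <= z by rewrite invr_ge0.
  have z1 : z <= 1 by rewrite invf_le1// ler1n.
  have hz' : z * (m + 1) <= 1 by rewrite -ler_pdivlMr ?ltr_wpDl// mul1r.
  have zm : z ^+ 2 * m <= 1.
    have : 0 <= z * (1 - z) * m by rewrite !mulr_ge0// subr_ge0.
    by lra.
  have := alb z zm; apply: le_trans; rewrite /al.
  have -> : \int[nu]_x (1 - cos (x * z)) = - \int[nu]_x (cos (x * z) - 1).
    rewrite -RintegralN; last exact: levy_cos_int.
    by apply: eq_Rintegral => x _; rewrite opprB.
  by have : 0 <= a * z ^+ 2; [rewrite mulr_ge0// sqr_ge0|lra].
pose s2 := \int[nu]_x (x ^+ 2).
have s20 : 0 <= s2 by apply: Rintegral_ge0 => x _; exact: sqr_ge0.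
pose v := a + s2.
have mI : measurable_fun [set: measurableTypeR R] (\1_(`[-1, 1]%classic : set R) : R -> R).
  by apply: measurable_indic; exact: measurable_itv.
have mid : measurable_fun [set: measurableTypeR R] (fun x : R => x) by exact: measurable_id.
have ix : nu.-integrable setT (EFin \o (fun x : R => x - x * \1_(`[-1, 1]%classic) x)).
  apply: le_integrable_real isq => [|x].
    by apply: measurable_funB => //; exact: measurable_funM.
  rewrite indicE; case: (boolP (_ \in _)) => [_|]; first by rewrite mulr1 subrr normr0 sqr_ge0.
  rewrite notin_setE/= in_itv/= -ler_norml => /negP; rewrite -ltNge => x1.
  rewrite mulr0 subr0 -(real_normK (num_real x)) expr2.
  by rewrite ler_peMl// ltW.
pose g' := gamma + \int[nu]_x (x - x * \1_(`[-1, 1]%classic) x).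
pose Q z := \int[nu]_x quad_err (x * z).
have isx z : nu.-integrable setT (EFin \o (fun x : R => sin (x * z) - x * z)).
  have := integrableB_real (levy_sin_int lnu z) (integrableZ_real z ix).
  by apply: eq_integrable => // x _ /=; congr EFin; ring.
have beE z : be z - g' * z = \int[nu]_x (sin (x * z) - x * z).
  transitivity (\int[nu]_x (sin (x * z) - x * z * \1_(`[-1, 1]%classic) x) -
     z * \int[nu]_x (x - x * \1_(`[-1, 1]%classic) x)); first by rewrite /be /g'; ring.
  rewrite -RintegralZl// -RintegralB//; [|exact: levy_sin_int|exact: integrableZ_real].
  by apply: eq_Rintegral => x _; ring.
have icx z : nu.-integrable setT (EFin \o (fun x : R => cos (x * z) - 1 + (x * z) ^+ 2 / 2)).
  have := integrableD_real (levy_cos_int lnu z) (integrableZ_real (z ^+ 2 / 2) isq).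
  by apply: eq_integrable => // x _ /=; congr EFin; field.
have alE z : al z + v * z ^+ 2 / 2 = \int[nu]_x (cos (x * z) - 1 + (x * z) ^+ 2 / 2).
  transitivity (\int[nu]_x (cos (x * z) - 1) + (z ^+ 2 / 2) * s2).
    by rewrite /al /v; field.
  rewrite -RintegralZl// -RintegralD//; [|exact: levy_cos_int|exact: integrableZ_real].
  by apply: eq_Rintegral => x _; field.
have bQ z : `|al z + v * z ^+ 2 / 2| <= Q z /\ `|be z - g' * z| <= 2 * Q z.
  have [iq _] := levy_quad_int isq z.
  split.
    rewrite alE; apply: Rintegral_abs_le => //; first exact: integrable_real_meas (icx z).
    by move=> x; rewrite -normrN opprD opprB; exact: cos_quad_le.
  rewrite beE /Q -RintegralZl//; apply: Rintegral_abs_le => //.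
  - exact: integrable_real_meas (isx z).
  - by move=> x; rewrite distrC; exact: sin_sub_le.
  - exact: integrableZ_real.
have v0 : 0 <= v by rewrite addr_ge0.
have small e : 0 < e -> exists2 r : R, 0 < r & forall z : R, `|z| <= r ->
     `|al z + v * z ^+ 2 / 2| <= e * z ^+ 2 /\ `|be z - g' * z| <= e * z ^+ 2.
  move=> e0; have e20 : 0 < e / 2 by rewrite divr_gt0.
  have [r r0 rP] := levy_quad_small isq e20; exists r => // z /rP h.
  have [h1 h2] := bQ z; have : 0 <= e * z ^+ 2 by rewrite mulr_ge0 ?sqr_ge0// ltW.
  rewrite -/(Q z) in h => q0; have [k1 k2] := half _ _ _ h q0.
  by split; [apply: (le_trans h1)|apply: (le_trans h2)].
(* The exponent of [L1 - g'] has no linear term at [0], so [first_moment_from_cf] makes its mean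
   vanish. *)
have g'E : g' = fine 'E_P[L1].
  have iL1 : P.-integrable setT (EFin \o L1).
    apply: (@le_integrable_real _ _ _ P _ (fun w => 1 + L1 w ^+ 2)) => [//|w|].
      by rewrite -(real_normK (num_real (L1 w))); have := sqr_ge0 (`|L1 w| - 1); nra.
    by apply: integrableD_real => //; exact: finite_measure_integrable_cst.
  have -> : fine 'E_P[L1] = \int[P]_w L1 w by rewrite unlock.
  have cfc z t : \int[P]_w (\1_(setT : set T) w * cos (z * (L1 w - g') + t)) =
      1 * (expR (al z) * cos ((be z - g' * z) + t)).
    rewrite mul1r [be z - _ + t](_ : _ = be z + (t - g' * z)); last by ring.
    rewrite -cf1; apply: eq_Rintegral => w _; rewrite indicT mul1r; congr cos; ring.
  have mW : measurable_fun setT (fun w => L1 w - g') by exact: measurable_funB.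
  have [_ H] := first_moment_from_cf measurableT mW v0 al0 cfc small.
  transitivity (\int[P]_w L1 w - \int[P]_w (\1_(setT : set T) w * (L1 w - g'))); last by rewrite H subr0.
  rewrite -RintegralB//; last first.
    have := integrableB_real iL1 (finite_measure_integrable_cst P g' measurableT).
    by apply: eq_integrable => // w _ /=; rewrite indicT mul1r.
  rewrite -[LHS](Rintegral_prob_cst P); apply: eq_Rintegral => w _.
  by rewrite indicE in_setT /= mul1r; ring.
have cnt_id (c : R) : continuous (fun z : R => c * z).
  by move=> z; apply: cvgM; [exact: cvg_cst|exact: cvg_id].
exists al, be, v; split; last exact: cf.
rewrite -g'E; split => //.
- have -> : al = (fun z => \int[nu]_x (cos (x * z) - 1) - a * z ^+ 2 / 2) by [].
  move=> z; apply: cvgB.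
    apply: (@continuous_levy_integral _ nu isq (fun y => cos y - 1) 1) => // y.
      by apply: cvgB; [exact: continuous_cos|exact: cvg_cst].
    rewrite distrC ger0_norm ?one_sub_cos_ge0// mul1r.
    by have := one_sub_cos_le y; have := sqr_ge0 y; lra.
  apply: cvgM; last exact: cvg_cst.
  by apply: cvgM; [exact: cvg_cst|exact: exprn_continuous].
- have -> : be = (fun z => g' * z + \int[nu]_x (sin (x * z) - x * z)).
    by apply/funext => z; rewrite -beE; ring.
  move=> z; apply: cvgD; first exact: cnt_id.
  apply: (@continuous_levy_integral _ nu isq (fun y => sin y - y) 2) => // y.
    by apply: cvgB; [exact: continuous_sin|exact: cvg_id].
  by rewrite distrC (le_trans (sin_sub_le _))// ler_wpM2l// quad_err_le.
- exists (2 * s2); first by rewrite mulr_ge0.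
  move=> z; have [h1 h2] := bQ z; have [_ h3] := levy_quad_int isq z.
  have : 0 <= s2 * z ^+ 2 by rewrite mulr_ge0// sqr_ge0.
  rewrite -/(Q z) -/s2 in h3 => q0; have [k1 k2] := twice _ _ _ h3 q0.
  by split; [apply: (le_trans h1)|apply: (le_trans h2)].
Qed.

End levy_basis_log_cf.

(** * Independent sums *)

Import HBNNSimple.

Section independence_weights.
Context d (T : measurableType d) (R : realType) (P : probability T R).
Implicit Types (G V : T -> R) (h : R -> R).

Lemma integrable_mul_bounded G V (K M : R) :
  measurable_fun setT G -> measurable_fun setT V ->
  (forall w, `|G w| <= K) -> (forall w, `|V w| <= M) ->
  P.-integrable setT (EFin \o (fun w => G w * V w)).
Proof.
move=> mG mV GK VM; apply: (@integrable_bounded _ _ _ P _ (K * M)).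
  exact: measurable_funM.
by move=> w; rewrite normrM ler_pM.
Qed.

Lemma Rintegral_preimage V (B : set R) : measurable_fun setT V -> measurable B ->
  \int[P]_w \1_B (V w) = fine (P (V @^-1` B)).
Proof.
move=> mV mB; rewrite /Rintegral; congr fine.
transitivity (\int[P]_w (\1_(V @^-1` B) w)%:E)%E.
  by apply: eq_integral => w _; rewrite !indicE; congr (_%:R%:E); apply/idP/idP; rewrite !inE.
rewrite integral_indic ?setIT//.
by rewrite -[X in measurable X]setTI; exact: mV.
Qed.

(** From indicators to simple functions by linearity, then to bounded functions by dominated
    convergence. Adding [M] makes [h] nonnegative, as [nnsfun_approx] requires. *)
Lemma Rintegral_weight G V h (c K M : R) :
  measurable_fun setT G -> measurable_fun setT V -> measurable_fun setT h ->
  (forall w, `|G w| <= K) -> (forall x, `|h x| <= M) ->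
  (forall B, measurable B ->
    \int[P]_w (G w * \1_B (V w)) = c * fine (P (V @^-1` B))) ->
  \int[P]_w (G w * h (V w)) = c * \int[P]_w h (V w).
Proof.
move=> mG mV mh GK hM Hc.
pose f x := h x + M.
have f0 x : 0 <= f x by rewrite /f -lerBlDr sub0r; have := hM x; rewrite ler_norml => /andP[].
have f2 x : f x <= 2 * M.
  by rewrite mulr_natl mulr2n lerD2r (le_trans (ler_norm _)).
have mf : measurable_fun setT (EFin \o f).
  by apply/measurable_EFinP; exact: measurable_funD.
pose g := nnsfun_approx measurableT mf.
have gf x : g n x @[n --> \oo] --> f x.
  have := @cvg_nnsfun_approx _ _ _ _ measurableT _ mf (fun x _ => f0 x) x I.
  by move=> /fine_cvgP[].
have gle n x : g n x <= f x.
  have nd : nondecreasing_seq (g ^~ x).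
    by move=> i j ij; have /lefP := nd_nnsfun_approx measurableT mf ij; apply.
  rewrite -(cvg_lim _ (gf x))//; apply: nondecreasing_cvgn_le => //.
  by apply/cvg_ex; exists (f x); exact: gf.
have g0 n x : 0 <= g n x by exact: fun_ge0.
have gn n x : `|g n x| <= 2 * M by rewrite ger0_norm// (le_trans (gle n x)).
have mgV n : measurable_fun setT (fun w => g n (V w)) by exact: measurableT_comp.
have step n : \int[P]_w (G w * g n (V w)) = c * \int[P]_w g n (V w).
  pose s := fset_set (range (g n)).
  have gE x : g n x = \sum_(y <- s) y * \1_(g n @^-1` [set y]) x.
    by rewrite fimfunE fsbig_finite.
  have mB y : measurable (g n @^-1` [set y]) by [].
  have m1 (B : set R) : measurable B -> measurable_fun setT (fun w => \1_B (V w) : R).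
    by move=> mB'; apply: (measurableT_comp (f := \1_B : R -> R)) => //; exact: measurable_indic.
  have n1 (B : set R) w : `|\1_B (V w) : R| <= 1.
    by rewrite indicE; case: (_ \in _); rewrite ?normr1 ?normr0.
  have iG1 y : P.-integrable setT (EFin \o (fun w => G w * \1_(g n @^-1` [set y]) (V w))).
    by apply: (@integrable_mul_bounded _ _ K 1) => //; exact: m1.
  have i1 y : P.-integrable setT (EFin \o (fun w => \1_(g n @^-1` [set y]) (V w) : R)).
    by apply: (@integrable_bounded _ _ _ P _ 1) => //; exact: m1.
  transitivity (\int[P]_w \sum_(y <- s) (y * (G w * \1_(g n @^-1` [set y]) (V w)))).
    by apply: eq_Rintegral => w _; rewrite gE mulr_sumr; apply: eq_bigr => y _; ring.
  rewrite Rintegral_sum; last by move=> y; exact: integrableZ_real.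
  transitivity (c * \sum_(y <- s) y * fine (P (V @^-1` (g n @^-1` [set y])))).
    by rewrite mulr_sumr; apply: eq_bigr => y _; rewrite RintegralZl// Hc//; ring.
  congr (_ * _); transitivity (\int[P]_w \sum_(y <- s) (y * \1_(g n @^-1` [set y]) (V w))).
    rewrite Rintegral_sum; last by move=> y; exact: integrableZ_real.
    by apply: eq_bigr => y _; rewrite RintegralZl// Rintegral_preimage.
  by apply: eq_Rintegral => w _; rewrite gE.
have mfV : measurable_fun setT (fun w => f (V w)).
  by apply: measurable_funD => //; exact: measurableT_comp.
have [_ _ c1] : [/\ measurable_fun setT (fun w => G w * f (V w)),
    P.-integrable setT (EFin \o (fun w => G w * f (V w))) &
    \int[P]_w (G w * g n (V w)) @[n --> \oo] --> \int[P]_w (G w * f (V w))].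
  apply: (@Rintegral_dct _ _ _ P _ _ (fun=> K * (2 * M))) => [n|w||n w].
  - exact: measurable_funM.
  - by apply: cvgM; [exact: cvg_cst|exact: gf].
  - exact: finite_measure_integrable_cst.
  - by rewrite normrM ler_pM.
have [_ _ c2] : [/\ measurable_fun setT (fun w => f (V w)),
    P.-integrable setT (EFin \o (fun w => f (V w))) &
    \int[P]_w (g n (V w)) @[n --> \oo] --> \int[P]_w f (V w)].
  apply: (@Rintegral_dct _ _ _ P _ _ (fun=> 2 * M)) => [n|w||n w] //.
  exact: finite_measure_integrable_cst.
have E : \int[P]_w (G w * f (V w)) = c * \int[P]_w f (V w).
  have c3 : \int[P]_w (G w * g n (V w)) @[n --> \oo] --> c * \int[P]_w f (V w).
    by under eq_fun do rewrite step; apply: cvgM => //; exact: cvg_cst.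
  exact: (cvg_unique _ c1 c3).
have GT : \int[P]_w G w = c.
  have := Hc setT measurableT; rewrite preimage_setT probability_setT mulr1 => <-.
  by apply: eq_Rintegral => w _; rewrite indicE in_setT mulr1.
have iG : P.-integrable setT (EFin \o G) by exact: (@integrable_bounded _ _ _ P _ K).
have ihV : P.-integrable setT (EFin \o (fun w => h (V w))).
  by apply: (@integrable_bounded _ _ _ P _ M) => //; exact: measurableT_comp.
have iGh : P.-integrable setT (EFin \o (fun w => G w * h (V w))).
  by apply: (@integrable_mul_bounded _ _ K M) => //; exact: measurableT_comp.
have e1 : \int[P]_w (G w * f (V w)) = \int[P]_w (G w * h (V w)) + M * c.
  rewrite -GT -RintegralZl// -RintegralD//; last exact: integrableZ_real.
  by apply: eq_Rintegral => w _; rewrite /f; ring.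
have e2 : \int[P]_w f (V w) = \int[P]_w h (V w) + M.
  rewrite -[X in _ = _ + X](Rintegral_prob_cst P) -RintegralD//.
  exact: finite_measure_integrable_cst.
by move: E; rewrite e1 e2 mulrDr [c * M]mulrC => /addIr.
Qed.

Variables (I : finType) (Z : I -> T -> R).
Hypothesis mZ : forall i, measurable_fun setT (Z i).

Let ind (B : I -> set R) (s : seq I) w : R := \prod_(i <- s) \1_(B i) (Z i w).

Let mind B s : (forall i, measurable (B i)) -> measurable_fun setT (ind B s).
Proof.
move=> mB; apply: measurable_prod => i _.
by apply: (measurableT_comp (f := \1_(B i) : R -> R)) => //; exact: measurable_indic.
Qed.

Let ind1 B s w : `|ind B s w| <= 1.
Proof.
rewrite /ind; elim: s => [|i s IH]; first by rewrite big_nil normr1.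
rewrite big_cons normrM -[leRHS]mulr1 ler_pM// indicE.
by case: (_ \in _); rewrite ?normr1 ?normr0.
Qed.

(** Under the signed measure of density [G] the [Z i] keep their product law, tested on rectangles.
    A weight, unlike an event, can absorb bounded functions of the variables, which drives the
    induction below. *)
Definition indep_weight (s : seq I) G := forall B : I -> set R,
  (forall i, measurable (B i)) ->
  \int[P]_w (G w * \prod_(i <- s) \1_(B i) (Z i w)) =
  \int[P]_w G w * \prod_(i <- s) fine (P (Z i @^-1` B i)).

(** [Rintegral_weight] is applied with the rectangle over [s] counted as part of the weight, so that
    only [Z i] remains to be integrated. *)
Lemma indep_weight_step i s G h (K M : R) : i \notin s ->
  measurable_fun setT G -> (forall w, `|G w| <= K) ->
  measurable_fun setT h -> (forall x, `|h x| <= M) ->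
  indep_weight (i :: s) G ->
  indep_weight s (fun w => G w * h (Z i w)) /\
  \int[P]_w (G w * h (Z i w)) = \int[P]_w G w * \int[P]_w h (Z i w).
Proof.
move=> si mG GK mh hM H.
have main B : (forall i, measurable (B i)) ->
    \int[P]_w (G w * ind B s w * h (Z i w)) =
    (\int[P]_w G w * \prod_(i <- s) fine (P (Z i @^-1` B i))) * \int[P]_w h (Z i w).
  move=> mB; apply: (@Rintegral_weight _ _ _ _ (K * 1) M) => //.
  - by apply: measurable_funM => //; exact: mind.
  - by move=> w; rewrite normrM ler_pM.
  move=> C mC; have := H (fun j => if j == i then C else B j).
  move=> /(_ (fun j => if j == i as b return measurable (if b then C else B j) then mC else mB j)).
  rewrite !big_cons eqxx.
  have -> : \prod_(j <- s) fine (P (Z j @^-1` (if j == i then C else B j))) =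
      \prod_(j <- s) fine (P (Z j @^-1` B j)).
    by apply: eq_big_seq => j js; case: eqP => // ji; move: si; rewrite -ji js.
  rewrite mulrA [RHS]mulrAC => <-; apply: eq_Rintegral => w _.
  rewrite big_cons eqxx -mulrA; congr (_ * _); rewrite mulrC; congr (_ * _).
  by apply: eq_big_seq => j js; case: eqP => // ji; move: si; rewrite -ji js.
have e : \int[P]_w (G w * h (Z i w)) = \int[P]_w G w * \int[P]_w h (Z i w).
  have := main (fun=> setT) (fun=> measurableT).
  rewrite big1 ?mulr1; last by move=> j _; rewrite preimage_setT probability_setT.
  move=> <-; apply: eq_Rintegral => w _; rewrite /ind big1 ?mulr1// => j _.
  by rewrite indicE in_setT.
split=> // B mB; rewrite e mulrAC -main//.
by apply: eq_Rintegral => w _; rewrite /ind; ring.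
Qed.

Lemma indep_weightD s G1 G2 (K : R) :
  measurable_fun setT G1 -> measurable_fun setT G2 ->
  (forall w, `|G1 w| <= K) -> (forall w, `|G2 w| <= K) ->
  indep_weight s G1 -> indep_weight s G2 -> indep_weight s (fun w => G1 w + G2 w).
Proof.
move=> m1 m2 b1 b2 H1 H2 B mB.
have i1 : P.-integrable setT (EFin \o G1) by exact: (@integrable_bounded _ _ _ P _ K).
have i2 : P.-integrable setT (EFin \o G2) by exact: (@integrable_bounded _ _ _ P _ K).
have j1 : P.-integrable setT (EFin \o (fun w => G1 w * ind B s w)).
  by apply: (@integrable_mul_bounded _ _ K 1) => //; exact: mind.
have j2 : P.-integrable setT (EFin \o (fun w => G2 w * ind B s w)).
  by apply: (@integrable_mul_bounded _ _ K 1) => //; exact: mind.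
rewrite RintegralD// mulrDl -H1// -H2// -RintegralD//.
by apply: eq_Rintegral => w _; rewrite mulrDl.
Qed.

Variables (y al be : I -> R).
Hypothesis cfZ : forall i t,
  \int[P]_w cos (y i * Z i w + t) = expR (al i) * cos (be i + t).

(** Induction moving one term of the sum into [U]. The identity [cos(A + B) = cos A cos B + cos(A +
    pi/2) cos(B - pi/2)] splits the weight into two products, each absorbing a function of [Z i];
    sines written as shifted cosines stay within the family of hypotheses. *)
Lemma indep_weight_cf s : uniq s -> forall (U : T -> R) (A : set T) (p a b : R),
  measurable A -> measurable_fun setT U ->
  (forall t, indep_weight s (fun w => \1_A w * cos (U w + t))) ->
  (forall t, \int[P]_w (\1_A w * cos (U w + t)) = p * (expR a * cos (b + t))) ->
  forall t, \int[P]_w (\1_A w * cos (U w + \sum_(i <- s) y i * Z i w + t)) =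
  p * (expR (a + \sum_(i <- s) al i) * cos (b + \sum_(i <- s) be i + t)).
Proof.
elim: s => [|i s IH] /=.
  move=> _ U A p a b mA mU _ H t; rewrite !big_nil !addr0 -H.
  by apply: eq_Rintegral => w _; rewrite big_nil addr0.
move=> /andP[si us] U A p a b mA mU HI HE t.
have mcosU (t' : R) : measurable_fun setT (fun w => \1_A w * cos (U w + t') : R).
  apply: measurable_funM => //; apply: (measurableT_comp (f := @cos R)).
    by apply: continuous_measurable_fun; exact: continuous_cos.
  exact: measurable_funD.
have bcosU (t' : R) w : `|\1_A w * cos (U w + t') : R| <= 1.
  rewrite normrM -[leRHS]mulr1 ler_pM ?cos_max// indicE.
  by case: (_ \in _); rewrite ?normr1 ?normr0.
have mc (t' : R) : measurable_fun setT (fun x : R => cos (y i * x + t')).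
  exact: measurable_cos_lin.
have bc (t' : R) x : `|cos (y i * x + t')| <= 1 :> R by exact: cos_max.
pose G1 (t' : R) w : R := \1_A w * cos (U w + t') * cos (y i * Z i w + 0).
pose G2 (t' : R) w : R := \1_A w * cos (U w + (t' + pi / 2)) * cos (y i * Z i w + - (pi / 2)).
have st1 t' := indep_weight_step si (mcosU t') (bcosU t') (mc 0) (bc 0) (HI t').
have st2 t' := indep_weight_step si (mcosU (t' + pi / 2)) (bcosU (t' + pi / 2))
   (mc (- (pi / 2))) (bc (- (pi / 2))) (HI (t' + pi / 2)).
have GE t' w : \1_A w * cos (U w + y i * Z i w + t') = G1 t' w + G2 t' w.
  rewrite /G1 /G2 addr0 cosBpihalf addrA cosDpihalf.
  by rewrite (_ : U w + y i * Z i w + t' = (U w + t') + y i * Z i w) ?cosD; ring.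
have mG1 t' : measurable_fun setT (G1 t').
  by apply: measurable_funM => //; exact: (measurableT_comp (mc 0)).
have mG2 t' : measurable_fun setT (G2 t').
  by apply: measurable_funM => //; exact: (measurableT_comp (mc (- (pi / 2)))).
have bG1 t' w : `|G1 t' w| <= 1 by rewrite normrM -[leRHS]mulr1 ler_pM.
have bG2 t' w : `|G2 t' w| <= 1 by rewrite normrM -[leRHS]mulr1 ler_pM.
have := IH us (fun w => U w + y i * Z i w) A p (a + al i) (b + be i) mA.
rewrite !big_cons !addrA => <-.
- by apply: eq_Rintegral => w _; rewrite big_cons addrA.
- by apply: measurable_funD => //; exact: measurable_funM.
- move=> t'; rewrite (_ : (fun w => _) = (fun w => G1 t' w + G2 t' w)); last first.
    by apply/funext => w; exact: GE.
  apply: (@indep_weightD _ _ _ 1) => //; first exact: (st1 t').1.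
  exact: (st2 t').1.
- move=> t'; rewrite (_ : (fun w => _) = (fun w => G1 t' w + G2 t' w)); last first.
    by apply/funext => w; exact: GE.
  rewrite RintegralD//; last 2 first.
  + exact: (@integrable_bounded _ _ _ P _ 1).
  + exact: (@integrable_bounded _ _ _ P _ 1).
  rewrite (st1 t').2 (st2 t').2 !HE !cfZ addr0 cosBpihalf addrA cosDpihalf.
  by rewrite expRD (_ : b + be i + t' = (b + t') + be i) ?cosD; ring.
Qed.

End independence_weights.

(** * Integrals of simple functions *)

Lemma ae_forall_fin d (T : measurableType d) (R : realType)
    (mu : {measure set T -> \bar R}) (I : finType) (Q : I -> T -> Prop) :
  (forall i, {ae mu, forall w, Q i w}) -> {ae mu, forall w i, Q i w}.
Proof.
move=> H; have : {ae mu, forall w i, i \in index_enum I -> Q i w}.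
  elim: (index_enum I) => [|i s IH]; first exact: aeW.
  apply: filterS2 (H i) IH => w hi hs j; rewrite inE => /orP[/eqP ->//|]; exact: hs.
by apply: filterS => w h i; apply: h; exact: mem_index_enum.
Qed.

Section bounded_borel_sets.
Context (R : realType) (d : nat).
Implicit Types A B : set 'rV[R]_d.

Lemma sub_bounded_borel A B : measurable A -> A `<=` B -> bounded_borel B -> bounded_borel A.
Proof.
move=> mA AB [_ bB]; split=> //; move: bB; rewrite /bounded_set.
by apply: filterS => M h x /AB; exact: h.
Qed.

Lemma bounded_borel0 : bounded_borel (set0 : set 'rV[R]_d).
Proof.
split=> //; exists 0; split; first exact: real0.
by move=> M _ x [].
Qed.

Lemma bounded_borelU A B : bounded_borel A -> bounded_borel B -> bounded_borel (A `|` B).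
Proof.
move=> [mA bA] [mB bB]; split; first exact: measurableU.
move: bA bB; rewrite /bounded_set.
by apply: filterS2 => M hA hB x [/hA|/hB].
Qed.

Lemma bounded_borelI A B : bounded_borel A -> measurable B -> bounded_borel (A `&` B).
Proof.
move=> bA mB; apply: (sub_bounded_borel _ _ bA); last exact: subIsetl.
by apply: measurableI => //; exact: bA.1.
Qed.

Lemma bounded_borel_vol A : bounded_borel A -> (lebesgue_rV R d A < +oo)%E.
Proof.
move=> [mA /bounded_set_rV[M H]].
apply: (@le_lt_trans _ _ (lebesgue_rV R d
   [set x | forall i, x ord0 i \in `[(const_mx (- `|M|) : 'rV[R]_d) ord0 i, (const_mx `|M| : 'rV[R]_d) ord0 i]])).
  apply: le_measure; rewrite ?inE//; first exact: measurable_box.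
  move=> x Ax i; rewrite !mxE in_itv/= -ler_norml (le_trans (H _ i Ax))//.
  exact: ler_norm.
rewrite lebesgue_rV_box ?ltry// => i; rewrite !mxE.
by rewrite (@le_trans _ _ 0)// oppr_le0.
Qed.

Lemma integrable_indic_bounded_borel A : bounded_borel A ->
  (lebesgue_rV R d).-integrable setT (EFin \o (\1_A : 'rV[R]_d -> R)).
Proof.
move=> bA; apply/integrableP; split.
  by apply/measurable_EFinP; apply: measurable_indic; exact: bA.1.
under eq_integral do rewrite /= ger0_norm//.
by rewrite integral_indic//= ?setIT; [exact: bounded_borel_vol|exact: bA.1].
Qed.

Lemma Rintegral_indic_vol A : measurable A ->
  \int[lebesgue_rV R d]_u \1_A u = fine (lebesgue_rV R d A).
Proof. by move=> mA; rewrite /Rintegral integral_indic// setIT. Qed.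

End bounded_borel_sets.

Section simple_function_operations.
Context (R : realType) (d : nat).
Local Notation SF := (simple_function (R := R) d).

Definition sfZ (c : R) (s : SF) : SF :=
  SimpleFunction (fun j => c * sf_coef j) (@sf_setP _ _ s).

Definition sfD (s1 s2 : SF) : SF :=
  @SimpleFunction R d (sf_size s1 + sf_size s2)
    (fun j => match fintype.split j with inl i => sf_coef i | inr i => sf_coef i end)
    (fun j => match fintype.split j with inl i => sf_set i | inr i => sf_set i end)
    (fun j => match fintype.split j as k return bounded_borel
        (match k with inl i => sf_set i | inr i => sf_set i end) with
      inl i => sf_setP i | inr i => sf_setP i end).

Definition sfI (s : SF) (C : set 'rV[R]_d) (mC : measurable C) : SF :=
  SimpleFunction (@sf_coef _ _ s)
    (fun j => bounded_borelI (sf_setP j) mC).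

Definition sf0 : SF := @SimpleFunction R d 0 (fun=> 0) (fun=> set0) (fun=> bounded_borel0 R d).

Lemma sum_split m n (F : 'I_m -> R) (G : 'I_n -> R) :
  \sum_(j < m + n) match fintype.split j with inl i => F i | inr i => G i end =
  \sum_(i < m) F i + \sum_(i < n) G i.
Proof.
rewrite big_split_ord/=; congr (_ + _); apply: eq_bigr => i _.
  by rewrite (unsplitK (inl i)).
by rewrite (unsplitK (inr i)).
Qed.

Lemma simple_evalZ c s u : simple_eval (sfZ c s) u = c * simple_eval s u.
Proof. by rewrite /simple_eval mulr_sumr; apply: eq_bigr => j _; rewrite mulrA. Qed.

Lemma simple_evalD s1 s2 u : simple_eval (sfD s1 s2) u = simple_eval s1 u + simple_eval s2 u.
Proof.
by rewrite /simple_eval -sum_split; apply: eq_bigr => j _ /=; case: (fintype.split j).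
Qed.

Lemma simple_evalI s C (mC : measurable C) u :
  simple_eval (sfI s mC) u = \1_C u * simple_eval s u.
Proof.
rewrite /simple_eval mulr_sumr; apply: eq_bigr => j _ /=.
by rewrite indicI /=; ring.
Qed.

Lemma simple_eval0 u : simple_eval sf0 u = 0.
Proof. by rewrite /simple_eval big_ord0. Qed.

Lemma measurable_simple_eval (s : SF) : measurable_fun setT (simple_eval s).
Proof.
apply: measurable_sum => j; apply: measurable_funM => //.
by apply: measurable_indic; exact: (sf_setP j).1.
Qed.

Lemma simple_eval_bound (s : SF) u : `|simple_eval s u| <= \sum_(j < sf_size s) `|sf_coef j|.
Proof.
rewrite (le_trans (ler_norm_sum _ _ _))//; apply: ler_sum => j _.
by rewrite normrM ler_piMr// indicE; case: (_ \in _); rewrite ?normr1 ?normr0.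
Qed.

Lemma integrable_simple_eval (s : SF) :
  (lebesgue_rV R d).-integrable setT (EFin \o simple_eval s).
Proof.
apply: integrable_sum_real => j; apply: integrableZ_real.
by apply: integrable_indic_bounded_borel; exact: sf_setP.
Qed.

Lemma integrable_simple_eval_sq (s : SF) :
  (lebesgue_rV R d).-integrable setT (EFin \o (fun u => simple_eval s u ^+ 2)).
Proof.
apply: le_integrable_real (integrableZ_real (\sum_(j < sf_size s) `|sf_coef j|)
  (integrable_abs (integrable_simple_eval s))) => [|u].
  by apply: measurable_funX; exact: measurable_simple_eval.
by rewrite normrX expr2 ler_wpM2r// simple_eval_bound.
Qed.

Context disp (T : measurableType disp) (P : probability T R) (L : set 'rV[R]_d -> {RV P >-> R}).

Lemma simple_integralZ c s A w :
  simple_integral L (sfZ c s) A w = c * simple_integral L s A w.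
Proof. by rewrite /simple_integral mulr_sumr; apply: eq_bigr => j _; rewrite mulrA. Qed.

Lemma simple_integralD s1 s2 A w :
  simple_integral L (sfD s1 s2) A w = simple_integral L s1 A w + simple_integral L s2 A w.
Proof.
by rewrite /simple_integral -sum_split; apply: eq_bigr => j _ /=; case: (fintype.split j).
Qed.

Lemma simple_integralI s C (mC : measurable C) w :
  simple_integral L (sfI s mC) setT w = simple_integral L s C w.
Proof. by apply: eq_bigr => j _ /=; rewrite setIT. Qed.

Lemma simple_integral0 A w : simple_integral L sf0 A w = 0.
Proof. by rewrite /simple_integral big_ord0. Qed.

Lemma measurable_simple_integral s A : measurable_fun setT (simple_integral L s A).
Proof. by apply: measurable_sum => j; exact: measurable_funM. Qed.

End simple_function_operations.

Section levy_additivity.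
Context {disp} {T : measurableType disp} {R : realType} (P : probability T R).
Context (d : nat) (L : set 'rV[R]_d -> {RV P >-> R}).
Hypothesis lL : is_levy_basis L.

(** Additivity for the constant sequence of empty sets makes the series with all terms [L set0]
    converge, so its terms tend to [0]. *)
Lemma levy_set0 : {ae P, forall w, L set0 w = 0}.
Proof.
have := levy_additive lL (A := fun=> set0) (fun=> bounded_borel0 R d).
rewrite bigcup0//.
have t0 : trivIset [set: nat] (fun=> set0 : set 'rV[R]_d) by move=> i j _ _ [x []].
move=> /(_ t0 (bounded_borel0 R d)).
apply: filterS => w h.
have c0 : L set0 w @[n --> \oo] --> (0 : R).
  by apply: cvg_series_cvg_0; apply/cvg_ex; exists (L set0 w); exact: h.
by apply/esym; exact: (cvg_unique _ c0 (cvg_cst _)).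
Qed.

Lemma levyU A B : bounded_borel A -> bounded_borel B -> A `&` B = set0 ->
  {ae P, forall w, L (A `|` B) w = L A w + L B w}.
Proof.
move=> bA bB AB.
pose F (n : nat) := if n == 0%N then A else if n == 1%N then B else set0.
have bF n : bounded_borel (F n).
  by rewrite /F; case: ifP => // _; case: ifP => // _; exact: bounded_borel0.
have tF : trivIset setT F.
  apply/trivIsetP => -[|[|i]] [|[|j]] _ _ //= ij; rewrite /F/= ?setI0 ?set0I//.
  by rewrite setIC.
have UF : \bigcup_n F n = A `|` B.
  apply/seteqP; split=> [x [[|[|n]] _]//=|x]; rewrite /F/=; [by left|by right|].
  by case=> h; [exists 0%N|exists 1%N].
have := levy_additive lL bF tF; rewrite UF => /(_ (bounded_borelU bA bB)) h.
have h0 := levy_set0.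
near=> w.
have w0 : L set0 w = 0 by near: w.
have hw : series (fun n => L (F n) w) n @[n --> \oo] --> L (A `|` B) w by near: w.
have c : series (fun n => L (F n) w) n @[n --> \oo] --> L A w + L B w.
  apply: cvg_near_cst; exists 2%N => // n /= n2.
  rewrite /series/= (big_cat_nat _ (n := 2))//= big_nat_recl// big_nat1/=.
  rewrite [X in _ + X]big1_seq ?addr0// => i /andP[_]; rewrite mem_index_iota => /andP[i2 _].
  by rewrite /F !gtn_eqF ?w0// (ltn_trans _ i2).
exact: (cvg_unique _ hw c).
Unshelve. all: by end_near.
Qed.

Lemma levy_bigcup (I : choiceType) (s : seq I) (A : I -> set 'rV[R]_d) : uniq s ->
  (forall i, bounded_borel (A i)) -> (forall i j, i != j -> A i `&` A j = set0) ->
  {ae P, forall w, L (\big[setU/set0]_(i <- s) A i) w = \sum_(i <- s) L (A i) w}.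
Proof.
move=> us bA tA; elim: s us => [_|i s IH /= /andP[si us]].
  by apply: filterS levy_set0 => w; rewrite !big_nil.
have bU : bounded_borel (\big[setU/set0]_(i <- s) A i).
  elim: (s) => [|j s' IH']; first by rewrite big_nil; exact: bounded_borel0.
  by rewrite big_cons; exact: bounded_borelU.
have dU : A i `&` \big[setU/set0]_(i <- s) A i = set0.
  rewrite -subset0 => x [Ai]; rewrite -bigcup_seq => -[j /= js Aj].
  have ij : i != j by apply: contra si => /eqP ->.
  by have : (A i `&` A j) x by []; rewrite tA.
have := levyU (bA i) bU dU; apply: filterS2 (IH us) => w h1 h2.
by rewrite !big_cons h2 h1.
Qed.

End levy_additivity.

(** * Characteristic function of a simple integral *)

Section simple_integral_cf.
Context {disp} {T : measurableType disp} {R : realType} (P : probability T R).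
Context (d : nat) (L : set 'rV[R]_d -> {RV P >-> R}).
Hypothesis lL : is_levy_basis L.
Variables (mu v : R) (a b : R -> R).
Hypothesis lab : levy_log_cf mu v a b.
Hypothesis cfL : forall A z t, bounded_borel A -> let l := fine (lebesgue_rV R d A) in
    \int[P]_w cos (z * L A w + t) = expR (l * a z) * cos (l * b z + t).
Local Notation leb := (lebesgue_rV R d).

(** Events independent of the whole basis. They will be events of the field [Y], which is how
    conditioning on the field enters. *)
Definition indep_event (D : set T) := measurable D /\
  forall E, sigma_family (@bounded_borel R d) L E -> P (D `&` E) = (P D * P E)%E.

Lemma indep_eventT : indep_event setT.
Proof. by split=> // E _; rewrite setTI probability_setT mul1e. Qed.

Lemma log_cf_a0 : a 0 = 0.
Proof.
have [C C0 /(_ 0)] := llc_quad lab.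
by rewrite expr0n/= !mulr0 mul0r addr0 => -[]; rewrite normr_le0 => /eqP.
Qed.

Lemma log_cf_b0 : b 0 = 0.
Proof.
have [C C0 /(_ 0)] := llc_quad lab.
by rewrite expr0n/= !mulr0 mul0r addr0 subr0 => -[_]; rewrite normr_le0 => /eqP.
Qed.

Lemma disjoint_cf n (A : 'I_n -> set 'rV[R]_d) (y : 'I_n -> R) D t :
  (forall i, bounded_borel (A i)) -> trivIset setT A -> indep_event D ->
  \int[P]_w (\1_D w * cos (\sum_(i < n) y i * L (A i) w + t)) =
  fine (P D) * (expR (\sum_(i < n) fine (leb (A i)) * a (y i)) *
                cos (\sum_(i < n) fine (leb (A i)) * b (y i) + t)).
Proof.
move=> bA tA [mD iD].
have iD1 : P.-integrable setT (EFin \o (\1_D : T -> R)).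
  by have := integrable_indic P mD; exact: eq_integrable.
have pfin (E : set T) : measurable E -> P E = (fine (P E))%:E.
  by move=> mE; rewrite fineK// fin_num_measure.
have mpre i (C : set R) : measurable C -> measurable (L (A i) @^-1` C).
  by move=> mC; rewrite -[X in measurable X]setTI; exact: measurable_funP.
have base : indep_weight P (fun i => L (A i) : T -> R) (index_enum 'I_n) (\1_D : T -> R).
  move=> B mB.
  have mE : measurable (\bigcap_(i in [set: 'I_n]) (L (A i) @^-1` B i)).
    by apply: fin_bigcap_measurable => [|i _]; [exact: finite_finset|exact: mpre].
  have E1 : P (D `&` \bigcap_(i in [set: 'I_n]) (L (A i) @^-1` B i)) =
      (P D * P (\bigcap_(i in [set: 'I_n]) (L (A i) @^-1` B i)))%E.
    apply: iD.
    have := @fin_bigcap_measurable _ (g_sigma_algebraType (\bigcup_(i in @bounded_borel R d)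
       preimage_set_system setT (L i) measurable)) _ [set: 'I_n] (fun i => L (A i) @^-1` B i).
    apply => [|i _]; first exact: finite_finset.
    apply: sub_sigma_algebra; exists (A i); first exact: bA.
    by exists (B i) => //; rewrite setTI.
  have E2 := levy_independent lL bA tA mB.
  transitivity (fine (P (D `&` \bigcap_(i in [set: 'I_n]) (L (A i) @^-1` B i)))).
    rewrite -[X in _ = fine (P X)]setIT -integral_indic//; last exact: measurableI.
    congr fine; apply: eq_integral => w _; congr EFin.
    rewrite indicI /=; congr (_ * _); rewrite indicE.
    case: (boolP (w \in _)) => [/set_mem h|/negP h].
      rewrite big1// => i _; rewrite indicE mem_set//; exact: h.
    apply/eqP; rewrite prodf_seq_eq0; apply: contra_notT h => /hasPn h.
    apply/mem_set => i _; have := h i (mem_index_enum i); rewrite /= indicE.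
    by case: (boolP (_ \in _)) => [/set_mem//|]; rewrite eqxx.
  rewrite E1 E2 fineM ?fin_num_measure//; last first.
    by rewrite prode_fin_num// => i _; rewrite fin_num_measure//; exact: mpre.
  congr (_ * _); first by rewrite /Rintegral integral_indic// setIT.
  rewrite (eq_bigr (fun i => (fine (P (L (A i) @^-1` B i)))%:E)) => [|i _].
    by rewrite prodEFin.
  by rewrite fineK// fin_num_measure//; exact: mpre.
have := @indep_weight_cf _ _ _ P _ (fun i => L (A i) : T -> R)
   (fun i => measurable_funP (L (A i))) y
   (fun i => fine (leb (A i)) * a (y i)) (fun i => fine (leb (A i)) * b (y i))
   (fun i t => cfL (y i) t (bA i)) (index_enum 'I_n) (index_enum_uniq _) (fun=> 0) D (fine (P D)) 0 0.
move=> /(_ mD _ _ _ t) H.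
transitivity (\int[P]_w (\1_D w * cos (0 + \sum_(i <- index_enum 'I_n) y i * L (A i) w + t))).
  by apply: eq_Rintegral => w _; rewrite add0r.
rewrite H ?add0r//.
- move=> t' B mB; have := base B mB.
  move=> e; transitivity (\int[P]_w (cos (0 + t') *
      (\1_D w * \prod_(i <- index_enum 'I_n) \1_(B i) (L (A i) w)))).
    by apply: eq_Rintegral => w _; ring.
  rewrite RintegralZl//; last first.
    apply: (@integrable_mul_bounded _ _ _ P _ _ 1 1) => //.
    + apply: measurable_prod => i _.
      by apply: (measurableT_comp (f := \1_(B i) : R -> R)) => //; exact: measurable_indic.
    + by move=> w; rewrite indicE; case: (_ \in _); rewrite ?normr1 ?normr0.
    + move=> w; rewrite normr_prod; apply: prodr_ile1 => i _; rewrite normr_ge0/=.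
      by rewrite indicE; case: (_ \in _); rewrite ?normr1 ?normr0.
  rewrite e mulrA; congr (_ * _); rewrite -RintegralZl//.
  by apply: eq_Rintegral => w _; rewrite mulrC.
- move=> t'; rewrite add0r expR0 mul1r mulrC.
  have -> : fine (P D) = \int[P]_w \1_D w by rewrite /Rintegral integral_indic// setIT.
  by rewrite -RintegralZl//; apply: eq_Rintegral => w _; rewrite mulrC.
Qed.

Section atoms.
Variable s : simple_function (R := R) d.
Local Notation n := (sf_size s).
Local Notation F := {ffun 'I_n -> bool}.

(** The sets of a simple function may overlap, so they are cut into atoms indexed by membership
    vectors. The atom of the zero vector is in general unbounded, where [L] is unconstrained; [B]
    replaces it by the empty set, which is harmless because its coefficient [X N0] is [0]. *)
Let J (u : 'rV[R]_d) : F := [ffun j => u \in sf_set j].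
Let N0 : F := [ffun=> false].
Let At (p : F) : set 'rV[R]_d := [set u | J u = p].
Let B (p : F) : set 'rV[R]_d := if p == N0 then set0 else At p.
Let X (p : F) : R := \sum_(j < n) sf_coef j * (p j)%:R.

Let X0 : X N0 = 0.
Proof. by rewrite /X big1// => j _; rewrite ffunE mulr0. Qed.

Let evalE u : simple_eval s u = X (J u).
Proof. by apply: eq_bigr => j _; rewrite indicE ffunE. Qed.

Let mAt p : measurable (At p).
Proof.
rewrite (_ : At p = \bigcap_(j in [set: 'I_n]) (if p j then sf_set j else ~` sf_set j)).
  apply: fin_bigcap_measurable => [|j _]; first exact: finite_finset.
  by case: (p j); [|apply: measurableC]; exact: (sf_setP j).1.
apply/seteqP; split=> [u <- j _|u H].
  by rewrite ffunE; case: (boolP (u \in _)) => [/set_mem|/negP h] //= h'; apply: h; exact/mem_set.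
apply/ffunP => j; rewrite ffunE; have := H j I.
by case: (p j) => [/mem_set//|h]; apply/negbTE/negP => /set_mem.
Qed.

Let bB p : bounded_borel (B p).
Proof.
rewrite /B; case: (eqVneq p N0) => [_|pN]; first exact: bounded_borel0.
have [j pj] : exists j, p j.
  apply/existsP; apply: contraR pN; rewrite negb_exists => /forallP h.
  by apply/eqP/ffunP => j; rewrite ffunE; apply/negbTE; exact: h.
apply: (sub_bounded_borel (mAt p) _ (sf_setP j)) => u /= Ju.
by move: pj; rewrite -Ju ffunE => /set_mem.
Qed.

Let BB p q : p != q -> B p `&` B q = set0.
Proof.
move=> pq; rewrite -subset0 => u; rewrite /B.
by case: ifP => _; case: ifP => _ //= [] // e1 e2; move: pq; rewrite -e1 -e2 eqxx.
Qed.

Let setE j : sf_set (s := s) j = \big[setU/set0]_(p <- seq.filter (fun p : F => p j) (index_enum F)) B p.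
Proof.
rewrite -bigcup_seq; apply/seteqP; split=> u.
  move=> uj; have pj : J u j by rewrite ffunE mem_set.
  exists (J u); first by rewrite /= mem_filter pj mem_index_enum.
  by rewrite /B; case: eqP => // e; move: pj; rewrite e ffunE.
move=> [p /=]; rewrite mem_filter => /andP[pj _]; rewrite /B; case: eqP => // _ /= Ju.
by move: pj; rewrite -Ju ffunE => /set_mem.
Qed.

Lemma simple_integral_atoms :
  {ae P, forall w, simple_integral L s setT w = \sum_p X p * L (B p) w}.
Proof.
have H (j : 'I_n) : {ae P, forall w, L (sf_set j) w = \sum_(p : F | p j) L (B p) w}.
  rewrite setE; apply: filterS (levy_bigcup lL (filter_uniq (fun p : F => p j) (index_enum_uniq F)) bB BB) => w ->.
  by rewrite big_filter.
have : {ae P, forall w (j : 'I_n), L (sf_set j) w = \sum_(p : F | p j) L (B p) w}.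
  exact: (ae_forall_fin H).
apply: filterS => w H'; rewrite /simple_integral.
under eq_bigr do rewrite setIT H' mulr_sumr big_mkcond/=.
rewrite exchange_big/=; apply: eq_bigr => p _; rewrite /X mulr_suml.
by apply: eq_bigr => j _; case: (p j); rewrite ?mulr1 ?mulr0 ?mul0r.
Qed.

(** [h 0 = 0] discards the region outside all the sets, whose measure may be infinite. *)
Lemma Rintegral_atoms (h : R -> R) : h 0 = 0 ->
  leb.-integrable setT (EFin \o (fun u => h (simple_eval s u))) /\
  \int[leb]_u h (simple_eval s u) = \sum_p fine (leb (B p)) * h (X p).
Proof.
move=> h0.
have e u : h (simple_eval s u) = \sum_(p <- index_enum F) h (X p) * \1_(B p) u.
  rewrite evalE (bigD1_seq (J u)) ?mem_index_enum ?index_enum_uniq//=.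
  rewrite [X in _ + X]big1 ?addr0 => [|p pJ]; last first.
    rewrite indicE /B; case: (eqVneq p N0) => _; first by rewrite in_set0 mulr0.
    by rewrite memNset ?mulr0// => /= e; rewrite e eqxx in pJ.
  rewrite /B; case: (eqVneq (J u) N0) => [->|_]; first by rewrite X0 h0 mul0r.
  by rewrite indicE mem_set ?mulr1.
have i1 p : leb.-integrable setT (EFin \o (fun u => h (X p) * \1_(B p) u)).
  by apply: integrableZ_real; exact: integrable_indic_bounded_borel.
split.
  have := @integrable_sum_real _ _ _ leb _ (index_enum F) _ i1.
  by apply: eq_integrable => // u _ /=; rewrite e.
under eq_Rintegral do rewrite e.
rewrite Rintegral_sum//; apply: eq_bigr => p _.
rewrite RintegralZl; [|by []|exact: integrable_indic_bounded_borel].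
by rewrite Rintegral_indic_vol; [exact: mulrC|exact: (bB p).1].
Qed.

Lemma simple_cf D t : indep_event D ->
  \int[P]_w (\1_D w * cos (simple_integral L s setT w + t)) =
  fine (P D) * (expR (\int[leb]_u a (simple_eval s u)) *
                cos (\int[leb]_u b (simple_eval s u) + t)).
Proof.
move=> iD.
have tB : trivIset setT (fun i : 'I_#|F| => B (enum_val i)).
  apply/trivIsetP => i j _ _ ij; apply: BB; apply: contra ij => /eqP/enum_val_inj ->.
  by [].
have := disjoint_cf (fun i : 'I_#|F| => X (enum_val i)) t (fun i => bB (enum_val i)) tB iD.
have sumE (V : nmodType) (G : F -> V) : \sum_(i < #|F|) G (enum_val i) = \sum_p G p.
  by rewrite -big_enum_val /=; apply: eq_bigl.
rewrite (Rintegral_atoms log_cf_a0).2 (Rintegral_atoms log_cf_b0).2.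
rewrite (sumE R (fun p => fine (leb (B p)) * a (X p))).
rewrite (sumE R (fun p => fine (leb (B p)) * b (X p))) => <-.
rewrite /Rintegral; congr fine; apply: ae_eq_integral => //.
- apply/measurable_EFinP; apply: measurable_funM; first by apply: measurable_indic; exact: iD.1.
  apply: (measurableT_comp (f := @cos R)).
    by apply: continuous_measurable_fun; exact: continuous_cos.
  by apply: measurable_funD => //; exact: measurable_simple_integral.
- apply/measurable_EFinP; apply: measurable_funM; first by apply: measurable_indic; exact: iD.1.
  apply: (measurableT_comp (f := @cos R)).
    by apply: continuous_measurable_fun; exact: continuous_cos.
  apply: measurable_funD => //; apply: measurable_sum => i; exact: measurable_funM.
- apply: filterS simple_integral_atoms => w h _ /=.
  by rewrite (sumE R (fun p => X p * L (B p) w)) h.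
Qed.

End atoms.

End simple_integral_cf.

(** * Integrals of the Levy exponent *)

Section real_probability.
Context d (T : measurableType d) (R : realType) (P : probability T R).
Implicit Types E : set T.

Definition pr E : R := fine (P E).

Lemma prE E : measurable E -> P E = (pr E)%:E.
Proof. by move=> mE; rewrite fineK// fin_num_measure. Qed.

Lemma pr_ge0 E : 0 <= pr E. Proof. exact: fine_ge0. Qed.

Lemma pr_le1 E : measurable E -> pr E <= 1.
Proof. by move=> mE; rewrite -lee_fin -prE// probability_le1. Qed.

Lemma pr_Rintegral E : measurable E -> \int[P]_w \1_E w = pr E.
Proof. by move=> mE; rewrite /Rintegral integral_indic// setIT. Qed.

Lemma integrable_indicP E : measurable E -> P.-integrable setT (EFin \o (\1_E : T -> R)).
Proof. by move=> mE; have := integrable_indic P mE; exact: eq_integrable. Qed.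

(** The union bound in the shape of an argument with three error terms. The inclusion holds only
    almost surely in the applications that rest on additivity of [L]. *)
Lemma pr_le3_ae E E1 E2 E3 : measurable E -> measurable E1 -> measurable E2 -> measurable E3 ->
  {ae P, forall w, E w -> [\/ E1 w, E2 w | E3 w]} -> pr E <= pr E1 + pr E2 + pr E3.
Proof.
move=> mE m1 m2 m3 [N [mN N0 NE]].
rewrite -lee_fin !EFinD -!prE//.
apply: (@le_trans _ _ (P (E1 `|` E2 `|` E3 `|` N))).
  apply: le_measure; rewrite ?inE//; first by repeat apply: measurableU.
  move=> w Ew; have [Nw|nN] := pselect (N w); first by right.
  left; have : E w -> [\/ E1 w, E2 w | E3 w] by apply: contrapT => h; apply: nN; exact: NE.
  by move=> /(_ Ew)[h|h|h]; [left; left|left; right|right].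
have mU : measurable (E1 `|` E2 `|` E3) by repeat apply: measurableU.
apply: (le_trans (measureU2 P mU mN)); rewrite [X in (_ + X)%E](_ : _ = 0%E) ?adde0; last exact: N0.
apply: (le_trans (measureU2 P (measurableU _ _ m1 m2) m3)); apply: leeD => //.
exact: measureU2.
Qed.

Lemma pr_chebyshev (W : T -> R) (e : R) : measurable_fun setT W -> 0 < e ->
  P.-integrable setT (EFin \o (fun w => W w ^+ 2)) ->
  pr [set w | e <= `|W w|] <= (\int[P]_w (W w ^+ 2)) / e ^+ 2.
Proof.
move=> mW e0 iW.
have mE : measurable [set w | e <= `|W w|].
  rewrite -[X in measurable X]setTI; apply: measurable_fun_le => //.
  exact: measurableT_comp.
rewrite -pr_Rintegral// mulrC -RintegralZl//.
apply: le_Rintegral => //; [exact: integrable_indicP|exact: integrableZ_real|].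
move=> w _; rewrite indicE mulrC ler_pdivlMr ?exprn_gt0//.
case: (boolP (_ \in _)) => [|_]; last by rewrite mul0r sqr_ge0.
rewrite inE/= mul1r => h; rewrite -(real_normK (num_real (W w))).
by rewrite lerXn2r ?nnegrE// ltW.
Qed.

Lemma measurable_dist_ge (U V : T -> R) (e : R) : measurable_fun setT U ->
  measurable_fun setT V -> measurable [set w | e <= `|U w - V w|].
Proof.
move=> mU mV; rewrite -[X in measurable X]setTI; apply: measurable_fun_le => //.
by apply: measurableT_comp => //; exact: measurable_funB.
Qed.

Definition cvgP (Z : nat -> T -> R) (W : T -> R) := forall e e' : R, 0 < e -> 0 < e' ->
  exists N, forall n, (N <= n)%N -> pr [set w | e <= `|Z n w - W w|] <= e'.

Lemma cvgP_cvg_in_probability Z W : cvg_in_probability P Z W -> cvgP Z W.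
Proof.
move=> H e e' e0 e'0; have /fine_cvgP[_ /cvgrPdist_le/(_ _ e'0)[N _ h]] := H e e0.
exists N => n /h /=; rewrite sub0r normrN; exact: le_trans (ler_norm _).
Qed.

Lemma cvgPD Z1 Z2 W1 W2 : (forall n, measurable_fun setT (Z1 n)) ->
  (forall n, measurable_fun setT (Z2 n)) -> measurable_fun setT W1 -> measurable_fun setT W2 ->
  cvgP Z1 W1 -> cvgP Z2 W2 -> cvgP (fun n w => Z1 n w + Z2 n w) (fun w => W1 w + W2 w).
Proof.
move=> mZ1 mZ2 mW1 mW2 c1 c2 e e' e0 e'0.
have e2 : 0 < e / 2 by rewrite divr_gt0.
have e'2 : 0 < e' / 2 by rewrite divr_gt0.
have [N1 h1] := c1 _ _ e2 e'2; have [N2 h2] := c2 _ _ e2 e'2.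
exists (maxn N1 N2) => n; rewrite geq_max => /andP[/h1 {}h1 /h2 {}h2].
have := @pr_le3_ae [set w | e <= `|Z1 n w + Z2 n w - (W1 w + W2 w)|]
   [set w | e / 2 <= `|Z1 n w - W1 w|] [set w | e / 2 <= `|Z2 n w - W2 w|] set0.
rewrite {4}/pr measure0/= addr0 => H.
apply: (le_trans (H _ _ _ _ _)) => //.
- by apply: measurable_dist_ge; apply: measurable_funD.
- exact: measurable_dist_ge.
- exact: measurable_dist_ge.
- apply: aeW => w /= h; have [?|h3] := leP (e / 2) `|Z1 n w - W1 w|; first by constructor 1.
  constructor 2; move: h; rewrite opprD addrACA => h.
  by have := le_trans h (ler_normD _ _); lra.
- by rewrite (splitr e') lerD.
Qed.

Lemma cvgPZ Z W (c : R) : (forall n, measurable_fun setT (Z n)) -> measurable_fun setT W ->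
  cvgP Z W -> cvgP (fun n w => c * Z n w) (fun w => c * W w).
Proof.
move=> mZ mW cZ e e' e0 e'0.
have c1 : 0 < `|c| + 1 by rewrite ltr_wpDl.
have e2 : 0 < e / (`|c| + 1) by rewrite divr_gt0.
have [N h] := cZ _ _ e2 e'0; exists N => n /h; apply: le_trans.
have := @pr_le3_ae [set w | e <= `|c * Z n w - c * W w|]
   [set w | e / (`|c| + 1) <= `|Z n w - W w|] set0 set0.
rewrite {3 4}/pr measure0/= !addr0; apply => //.
- by apply: measurable_dist_ge; apply: measurable_funM.
- exact: measurable_dist_ge.
- apply: aeW => w /= h'; constructor 1; rewrite ler_pdivrMr//; apply: (le_trans h').
  by rewrite -mulrBr normrM mulrC ler_wpM2l// lerDl.
Qed.

(** Off the event of a deviation of at least [e / 4] the Lipschitz bound of the cosine costs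
    [e / 4]; on it the trivial bound [2] costs [2 (e / 4)]. *)
Lemma cvgP_cos Z W D t : measurable D -> (forall n, measurable_fun setT (Z n)) ->
  measurable_fun setT W -> cvgP Z W ->
  \int[P]_w (\1_D w * cos (Z n w + t)) @[n --> \oo] --> \int[P]_w (\1_D w * cos (W w + t)).
Proof.
move=> mD mZ mW cZ; apply/cvgrPdist_le => e e0.
have e4 : 0 < e / 4 by rewrite divr_gt0.
have [N h] := cZ _ _ e4 e4; exists N => // n /= /h {}h.
have mc (U : T -> R) : measurable_fun setT U -> measurable_fun setT (fun w => \1_D w * cos (U w + t)).
  move=> mU; apply: measurable_funM; first exact: measurable_indic.
  apply: (measurableT_comp (f := @cos R)); last exact: measurable_funD.
  by apply: continuous_measurable_fun; exact: continuous_cos.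
have bc (U : T -> R) (_ : measurable_fun setT U) w : `|\1_D w * cos (U w + t)| <= 1.
  rewrite normrM -[leRHS]mulr1 ler_pM ?cos_max// indicE.
  by case: (_ \in _); rewrite ?normr1 ?normr0.
pose E := [set w | e / 4 <= `|Z n w - W w|].
have mE : measurable E by exact: measurable_dist_ge.
rewrite -RintegralB//; last 2 first.
- by apply: (@integrable_bounded _ _ _ P _ 1) => [|w]; [exact: mc|exact: bc].
- by apply: (@integrable_bounded _ _ _ P _ 1) => [|w]; [exact: mc|exact: bc].
have ig : P.-integrable setT (EFin \o (fun w => e / 4 + 2 * \1_E w)).
  apply: integrableD_real; first exact: finite_measure_integrable_cst.
  by apply: integrableZ_real; exact: integrable_indicP.
apply: (le_trans (Rintegral_abs_le _ _ ig)).
- by apply: measurable_funB; exact: mc.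
- move=> w; have [wE|wE] := boolP (w \in E).
    rewrite (le_trans (ler_normB _ _))// (le_trans (lerD (bc _ mW w) (bc _ (mZ n) w)))//.
    by rewrite [\1_E w]indicE wE mulr1; lra.
  rewrite [\1_E w]indicE (negbTE wE) mulr0 addr0.
  move: wE; rewrite notin_setE /E/= => /negP; rewrite -ltNge => hw.
  rewrite -mulrBr normrM.
  apply: (@le_trans _ _ `|cos (W w + t) - cos (Z n w + t)|).
    by rewrite ler_piMl// indicE; case: (_ \in _); rewrite ?normr1 ?normr0.
  have := @expR_cos_dist R 0 0 (W w - Z n w) (Z n w + t) (lexx _) (lexx _).
  rewrite expR0 !mul1r subrr normr0 add0r addrA subrK => /le_trans; apply.
  by rewrite distrC ltW.
rewrite RintegralD//; last 2 first.
- exact: finite_measure_integrable_cst.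
- by apply: integrableZ_real; exact: integrable_indicP.
rewrite Rintegral_prob_cst RintegralZl//; last exact: integrable_indicP.
by rewrite pr_Rintegral//; move: h; rewrite -/E => ?; lra.
Qed.

End real_probability.

Section log_cf_integrals.
Context {R : realType} (d : nat).
Local Notation leb := (lebesgue_rV R d).
Local Notation intble f := (leb.-integrable setT (EFin \o f)).
Variables (mu v : R) (a b : R -> R).
Hypothesis lab : levy_log_cf mu v a b.

Definition L12 (g : 'rV[R]_d -> R) := intble g /\ intble (fun u => g u ^+ 2).

Lemma L12Z c g : L12 g -> L12 (fun u => c * g u).
Proof.
move=> [i1 i2]; split; first exact: integrableZ_real.
have := integrableZ_real (c ^+ 2) i2; apply: eq_integrable => // u _ /=.
by rewrite exprMn.
Qed.

Lemma L12_le (f g : 'rV[R]_d -> R) : measurable_fun setT f -> (forall u, `|f u| <= g u) -> L12 g -> L12 f.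
Proof.
move=> mf fg [i1 i2]; split; first exact: le_integrable_real i1.
apply: le_integrable_real i2 => [|u]; first exact: measurable_funX.
by rewrite normrX lerXn2r ?nnegrE// (le_trans _ (fg u)).
Qed.

Lemma L12_abs g : L12 g -> L12 (fun u => `|g u|).
Proof.
move=> [i1 i2]; split; first exact: integrable_abs.
by apply: eq_integrable i2 => // u _ /=; rewrite real_normK ?num_real.
Qed.

Lemma L12D (f g : 'rV[R]_d -> R) : L12 f -> L12 g -> L12 (fun u => f u + g u).
Proof.
move=> [f1 f2] [g1 g2]; split; first exact: integrableD_real.
apply: le_integrable_real (integrableZ_real 2 (integrableD_real f2 g2)) => [|u].
  apply: measurable_funX; apply: measurable_funD.
    exact: integrable_real_meas f1.
  exact: integrable_real_meas g1.
by rewrite ger0_norm ?sqr_ge0//; have := sqr_ge0 (f u - g u); nra.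
Qed.

Let ma : measurable_fun setT a. Proof. exact: continuous_measurable_fun (llc_a_cont lab). Qed.
Let mb : measurable_fun setT b. Proof. exact: continuous_measurable_fun (llc_b_cont lab). Qed.

Lemma log_cf_dom : exists2 K, 0 <= K & forall x, `|a x| <= K * x ^+ 2 /\ `|b x| <= K * (`|x| + x ^+ 2).
Proof.
have [C C0 HC] := llc_quad lab; have v0 := llc_v_ge0 lab.
exists (C + v + `|mu|); first by rewrite !addr_ge0.
move=> x; have [h1 h2] := HC x; have x2 := sqr_ge0 x.
have vx : 0 <= v * x ^+ 2 by rewrite mulr_ge0.
have mx : 0 <= `|mu| * x ^+ 2 by rewrite mulr_ge0.
split.
  rewrite -(addrK (v * x ^+ 2 / 2) (a x)) (le_trans (ler_normB _ _))//.
  by rewrite (le_trans (lerD h1 (lexx _)))// ger0_norm ?divr_ge0//; lra.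
rewrite -(subrK (mu * x) (b x)) (le_trans (ler_normD _ _))//.
rewrite (le_trans (lerD h2 (lexx _)))// normrM.
have : 0 <= (C + v) * `|x| by rewrite mulr_ge0// addr_ge0.
lra.
Qed.

Lemma log_cf_int g : L12 g -> intble (fun u => a (g u)) /\ intble (fun u => b (g u)).
Proof.
move=> [i1 i2]; have mg := integrable_real_meas i1; have [K K0 HK] := log_cf_dom.
split.
  apply: le_integrable_real (integrableZ_real K i2) => [|u]; first exact: measurableT_comp.
  exact: (HK _).1.
apply: le_integrable_real (integrableZ_real K (integrableD_real (integrable_abs i1) i2)) => [|u].
  exact: measurableT_comp.
exact: (HK _).2.
Qed.

Lemma measurable_tail (rho : R) (g : 'rV[R]_d -> R) : measurable_fun setT g ->
  measurable [set u | rho < `|g u|].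
Proof.
move=> mg; rewrite (_ : [set u | _] = ~` [set u | `|g u| <= rho]).
  apply: measurableC; rewrite -[X in measurable X]setTI; apply: measurable_fun_le => //.
  exact: measurableT_comp.
by apply/seteqP; split=> u /=; rewrite ltNge => /negP.
Qed.

Lemma integrable_tail rho g : L12 g -> intble (fun u => \1_[set u | rho < `|g u|] u * g u ^+ 2).
Proof.
move=> [i1 i2]; have mg := integrable_real_meas i1.
apply: le_integrable_real i2 => [|u].
  apply: measurable_funM; last exact: measurable_funX.
  by apply: measurable_indic; exact: measurable_tail.
rewrite normrM (ger0_norm (sqr_ge0 _)) ler_piMl ?sqr_ge0// indicE.
by case: (_ \in _); rewrite ?normr1 ?normr0.
Qed.

(** Where [|g| <= rho] the bound of small order applies with factor [e], elsewhere the global one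
    with [C]. That [C] precedes [e] allows the tail integral to be made small afterwards. *)
Lemma log_cf_est : exists2 C, 0 <= C & forall e, 0 < e -> exists2 rho : R, 0 < rho &
  forall g, L12 g ->
    let q := e * \int[leb]_u (g u ^+ 2) +
             C * \int[leb]_u (\1_[set u | rho < `|g u|] u * g u ^+ 2) in
    `|\int[leb]_u a (g u) + v / 2 * \int[leb]_u (g u ^+ 2)| <= q /\
    `|\int[leb]_u b (g u) - mu * \int[leb]_u g u| <= q.
Proof.
have [C C0 HC] := llc_quad lab; exists C => // e e0.
have [rho rho0 Hr] := llc_small lab e0; exists rho => // g Lg.
have [i1 i2] := Lg; have [ia ib] := log_cf_int Lg; have it := integrable_tail rho Lg.
have pt u (y : R) : `|y| <= C * g u ^+ 2 -> (`|g u| <= rho -> `|y| <= e * g u ^+ 2) ->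
    `|y| <= e * g u ^+ 2 + C * (\1_[set u | rho < `|g u|] u * g u ^+ 2).
  move=> y1 y2; rewrite indicE; case: (boolP (_ \in _)) => [_|].
    by rewrite mul1r (le_trans y1)// lerDr mulr_ge0 ?sqr_ge0// ltW.
  rewrite notin_setE/= => /negP; rewrite -leNgt => /y2 h.
  by rewrite mul0r mulr0 addr0.
have iq : intble (fun u => e * g u ^+ 2 + C * (\1_[set u | rho < `|g u|] u * g u ^+ 2)).
  by apply: integrableD_real; exact: integrableZ_real.
have qE : e * \int[leb]_u (g u ^+ 2) + C * \int[leb]_u (\1_[set u | rho < `|g u|] u * g u ^+ 2) =
    \int[leb]_u (e * g u ^+ 2 + C * (\1_[set u | rho < `|g u|] u * g u ^+ 2)).
  by rewrite RintegralD//; [rewrite !RintegralZl|exact: integrableZ_real|exact: integrableZ_real].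
rewrite /= qE; split.
  rewrite -RintegralZl// -RintegralD//; last exact: integrableZ_real.
  have ii := integrableD_real ia (integrableZ_real (v / 2) i2).
  apply: Rintegral_abs_le => //; first exact: integrable_real_meas ii.
  move=> u; have [h1 _] := HC (g u).
  have e1 : a (g u) + v / 2 * g u ^+ 2 = a (g u) + v * g u ^+ 2 / 2 by field.
  by rewrite e1; apply: pt => // /Hr[].
rewrite -RintegralZl// -RintegralB//; last exact: integrableZ_real.
have ii := integrableB_real ib (integrableZ_real mu i1).
apply: Rintegral_abs_le => //; first exact: integrable_real_meas ii.
by move=> u; have [_ h1] := HC (g u); apply: pt => // /Hr[].
Qed.

Lemma tail_small g e : L12 g -> 0 < e -> exists K : nat,
  \int[leb]_u (\1_[set u | K.+1%:R < `|g u|] u * g u ^+ 2) <= e.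
Proof.
move=> Lg e0; have [i1 i2] := Lg.
have [_ _] : [/\ measurable_fun [set: 'rV[R]_d] (fun=> 0 : R), intble (fun=> 0 : R) &
   \int[leb]_u (\1_[set u | k.+1%:R < `|g u|] u * g u ^+ 2) @[k --> \oo] --> \int[leb]_u (0 : R)].
  apply: (Rintegral_dct _ _ i2) => [k|u|k u].
  - exact: integrable_real_meas (integrable_tail _ Lg).
  - apply: cvg_near_cst; exists (Num.truncn `|g u|) => // k /= kg.
    rewrite indicE memNset ?mul0r//=; apply/negP; rewrite -leNgt.
    by rewrite (le_trans (ltW (truncnS_gt `|g u|)))// ler_nat ltnS.
  - rewrite normrM (ger0_norm (sqr_ge0 _)) ler_piMl ?sqr_ge0// indicE.
    by case: (_ \in _); rewrite ?normr1 ?normr0.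
rewrite [X in _ --> X](_ : _ = 0); last by rewrite /Rintegral integral0.
move=> /cvgr0Pnorm_le/(_ _ e0)[N _ /(_ N (leqnn N))/= h].
by exists N; rewrite (le_trans (ler_norm _)).
Qed.

Lemma log_cf_scale_small g : L12 g -> forall e, 0 < e -> exists2 r : R, 0 < r & forall z : R, `|z| <= r ->
  `|\int[leb]_u a (z * g u) + (v * \int[leb]_u (g u ^+ 2)) * z ^+ 2 / 2| <= e * z ^+ 2 /\
  `|\int[leb]_u b (z * g u) - z * (mu * \int[leb]_u g u)| <= e * z ^+ 2.
Proof.
move=> Lg e e0; have [i1 i2] := Lg.
have [C C0 HC] := log_cf_est.
pose S := \int[leb]_u (g u ^+ 2).
have S0 : 0 <= S by apply: Rintegral_ge0 => u _; exact: sqr_ge0.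
have eS : 0 < e / (2 * (S + 1)) by rewrite divr_gt0// mulr_gt0// ltr_wpDl.
have eC : 0 < e / (2 * (C + 1)) by rewrite divr_gt0// mulr_gt0// ltr_wpDl.
have [rho rho0 Hr] := HC _ eS; have [K HK] := tail_small Lg eC.
(* For such [z], [|z g| > rho] forces [|g| > K + 1], so the tail of [z g] beyond [rho] is at most
   [z^2] times a tail of [g] beyond a fixed level. *)
exists (rho / K.+1%:R); first by rewrite divr_gt0.
move=> z; rewrite ler_pdivlMr// => zr; have := Hr _ (L12Z z Lg) => /=.
have e1 : \int[leb]_u ((z * g u) ^+ 2) = z ^+ 2 * S.
  by rewrite -RintegralZl//; apply: eq_Rintegral => u _; rewrite exprMn.
have e2 : \int[leb]_u (z * g u) = z * \int[leb]_u g u by rewrite RintegralZl.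
have z2 := sqr_ge0 z.
have e3 : \int[leb]_u (\1_[set u | rho < `|z * g u|] u * (z * g u) ^+ 2) <=
    z ^+ 2 * (e / (2 * (C + 1))).
  apply: (@le_trans _ _ (z ^+ 2 * \int[leb]_u (\1_[set u | K.+1%:R < `|g u|] u * g u ^+ 2))).
    rewrite -RintegralZl//; last exact: integrable_tail.
    apply: le_Rintegral => //.
    - exact: (integrable_tail _ (L12Z z Lg)).
    - by apply: integrableZ_real; exact: integrable_tail.
    move=> u _; rewrite exprMn mulrCA; apply: ler_wpM2l => //.
    apply: ler_wpM2r; first exact: sqr_ge0.
    rewrite !indicE; case: (boolP (u \in [set u | rho < `|z * g u|])) => //.
    rewrite inE/= => h; rewrite mem_set//= ltNge; apply/negP => gK.
    move: h; apply/negP; rewrite -leNgt normrM.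
    by apply: le_trans zr; rewrite ler_wpM2l.
  by apply: ler_wpM2l.
have q : e / (2 * (S + 1)) * (z ^+ 2 * S) +
    C * \int[leb]_u (\1_[set u | rho < `|z * g u|] u * (z * g u) ^+ 2) <= e * z ^+ 2.
  have q1 : e / (2 * (S + 1)) * (z ^+ 2 * S) <= e / 2 * z ^+ 2.
    have -> : e / (2 * (S + 1)) * (z ^+ 2 * S) = (e / 2 * z ^+ 2) * (S / (S + 1)).
      by field; rewrite gt_eqF// ltr_wpDl.
    apply: ler_piMr; first by rewrite mulr_ge0// divr_ge0// ltW.
    by rewrite ler_pdivrMr ?ltr_wpDl// mul1r lerDl.
  have q2 : C * (z ^+ 2 * (e / (2 * (C + 1)))) <= e / 2 * z ^+ 2.
    have -> : C * (z ^+ 2 * (e / (2 * (C + 1)))) = (e / 2 * z ^+ 2) * (C / (C + 1)).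
      by field; rewrite gt_eqF// ltr_wpDl.
    apply: ler_piMr; first by rewrite mulr_ge0// divr_ge0// ltW.
    by rewrite ler_pdivrMr ?ltr_wpDl// mul1r lerDl.
  by have q4 := ler_wpM2l C0 e3; clear -q1 q2 q4; lra.
rewrite e1 e2 => -[h1 h2]; split.
  rewrite (_ : v * S * z ^+ 2 / 2 = v / 2 * (z ^+ 2 * S)); last by field.
  exact: (le_trans h1).
by rewrite mulrCA; exact: (le_trans h2).
Qed.

Context disp (T : measurableType disp) (P : probability T R).

Lemma moments_from_log_cf (D : set T) (W : T -> R) (p : R) g :
  measurable D -> measurable_fun setT W -> L12 g ->
  (forall z t, \int[P]_w (\1_D w * cos (z * W w + t)) =
     p * (expR (\int[leb]_u a (z * g u)) * cos (\int[leb]_u b (z * g u) + t))) ->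
  let W' w := W w - mu * \int[leb]_u g u in
  [/\ P.-integrable setT (EFin \o (fun w => \1_D w * W' w ^+ 2)),
      \int[P]_w (\1_D w * W' w ^+ 2) = p * (v * \int[leb]_u (g u ^+ 2)),
      P.-integrable setT (EFin \o (fun w => \1_D w * W' w)) &
      \int[P]_w (\1_D w * W' w) = 0].
Proof.
move=> mD mW Lg cf W'; have mW' : measurable_fun setT W' by exact: measurable_funB.
have V0 : 0 <= v * \int[leb]_u (g u ^+ 2).
  by rewrite mulr_ge0 ?(llc_v_ge0 lab)//; apply: Rintegral_ge0 => u _; exact: sqr_ge0.
have al0 z : \int[leb]_u a (z * g u) <= 0.
  rewrite -oppr_ge0 -RintegralN; last exact: (log_cf_int (L12Z z Lg)).1.
  by apply: Rintegral_ge0 => u _; rewrite oppr_ge0 (llc_a_le0 lab).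
have cf' z t : \int[P]_w (\1_D w * cos (z * W' w + t)) =
    p * (expR (\int[leb]_u a (z * g u)) *
      cos ((\int[leb]_u b (z * g u) - z * (mu * \int[leb]_u g u)) + t)).
  rewrite (_ : _ - _ + t = \int[leb]_u b (z * g u) + (t - z * (mu * \int[leb]_u g u))); last by ring.
  rewrite -cf; apply: eq_Rintegral => w _; congr (_ * cos _); rewrite /W'; ring.
have sm := log_cf_scale_small Lg.
have [f1 f2] := first_moment_from_cf mD mW' V0 al0 cf' sm.
split=> //; first exact: sq_integrable_from_cf mD mW' V0 al0 cf' sm.
exact: second_moment_from_cf mD mW' V0 al0 cf' sm.
Qed.

End log_cf_integrals.

(** * Uniqueness of the stochastic integral *)

Import HBNNSimple.

(* Along the subsequence [n_ k] the mass of [phi (n_ k)] concentrates on the k-th shell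
   [G m_(k+1) `\` G m_k]; [A] collects the shells of even rank. *)
Lemma gliding_hump d (T : measurableType d) (R : realType) (mu : {measure set T -> \bar R})
    (phi : nat -> T -> R) (G : nat -> set T) :
  (forall n, mu.-integrable setT (EFin \o phi n)) -> (forall n x, 0 <= phi n x) ->
  (forall m, measurable (G m)) -> (forall m m', (m <= m')%N -> G m `<=` G m') ->
  (forall m, \int[mu]_x (\1_(G m) x * phi n x) @[n --> \oo] --> 0) ->
  (forall n, \int[mu]_x (\1_(~` G m) x * phi n x) @[m --> \oo] --> 0) ->
  exists (A : set T) (n_ : nat -> nat), [/\ measurable A, forall k, (k <= n_ k)%N,
    forall k, ~~ odd k -> \int[mu]_x (\1_(~` A) x * phi (n_ k) x) <= 2 * k.+1%:R^-1 &
    forall k, odd k -> \int[mu]_x (\1_A x * phi (n_ k) x) <= 2 * k.+1%:R^-1].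
Proof.
move=> iphi phi0 mG ndG c1 c2.
have iI (C : set T) n : measurable C -> mu.-integrable setT (EFin \o (fun x => \1_C x * phi n x)).
  move=> mC; apply: le_integrable_real (iphi n) => [|x].
    by apply: measurable_funM; [exact: measurable_indic|exact: integrable_real_meas (iphi n)].
  rewrite normrM (ger0_norm (phi0 n x)) ler_piMl// indicE.
  by case: (_ \in _); rewrite ?normr1 ?normr0.
have hN m k : exists n, (k <= n)%N /\ \int[mu]_x (\1_(G m) x * phi n x) <= k.+1%:R^-1.
  have k0 : 0 < k.+1%:R^-1 :> R by rewrite invr_gt0.
  have /cvgr0Pnorm_le/(_ _ k0)[N _ h] := c1 m.
  exists (maxn k N); split; first exact: leq_maxl.
  by rewrite (le_trans (ler_norm _))// h//= leq_maxr.
have hM n m k : exists m', (m <= m')%N /\ \int[mu]_x (\1_(~` G m') x * phi n x) <= k.+1%:R^-1.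
  have k0 : 0 < k.+1%:R^-1 :> R by rewrite invr_gt0.
  have /cvgr0Pnorm_le/(_ _ k0)[N _ h] := c2 n.
  exists (maxn m N); split; first exact: leq_maxl.
  by rewrite (le_trans (ler_norm _))// h//= leq_maxr.
pose Nf m k := projT1 (cid (hN m k)); pose Mf n m k := projT1 (cid (hM n m k)).
have NfP m k : (k <= Nf m k)%N /\ \int[mu]_x (\1_(G m) x * phi (Nf m k) x) <= k.+1%:R^-1.
  exact: projT2 (cid (hN m k)).
have MfP n m k : (m <= Mf n m k)%N /\ \int[mu]_x (\1_(~` G (Mf n m k)) x * phi n x) <= k.+1%:R^-1.
  exact: projT2 (cid (hM n m k)).
(* Alternating choice: [n_ k] is so late that [phi (n_ k)] has mass at most [1 / (k + 1)] on
   [G (m_ k)], then [m_ k.+1] so large that at most [1 / (k + 1)] lies outside [G (m_ k.+1)]. Off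
   the k-th shell the mass is therefore at most [2 / (k + 1)]. *)
pose m_ := fix m_ k := if k is k'.+1 then Mf (Nf (m_ k') k') (m_ k') k' else 0%N.
pose n_ k := Nf (m_ k) k.
have m_nd k j : (k <= j)%N -> (m_ k <= m_ j)%N.
  elim: j => [|j IH]; first by rewrite leqn0 => /eqP ->.
  rewrite leq_eqVlt => /predU1P[->//|]; rewrite ltnS => /IH h.
  by apply: leq_trans h _; rewrite /= (MfP _ _ _).1.
pose Sh k := G (m_ k.+1) `\` G (m_ k).
have mSh k : measurable (Sh k) by exact: measurableD.
have disj k j x : (k < j)%N -> Sh k x -> Sh j x -> False.
  move=> kj [h1 _] [_ h2]; apply: h2; apply: ndG h1.
  exact: m_nd.
have off k (C : set T) : measurable C -> C `&` Sh k `<=` set0 ->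
    \int[mu]_x (\1_C x * phi (n_ k) x) <= 2 * k.+1%:R^-1.
  move=> mC CS; have [_ h1] := NfP (m_ k) k.
  have [_ h2] := MfP (n_ k) (m_ k) k.
  apply: (@le_trans _ _ (\int[mu]_x (\1_(G (m_ k)) x * phi (n_ k) x +
     \1_(~` G (m_ k.+1)) x * phi (n_ k) x))).
    apply: le_Rintegral => //; [exact: iI| |].
      by apply: integrableD_real; apply: iI => //; exact: measurableC.
    move=> x _; rewrite -mulrDl; apply: ler_wpM2r => //.
    rewrite !indicE in_setC; case: (boolP (x \in C)) => xC; last by rewrite addr_ge0.
    case: (boolP (x \in G (m_ k))) => x1; first by rewrite lerDl.
    case: (boolP (x \in G (m_ k.+1))) => x2; last by rewrite add0r.
    exfalso; apply: (CS x); split; first exact/set_mem.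
    by split; [exact/set_mem|move: x1; rewrite notin_setE].
  rewrite RintegralD//; [|exact: iI|by apply: iI; exact: measurableC].
  by rewrite mulr_natl mulr2n lerD.
pose A := \bigcup_(k in [set k | ~~ odd k]) Sh k.
have mA : measurable A by apply: bigcup_measurable => k _.
exists A, n_; split=> [//|k||]; first exact: (NfP _ _).1.
- move=> k ek; apply: off; first exact: measurableC.
  by move=> x [nA Sx]; apply: nA; exists k.
- move=> k ok; apply: off => // x [[j ej Sj] Sk].
  have [jk|jk|jk] := ltngtP j k; [exact: disj jk Sj Sk|exact: disj jk Sk Sj|].
  by move: ej; rewrite /= jk ok.
Qed.

Lemma le_thirds (R : realFieldType) (x y z e : R) :
  x <= e / 3 -> y <= e / 3 -> z <= e / 3 -> x + y + z <= e.
Proof. lra. Qed.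

Lemma norm_ge_third (R : realFieldType) (x y z e : R) :
  e <= `|x + y + z| -> `|x| < e / 3 -> `|y| < e / 3 -> e / 3 <= `|z|.
Proof. by have := ler_normD (x + y) z; have := ler_normD x y; lra. Qed.

Section levy_integral.
Context {disp} {T : measurableType disp} {R : realType} (P : probability T R).
Context (d : nat) (L : set 'rV[R]_d -> {RV P >-> R}).
Hypothesis lL : is_levy_basis L.
Variables (mu v : R) (a b : R -> R).
Hypothesis lab : levy_log_cf mu v a b.
Hypothesis cfL : forall A z t, bounded_borel A -> let l := fine (lebesgue_rV R d A) in
    \int[P]_w cos (z * L A w + t) = expR (l * a z) * cos (l * b z + t).
Local Notation leb := (lebesgue_rV R d).
Local Notation intble f := (leb.-integrable setT (EFin \o f)).
Local Notation SF := (simple_function (R := R) d).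
Local Notation I s := (simple_integral L s setT).

Lemma L12_simple (s : SF) : L12 (simple_eval s).
Proof. by split; [exact: integrable_simple_eval|exact: integrable_simple_eval_sq]. Qed.

Lemma simple_moments (s : SF) :
  let W w := I s w - mu * \int[leb]_u simple_eval s u in
  P.-integrable setT (EFin \o (fun w => W w ^+ 2)) /\
  \int[P]_w (W w ^+ 2) = v * \int[leb]_u (simple_eval s u ^+ 2).
Proof.
move=> W.
have cf z t : \int[P]_w (\1_(setT : set T) w * cos (z * I s w + t)) =
     1 * (expR (\int[leb]_u a (z * simple_eval s u)) * cos (\int[leb]_u b (z * simple_eval s u) + t)).
  have := simple_cf lL lab cfL (sfZ z s) t (indep_eventT L).
  rewrite probability_setT /= => e.
  under [X in expR X]eq_Rintegral do rewrite -simple_evalZ.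
  under [X in cos (X + _)]eq_Rintegral do rewrite -simple_evalZ.
  by rewrite -e; apply: eq_Rintegral => w _; rewrite simple_integralZ.
have [h1 h2 _ _] := moments_from_log_cf lab measurableT (measurable_simple_integral L s setT)
  (L12_simple s) cf.
split.
  by apply: eq_integrable h1 => // w _ /=; rewrite indicE in_setT mul1r.
rewrite mul1r in h2; rewrite -h2; apply: eq_Rintegral => w _.
by rewrite indicE in_setT mul1r.
Qed.

(** The first term controls the mean of a simple integral and the second its variance. *)
Definition mass (g : 'rV[R]_d -> R) u := `|g u| + g u ^+ 2.

Lemma mass_ge0 g u : 0 <= mass g u.
Proof. by rewrite addr_ge0// sqr_ge0. Qed.

Lemma mass_int g : L12 g -> intble (mass g).
Proof. by move=> [g1 g2]; apply: integrableD_real => //; exact: integrable_abs. Qed.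

(** The first entry of [dl] keeps the mean below [e / 2]; the second bounds the variance by
    [e' (e / 2)^2], and Chebyshev's inequality applies to the centred integral. *)
Lemma simple_integral_small (e e' : R) : 0 < e -> 0 < e' -> exists2 dl : R, 0 < dl &
  forall s : SF, \int[leb]_u mass (simple_eval s) u <= dl -> pr P [set w | e <= `|I s w|] <= e'.
Proof.
move=> e0 e'0; have v0 := llc_v_ge0 lab.
have m1 : 0 < `|mu| + 1 by rewrite ltr_wpDl.
have v1 : 0 < v + 1 by rewrite ltr_wpDl.
have e2 : 0 < e / 2 by rewrite divr_gt0.
pose dl := Num.min (e / 2 / (`|mu| + 1)) (e' * (e / 2) ^+ 2 / (v + 1)).
have dl0 : 0 < dl by rewrite lt_min !divr_gt0// mulr_gt0// exprn_gt0.
exists dl => // s sm.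
have [i1 i2] := L12_simple s; have ia := integrable_abs i1.
have [iW EW] := simple_moments s.
have sm' : \int[leb]_u `|simple_eval s u| + \int[leb]_u (simple_eval s u ^+ 2) <= dl.
  by rewrite -RintegralD.
have h1 : 0 <= \int[leb]_u `|simple_eval s u| by exact: Rintegral_ge0.
have h2 : 0 <= \int[leb]_u (simple_eval s u ^+ 2).
  by apply: Rintegral_ge0 => u _; exact: sqr_ge0.
have dl1 : dl <= e / 2 / (`|mu| + 1) by rewrite ge_min lexx.
have dl2 : dl <= e' * (e / 2) ^+ 2 / (v + 1) by rewrite ge_min lexx orbT.
have mI := measurable_simple_integral L s setT.
have mW : measurable_fun setT (fun w => I s w - mu * \int[leb]_u simple_eval s u).
  exact: measurable_funB.
have b1 : `|mu * \int[leb]_u simple_eval s u| <= e / 2.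
  rewrite normrM; apply: (@le_trans _ _ (`|mu| * \int[leb]_u `|simple_eval s u|)).
    apply: ler_wpM2l => //; apply: Rintegral_abs_le => //; exact: integrable_real_meas i1.
  apply: (@le_trans _ _ (`|mu| * (e / 2 / (`|mu| + 1)))).
    by apply: ler_wpM2l => //; apply: le_trans dl1; apply: le_trans sm'; rewrite lerDl.
  by rewrite mulrCA ler_piMr ?(ltW e2)// ler_pdivrMr// mul1r lerDl.
apply: (@le_trans _ _ (pr P [set w | e / 2 <= `|I s w - mu * \int[leb]_u simple_eval s u|])).
  have := @pr_le3_ae _ _ _ P [set w | e <= `|I s w|]
    [set w | e / 2 <= `|I s w - mu * \int[leb]_u simple_eval s u|] set0 set0.
  rewrite {3 4}/pr measure0/= !addr0; apply => //.
  - have := measurable_dist_ge e mI (measurable_cst (0 : R)).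
    by under eq_set do rewrite subr0.
  - exact: measurable_dist_ge.
  - apply: aeW => w /= h; constructor 1.
    have := ler_normD (I s w - mu * \int[leb]_u simple_eval s u) (mu * \int[leb]_u simple_eval s u).
    by rewrite subrK => h'; clear -h h' b1; lra.
apply: (le_trans (pr_chebyshev mW e2 iW)); rewrite EW ler_pdivrMr ?exprn_gt0//.
apply: (@le_trans _ _ (v * (e' * (e / 2) ^+ 2 / (v + 1)))).
  by apply: ler_wpM2l => //; apply: le_trans dl2; apply: le_trans sm'; rewrite lerDr.
rewrite mulrCA ler_piMr ?ler_pdivrMr ?mul1r ?lerDl//.
by apply: mulr_ge0; [exact: ltW|exact: sqr_ge0].
Qed.

Lemma simple_integral_split (s : SF) C (mC : measurable C) :
  {ae P, forall w, I s w = I (sfI s mC) w + I (sfI s (measurableC mC)) w}.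
Proof.
have H (j : 'I_(sf_size s)) : {ae P, forall w,
    L (sf_set j) w = L (sf_set j `&` C) w + L (sf_set j `&` ~` C) w}.
  have := levyU lL (bounded_borelI (sf_setP j) mC) (bounded_borelI (sf_setP j) (measurableC mC)).
  by rewrite -setIUr setUv setIT setIACA setICr setI0; exact.
apply: filterS (ae_forall_fin H) => w h; rewrite !simple_integralI /simple_integral -big_split/=.
by apply: eq_bigr => j _; rewrite setIT h mulrDr.
Qed.

Lemma mass_sfI (s : SF) C (mC : measurable C) u :
  mass (simple_eval (sfI s mC)) u = \1_C u * mass (simple_eval s) u.
Proof.
rewrite /mass simple_evalI indicE; case: (_ \in _); rewrite ?mul1r// !mul0r.
by rewrite normr0 expr0n addr0.
Qed.

(** Convergence to [0] almost everywhere does not make the masses tend to [0], as mass may escape.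
    The gliding hump yields one set [A] that carries nearly all the mass of [r (n_ k)] for even [k]
    and nearly none for odd [k]. Integrals over [A] at odd ranks are thus small, the Cauchy property
    over [A] passes this to the even ranks, and the part outside [A] is small there anyway. *)
Lemma simple_integral_unique (r : nat -> SF) :
  {ae leb, forall u, simple_eval (r n) u @[n --> \oo] --> 0} ->
  (forall C, measurable C -> forall e e' : R, 0 < e -> 0 < e' -> exists N, forall n m,
    (N <= n)%N -> (N <= m)%N ->
    pr P [set w | e <= `|simple_integral L (r n) C w - simple_integral L (r m) C w|] <= e') ->
  forall (e e' : R) N, 0 < e -> 0 < e' -> exists2 n, (N <= n)%N & pr P [set w | e <= `|I (r n) w|] <= e'.
Proof.
move=> r0 rC e e' N e0 e'0.
pose Bx (m : nat) : set 'rV[R]_d := [set u | forall i, u ord0 i \in `[- m%:R, m%:R]].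
have mBx m : measurable (Bx m).
  have := measurable_box (const_mx (- m%:R) : 'rV[R]_d) (const_mx m%:R).
  by under eq_set do under eq_forall do rewrite !mxE.
have bBx m : bounded_borel (Bx m).
  split=> //; apply: (@bounded_set_box _ _ m%:R) => u i /(_ i).
  by rewrite in_itv/= -ler_norml.
(* Part of a box on which all [r n] are bounded by [m]. Dominated convergence removes the mass from
   each [G m], and the sets exhaust almost all of space because convergent sequences are bounded. *)
pose G m := Bx m `&` \bigcap_n [set u | `|simple_eval (r n) u| <= m%:R].
have mG m : measurable (G m).
  apply: measurableI => //; apply: bigcap_measurable => // n _.
  rewrite -[X in measurable X]setTI; apply: measurable_fun_le => //.
  by apply: measurableT_comp => //; exact: measurable_simple_eval.
have ndG m m' : (m <= m')%N -> G m `<=` G m'.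
  move=> mm u [uB uG]; split=> [i|n _ /=].
    have := uB i; rewrite !in_itv/= -!ler_norml => /le_trans; apply.
    by rewrite ler_nat.
  by rewrite (le_trans (uG n Logic.I))// ler_nat.
pose phi n := mass (simple_eval (r n)).
have iphi n : intble (phi n) by apply: mass_int; exact: L12_simple.
have phi0 n u : 0 <= phi n u by exact: mass_ge0.
have mphi n : measurable_fun setT (phi n) by exact: integrable_real_meas (iphi n).
have c1 m : \int[leb]_u (\1_(G m) u * phi n u) @[n --> \oo] --> 0.
  have [] := @Rintegral_dct_ae _ _ _ leb (fun n u => \1_(G m) u * phi n u) (fun=> 0)
     (fun u => (m%:R + m%:R ^+ 2) * \1_(Bx m) u).
  - by move=> n; apply: measurable_funM => //; exact: measurable_indic.
  - exact: measurable_cst.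
  - apply: filterS r0 => u cu; rewrite -(mulr0 (\1_(G m) u)); apply: cvgM; first exact: cvg_cst.
    have -> : (0 : R) = `|(0 : R)| + (0 : R) ^+ 2 by rewrite normr0 expr0n addr0.
    by apply: cvgD; [exact: cvg_norm|apply: cvgM].
  - by apply: integrableZ_real; exact: integrable_indic_bounded_borel.
  - move=> n u; rewrite normrM (ger0_norm (phi0 n u)) !indicE.
    case: (boolP (u \in G m)) => [/set_mem[uB uG]|_]; last first.
      by rewrite normr0 mul0r mulr_ge0// addr_ge0// sqr_ge0.
    rewrite normr1 mul1r mem_set// mulr1; have := uG n Logic.I => /= h.
    by rewrite lerD// -(real_normK (num_real (simple_eval _ _))) lerXn2r ?nnegrE.
  by move=> _; rewrite [X in _ --> X](_ : _ = 0)//; rewrite /Rintegral integral0.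
have c2 n : \int[leb]_u (\1_(~` G m) u * phi n u) @[m --> \oo] --> 0.
  have [] := @Rintegral_dct_ae _ _ _ leb (fun m u => \1_(~` G m) u * phi n u) (fun=> 0) (phi n).
  - by move=> m; apply: measurable_funM => //; apply: measurable_indic; exact: measurableC.
  - exact: measurable_cst.
  - apply: filterS r0 => u cu; apply: cvg_near_cst.
    have : bounded_fun (fun n => simple_eval (r n) u).
      by apply: cvg_seq_bounded; apply/cvg_ex; exists 0.
    move=> [M [_ HM]].
    have hM k : `|simple_eval (r k) u| <= `|M| + 1.
      by apply: (HM (`|M| + 1)) => //; rewrite ltr_pwDr// ler_norm.
    exists (Num.truncn (`|M| + 1 + \sum_(i < d) `|u ord0 i|)).+1 => // m /= hm.
    have hm' : `|M| + 1 + \sum_(i < d) `|u ord0 i| <= m%:R.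
      by rewrite (le_trans (ltW (truncnS_gt _)))// ler_nat.
    have s0 : 0 <= \sum_(i < d) `|u ord0 i| by exact: sumr_ge0.
    rewrite indicE memNset ?mul0r//= => nG; apply: nG.
    split=> [i|k _ /=].
      rewrite in_itv/= -ler_norml (le_trans _ hm')// (bigD1 i)//=.
      have : 0 <= \sum_(i0 < d | i0 != i) `|u ord0 i0| by exact: sumr_ge0.
      by have := normr_ge0 M; lra.
    by rewrite (le_trans (hM k))// (le_trans _ hm')// lerDl.
  - exact: iphi.
  - move=> m u; rewrite normrM (ger0_norm (phi0 n u)) ler_piMl// indicE.
    by case: (_ \in _); rewrite ?normr1 ?normr0.
  by move=> _; rewrite [X in _ --> X](_ : _ = 0)//; rewrite /Rintegral integral0.
have [A [n_ [mA nk hE hO]]] := gliding_hump iphi phi0 mG ndG c1 c2.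
have e3 : 0 < e / 3 by rewrite divr_gt0.
have e'3 : 0 < e' / 3 by rewrite divr_gt0.
have [dl dl0 hdl] := simple_integral_small e3 e'3.
have [N1 hN1] := rC A mA _ _ e3 e'3.
have dl2 : 0 < dl / 2 by rewrite divr_gt0.
have /cvgr0Pnorm_le/(_ _ dl2)[N2 _ hN2] := @cvg_harmonic R.
have hsm k : (N2 <= k)%N -> 2 * k.+1%:R^-1 <= dl.
  move=> kN2; have h : `|k.+1%:R^-1 : R| <= dl / 2 := hN2 k kN2.
  by rewrite mulrC -ler_pdivlMr//; exact: le_trans (ler_norm _) h.
(* An even rank beyond all thresholds; [k.+1] is the odd rank it is compared with. *)
pose k := (maxn N (maxn N1 N2)).*2.
have kN : (maxn N (maxn N1 N2) <= k)%N by rewrite /k -addnn leq_addr.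
have [kN0 kN1 kN2] : [/\ N <= k, N1 <= k & N2 <= k]%N.
  by move: kN; rewrite !geq_max => /andP[? /andP[? ?]].
exists (n_ k); first exact: leq_trans (nk k).
have s1 : pr P [set w | e / 3 <= `|I (sfI (r (n_ k)) (measurableC mA)) w|] <= e' / 3.
  apply: hdl; under eq_Rintegral do rewrite mass_sfI.
  by apply: (le_trans (hE k _)); [rewrite /k odd_double|exact: hsm].
have s2 : pr P [set w | e / 3 <= `|I (sfI (r (n_ k.+1)) mA) w|] <= e' / 3.
  apply: hdl; under eq_Rintegral do rewrite mass_sfI.
  apply: (le_trans (hO k.+1 _)); first by rewrite /= /k odd_double.
  by apply: hsm; exact: leq_trans kN2 _.
have s3 := hN1 _ _ (leq_trans kN1 (nk k)) (leq_trans kN1 (leq_trans (leqnSn _) (nk k.+1))).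
have mI (s : SF) := measurable_simple_integral L s setT.
have mE (s : SF) (x : R) : measurable [set w | x <= `|I s w|].
  have := measurable_dist_ge x (mI s) (measurable_cst (0 : R)).
  by under eq_set do rewrite subr0.
have := @pr_le3_ae _ _ _ P [set w | e <= `|I (r (n_ k)) w|] _ _ _
   (mE _ _) (mE (sfI (r (n_ k)) (measurableC mA)) (e / 3)) (mE (sfI (r (n_ k.+1)) mA) (e / 3))
   (measurable_dist_ge (e / 3) (measurable_simple_integral L (r (n_ k)) A)
      (measurable_simple_integral L (r (n_ k.+1)) A)).
move=> H; apply: (le_trans (H _)); last exact: le_thirds.
apply: filterS (simple_integral_split (r (n_ k)) mA) => w hw /= h.
have [?|h1] := leP (e / 3) `|I (sfI (r (n_ k)) (measurableC mA)) w|; first by constructor 1.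
have [?|h2] := leP (e / 3) `|I (sfI (r (n_ k.+1)) mA) w|; first by constructor 2.
constructor 3; rewrite -!(simple_integralI L _ mA).
move: h; rewrite hw.
have -> : I (sfI (r (n_ k)) mA) w + I (sfI (r (n_ k)) (measurableC mA)) w =
  I (sfI (r (n_ k)) (measurableC mA)) w + I (sfI (r (n_ k.+1)) mA) w +
  (I (sfI (r (n_ k)) mA) w - I (sfI (r (n_ k.+1)) mA) w) by ring.
by move=> h; exact: norm_ge_third h h1 h2.
Qed.

Lemma nnsfun_box (p : {nnsfun 'rV[R]_d >-> R}) (m : nat) : exists s : SF, forall u,
  simple_eval s u = p u * \1_[set u : 'rV[R]_d | forall i, u ord0 i \in `[- m%:R, m%:R]] u.
Proof.
set B := [set u : 'rV[R]_d | _].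
have mB : measurable B.
  have := measurable_box (const_mx (- m%:R) : 'rV[R]_d) (const_mx m%:R).
  by under eq_set do under eq_forall do rewrite !mxE.
have bB : bounded_borel B.
  split=> //; apply: (@bounded_set_box _ _ m%:R) => u i /(_ i).
  by rewrite in_itv/= -ler_norml.
pose y := fset_set (p @` setT).
have bI (i : 'I_#|` y|) : bounded_borel (B `&` p @^-1` [set y`_i]).
  exact: bounded_borelI.
exists (SimpleFunction (fun i : 'I_#|` y| => y`_i) bI) => u.
rewrite fimfunEord mulr_suml; apply: eq_bigr => i _ /=.
by rewrite indicI/=; ring.
Qed.

(** Positive and negative parts are approximated from below and cut off to growing boxes. At each
    point one of the two parts vanishes, whence the domination by [|f|]. *)
Lemma L12_simple_approx (f : 'rV[R]_d -> R) : measurable_fun setT f ->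
  exists s : nat -> SF, (forall n u, `|simple_eval (s n) u| <= `|f u|) /\
    forall u, simple_eval (s n) u @[n --> \oo] --> f u.
Proof.
have diff_le (x y c : R) : x <= c -> y <= 0 -> 0 <= x -> 0 <= y -> `|x - y| <= c.
  by move=> ? ? ? ?; rewrite ler_norml; apply/andP; split; lra.
move=> mf.
pose fp u := Num.max (f u) 0; pose fm u := Num.max (- f u) 0.
have mfp : measurable_fun setT (EFin \o fp).
  by apply/measurable_EFinP; exact: measurable_maxr.
have mfm : measurable_fun setT (EFin \o fm).
  by apply/measurable_EFinP; apply: measurable_maxr => //; exact: measurableT_comp.
have fp0 u : 0 <= fp u by rewrite /fp le_max lexx orbT.
have fm0 u : 0 <= fm u by rewrite /fm le_max lexx orbT.
have approx (h : 'rV[R]_d -> R) (mh : measurable_fun setT (EFin \o h)) : (forall u, 0 <= h u) ->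
    (forall u, nnsfun_approx measurableT mh n u @[n --> \oo] --> h u) /\
    (forall n u, nnsfun_approx measurableT mh n u <= h u).
  move=> h0; have c u : nnsfun_approx measurableT mh n u @[n --> \oo] --> h u.
    have := @cvg_nnsfun_approx _ _ _ _ measurableT _ mh (fun x _ => h0 x) u Logic.I.
    by move=> /fine_cvgP[].
  split=> // n u.
  have nd : nondecreasing_seq (fun n => nnsfun_approx measurableT mh n u).
    by move=> i j ij; have /lefP := nd_nnsfun_approx measurableT mh ij; apply.
  rewrite -(cvg_lim _ (c u))//; apply: (@nondecreasing_cvgn_le _ (fun n => nnsfun_approx measurableT mh n u)) => //.
  by apply/cvg_ex; exists (h u); exact: c.
have [cp lp] := approx fp mfp fp0; have [cm lm] := approx fm mfm fm0.
pose sp n := projT1 (cid (nnsfun_box (nnsfun_approx measurableT mfp n) n)).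
pose sm n := projT1 (cid (nnsfun_box (nnsfun_approx measurableT mfm n) n)).
have spE n u := projT2 (cid (nnsfun_box (nnsfun_approx measurableT mfp n) n)) u.
have smE n u := projT2 (cid (nnsfun_box (nnsfun_approx measurableT mfm n) n)) u.
exists (fun n => sfD (sp n) (sfZ (-1) (sm n))).
have E n u : simple_eval (sfD (sp n) (sfZ (-1) (sm n))) u =
   (nnsfun_approx measurableT mfp n u - nnsfun_approx measurableT mfm n u) *
   \1_[set u : 'rV[R]_d | forall i, u ord0 i \in `[- n%:R, n%:R]] u.
  by rewrite simple_evalD simple_evalZ /sp /sm spE smE; ring.
split=> [n u|u].
  rewrite E normrM; apply: (@le_trans _ _ `|nnsfun_approx measurableT mfp n u - nnsfun_approx measurableT mfm n u|).
    by rewrite ler_piMr// indicE; case: (_ \in _); rewrite ?normr1 ?normr0.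
  have p0 : 0 <= nnsfun_approx measurableT mfp n u by exact: fun_ge0.
  have m0 : 0 <= nnsfun_approx measurableT mfm n u by exact: fun_ge0.
  move: (lp n u) (lm n u) p0 m0; rewrite /fp /fm.
  move: (nnsfun_approx measurableT mfp n u) (nnsfun_approx measurableT mfm n u) => x y.
  have [fu|fu] := leP 0 (f u).
    rewrite (ger0_norm fu) max_r ?oppr_le0// => h1 h2 h3 h4.
    exact: diff_le.
  rewrite (ltr0_norm fu) max_l ?oppr_ge0 ?(ltW fu)// => h1 h2 h3 h4.
  by rewrite distrC; exact: diff_le.
under eq_fun do rewrite E.
have -> : f u = (fp u - fm u) * 1.
  rewrite mulr1 /fp /fm; have [fu|fu] := leP 0 (f u).
    by rewrite max_r ?oppr_le0// subr0.
  by rewrite max_l ?oppr_ge0 ?(ltW fu)// opprK add0r.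
apply: cvgM; first exact: cvgB.
apply: cvg_near_cst; exists (Num.truncn (\sum_(i < d) `|u ord0 i|)).+1 => // n /= hn.
rewrite indicE mem_set//= => i; rewrite in_itv/= -ler_norml.
apply: (@le_trans _ _ (\sum_(i < d) `|u ord0 i|)).
  by rewrite (bigD1 i)//= lerDl sumr_ge0.
by rewrite (le_trans (ltW (truncnS_gt _)))// ler_nat.
Qed.

End levy_integral.

(** * Stochastic integrals as limits of dominated simple integrals *)

Section levy_integral_limit.
Context {disp} {T : measurableType disp} {R : realType} (P : probability T R).
Context (d : nat) (L : set 'rV[R]_d -> {RV P >-> R}).
Hypothesis lL : is_levy_basis L.
Variables (mu v : R) (a b : R -> R).
Hypothesis lab : levy_log_cf mu v a b.
Hypothesis cfL : forall A z t, bounded_borel A -> let l := fine (lebesgue_rV R d A) in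
    \int[P]_w cos (z * L A w + t) = expR (l * a z) * cos (l * b z + t).
Local Notation leb := (lebesgue_rV R d).
Local Notation SF := (simple_function (R := R) d).
Local Notation I s := (simple_integral L s setT).

(** Stable under linear combinations, and with a domination in [L^1] and [L^2] that lets the
    exponent pass to the limit; convergence is asked over the whole space only. *)
Definition dominated_integral (f : 'rV[R]_d -> R) (W : T -> R) :=
  exists (s : nat -> SF) (F : 'rV[R]_d -> R),
    [/\ L12 F, forall n u, `|simple_eval (s n) u| <= F u,
        forall u, simple_eval (s n) u @[n --> \oo] --> f u,
        measurable_fun setT W & cvgP P (fun n => I (s n)) W].

Lemma dominated_integralD f1 f2 W1 W2 :
  dominated_integral f1 W1 -> dominated_integral f2 W2 ->
  dominated_integral (fun u => f1 u + f2 u) (fun w => W1 w + W2 w).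
Proof.
move=> [s1 [F1 [L1 b1 c1 m1 p1]]] [s2 [F2 [L2 b2 c2 m2 p2]]].
exists (fun n => sfD (s1 n) (s2 n)), (fun u => F1 u + F2 u); split.
- exact: L12D.
- by move=> n u; rewrite simple_evalD (le_trans (ler_normD _ _))// lerD.
- by move=> u; under eq_fun do rewrite simple_evalD; exact: cvgD.
- exact: measurable_funD.
- have := @cvgPD _ _ _ P (fun n => I (s1 n)) (fun n => I (s2 n)) W1 W2
    (fun n => measurable_simple_integral L (s1 n) setT)
    (fun n => measurable_simple_integral L (s2 n) setT) m1 m2 p1 p2.
  by congr cvgP; apply/funext => n; apply/funext => w; rewrite simple_integralD.
Qed.

Lemma dominated_integralZ f W c :
  dominated_integral f W -> dominated_integral (fun u => c * f u) (fun w => c * W w).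
Proof.
move=> [s [F [L1 b1 c1 m1 p1]]].
exists (fun n => sfZ c (s n)), (fun u => `|c| * F u); split.
- exact: L12Z.
- by move=> n u; rewrite simple_evalZ normrM ler_wpM2l.
- by move=> u; under eq_fun do rewrite simple_evalZ; apply: cvgM => //; exact: cvg_cst.
- exact: measurable_funM.
- have := @cvgPZ _ _ _ P (fun n => I (s n)) W c
    (fun n => measurable_simple_integral L (s n) setT) m1 p1.
  by congr cvgP; apply/funext => n; apply/funext => w; rewrite simple_integralZ.
Qed.

Lemma dominated_integral0 : dominated_integral (fun=> 0) (fun=> 0).
Proof.
exists (fun=> sf0 R d), (fun=> 0); split => //.
- split; first by have := @integrable_simple_eval R d (sf0 R d); apply: eq_integrable => // u _ /=; rewrite simple_eval0.
  by have := @integrable_simple_eval R d (sf0 R d); apply: eq_integrable => // u _ /=; rewrite simple_eval0 expr0n.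
- by move=> n u; rewrite simple_eval0 normr0.
- by move=> u; under eq_fun do rewrite simple_eval0; exact: cvg_cst.
- move=> e e' e0 e'0; exists 0%N => n _.
  rewrite (_ : [set w | _] = set0); first by rewrite /pr measure0 ltW.
  by apply/seteqP; split=> // w /=; rewrite simple_integral0 subrr normr0 leNgt e0.
Qed.

Lemma dominated_integral_sum (J : Type) (r : seq J) (f : J -> 'rV[R]_d -> R) (W : J -> T -> R) :
  (forall j, dominated_integral (f j) (W j)) ->
  dominated_integral (fun u => \sum_(j <- r) f j u) (fun w => \sum_(j <- r) W j w).
Proof.
move=> H; elim: r => [|j r IH].
  under eq_fun do rewrite big_nil; under [X in dominated_integral _ X]eq_fun do rewrite big_nil.
  exact: dominated_integral0.
under eq_fun do rewrite big_cons; under [X in dominated_integral _ X]eq_fun do rewrite big_cons.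
exact: dominated_integralD.
Qed.

Lemma dominated_integral_L12 f W : dominated_integral f W -> L12 f.
Proof.
move=> [s [F [LF bs cs _ _]]].
have mf : measurable_fun setT f.
  by apply: (@measurable_fun_cvg _ _ _ _ (fun n => simple_eval (s n))) => [n|u _];
     [exact: measurable_simple_eval|exact: cs].
apply: (L12_le mf _ LF) => u.
have c : `|simple_eval (s n) u| @[n --> \oo] --> `|f u| by apply: cvg_norm; exact: cs.
rewrite -(cvg_lim _ c)//; apply: limr_le; first by apply/cvg_ex; exists `|f u|; exact: c.
exact: nearW.
Qed.

(** Both sides of [simple_cf] pass to the limit: the left one by convergence in probability, the
    right one by dominated convergence, with the majorants of [log_cf_dom] at [F]. *)
Lemma dominated_integral_cf f W D t : dominated_integral f W -> indep_event L D ->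
  \int[P]_w (\1_D w * cos (W w + t)) =
  pr P D * (expR (\int[leb]_u a (f u)) * cos (\int[leb]_u b (f u) + t)).
Proof.
move=> dfW iD; have [s [F [LF bs cs mW cW]]] := dfW.
have [K K0 HK] := log_cf_dom lab.
have c1 := @cvgP_cos _ _ _ P (fun n => I (s n)) W D t iD.1
  (fun n => measurable_simple_integral L (s n) setT) mW cW.
have ia := (log_cf_int lab (dominated_integral_L12 dfW)).
have F2 n u : simple_eval (s n) u ^+ 2 <= F u ^+ 2.
  rewrite -(real_normK (num_real (simple_eval _ _))) lerXn2r ?nnegrE//.
  exact: le_trans (bs n u).
have [_ _ ca] : [/\ measurable_fun setT (fun u => a (f u)),
   leb.-integrable setT (EFin \o (fun u => a (f u))) &
   \int[leb]_u a (simple_eval (s n) u) @[n --> \oo] --> \int[leb]_u a (f u)].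
  apply: (Rintegral_dct _ _ (integrableZ_real K LF.2)) => [n|u|n u].
  - apply: measurableT_comp; last exact: measurable_simple_eval.
    exact: continuous_measurable_fun (llc_a_cont lab).
  - by apply: continuous_cvg; [exact: (llc_a_cont lab)|exact: cs].
  - by rewrite (le_trans (HK _).1)// ler_wpM2l.
have [_ _ cb] : [/\ measurable_fun setT (fun u => b (f u)),
   leb.-integrable setT (EFin \o (fun u => b (f u))) &
   \int[leb]_u b (simple_eval (s n) u) @[n --> \oo] --> \int[leb]_u b (f u)].
  apply: (Rintegral_dct _ _ (integrableZ_real K (integrableD_real LF.1 LF.2))) => [n|u|n u].
  - apply: measurableT_comp; last exact: measurable_simple_eval.
    exact: continuous_measurable_fun (llc_b_cont lab).
  - by apply: continuous_cvg; [exact: (llc_b_cont lab)|exact: cs].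
  - by rewrite (le_trans (HK _).2)// ler_wpM2l// lerD.
have c2 : \int[P]_w (\1_D w * cos (I (s n) w + t)) @[n --> \oo] -->
    pr P D * (expR (\int[leb]_u a (f u)) * cos (\int[leb]_u b (f u) + t)).
  under eq_fun do rewrite (simple_cf lL lab cfL _ _ iD).
  apply: cvgM; first exact: cvg_cst.
  apply: cvgM; first by apply: continuous_cvg; [exact: continuous_expR|exact: ca].
  have cbt : \int[leb]_u b (simple_eval (s n) u) + t @[n --> \oo] --> \int[leb]_u b (f u) + t.
    by apply: cvgD => //; exact: cvg_cst.
  by apply: continuous_cvg; [exact: continuous_cos|exact: cbt].
exact: (cvg_unique _ c1 c2).
Qed.

(** The given simple functions [s] are compared with a dominated sequence [s'] for the same [f]. The
    integrals of [s'] are Cauchy by [simple_integral_small], and [simple_integral_unique] for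
    [s - s'] identifies their limit with [W]. *)
Lemma levy_integral_dominated f (W : {RV P >-> R}) : L12 f ->
  is_levy_integral L f setT W -> dominated_integral f W.
Proof.
move=> Lf [mf [s [cs HB cW]]].
have [s' [bs' cs']] := L12_simple_approx mf.
have {}cW := cvgP_cvg_in_probability cW.
have mI (s0 : SF) C := measurable_simple_integral L s0 C.
exists s', (fun u => `|f u|); split => //; first exact: L12_abs.
(* [s'] is Cauchy in L^1 and in L^2, hence its integrals are Cauchy in probability. *)
pose dif n m := sfD (s' n) (sfZ (-1) (s' m)).
have difE n m u : simple_eval (dif n m) u = simple_eval (s' n) u - simple_eval (s' m) u.
  by rewrite simple_evalD simple_evalZ; ring.
have difI n m C w : simple_integral L (dif n m) C w =
    simple_integral L (s' n) C w - simple_integral L (s' m) C w.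
  by rewrite simple_integralD simple_integralZ; ring.
pose g n u := mass (fun u => simple_eval (s' n) u - f u) u.
have lg n : L12 (fun u => simple_eval (s' n) u - f u).
  by apply: L12D; [exact: L12_simple|have := L12Z (-1) Lf; under eq_fun do rewrite mulN1r].
have cg : \int[leb]_u g n u @[n --> \oo] --> 0.
  have [_ _ ] : [/\ measurable_fun [set: 'rV[R]_d] (fun=> 0 : R),
     leb.-integrable setT (EFin \o (fun=> 0 : R)) & \int[leb]_u g n u @[n --> \oo] --> \int[leb]_u (0 : R)].
    apply: (Rintegral_dct _ _ (integrableZ_real 4 (mass_int Lf))) => [n|u|n u].
    - exact: integrable_real_meas (mass_int (lg n)).
    - have c0 : simple_eval (s' n) u - f u @[n --> \oo] --> (0 : R).
        rewrite -(subrr (f u)); apply: cvgB; [exact: cs'|exact: cvg_cst].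
      have -> : (0 : R) = `|(0 : R)| + (0 : R) * (0 : R) by rewrite normr0 mulr0 addr0.
      by apply: cvgD; [exact: cvg_norm|apply: cvgM].
    - rewrite ger0_norm ?mass_ge0// /g /mass.
      have h : `|simple_eval (s' n) u - f u| <= 2 * `|f u|.
        by rewrite (le_trans (ler_normB _ _))// mulr_natl mulr2n lerD2r.
      have h2 : (simple_eval (s' n) u - f u) ^+ 2 <= 4 * f u ^+ 2.
        rewrite -(real_normK (num_real (_ - _))) -(real_normK (num_real (f u))).
        rewrite (_ : 4 * _ = (2 * `|f u|) ^+ 2); last by ring.
        by rewrite lerXn2r ?nnegrE// mulr_ge0.
      by have := normr_ge0 (f u); lra.
  by rewrite [X in _ --> X](_ : _ = 0)//; rewrite /Rintegral integral0.
have mdif n m : \int[leb]_u mass (simple_eval (dif n m)) u <=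
    2 * (\int[leb]_u g n u + \int[leb]_u g m u).
  have igm k : leb.-integrable setT (EFin \o g k) by exact: mass_int (lg k).
  rewrite -RintegralD// -RintegralZl//; last exact: integrableD_real.
  apply: le_Rintegral => //; [exact: mass_int (L12_simple _)| |].
    by apply: integrableZ_real; exact: integrableD_real.
  move=> u _; rewrite /g /mass difE.
  set x := simple_eval (s' n) u; set y := simple_eval (s' m) u.
  have -> : x - y = (x - f u) - (y - f u) by ring.
  have := ler_normB (x - f u) (y - f u); have := sqr_ge0 ((x - f u) + (y - f u)).
  have := normr_ge0 (x - f u); have := normr_ge0 (y - f u).
  by move: (x - f u) (y - f u) => p q; nra.
have cau' C (mC : measurable C) (e e' : R) : 0 < e -> 0 < e' -> exists N, forall n m,
    (N <= n)%N -> (N <= m)%N ->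
    pr P [set w | e <= `|simple_integral L (s' n) C w - simple_integral L (s' m) C w|] <= e'.
  move=> e0 e'0; have [dl dl0 hdl] := simple_integral_small lL lab cfL e0 e'0.
  have dl4 : 0 < dl / 4 by rewrite divr_gt0.
  have /cvgr0Pnorm_le/(_ _ dl4)[N _ hN] := cg; exists N => n m nN mN.
  have := hdl (sfI (dif n m) mC).
  rewrite (_ : [set w | _] = [set w | e <= `|simple_integral L (s' n) C w - simple_integral L (s' m) C w|]); last first.
    by apply/seteqP; split=> w /=; rewrite simple_integralI difI.
  apply; under eq_Rintegral do rewrite mass_sfI.
  have h1 : `|\int[leb]_u g n u| <= dl / 4 := hN n nN.
  have h2 : `|\int[leb]_u g m u| <= dl / 4 := hN m mN.
  have h3 := mdif n m.
  apply: (@le_trans _ _ (\int[leb]_u mass (simple_eval (dif n m)) u)); last first.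
    by have := ler_norm (\int[leb]_u g n u); have := ler_norm (\int[leb]_u g m u); lra.
  have im := mass_int (L12_simple (dif n m)).
  apply: le_Rintegral => //.
    apply: (le_integrable_real _ _ im) => [|u].
      by apply: measurable_funM; [exact: measurable_indic|exact: integrable_real_meas im].
    rewrite normrM (ger0_norm (mass_ge0 _ _)) ler_piMl ?mass_ge0// indicE.
    by case: (_ \in _); rewrite ?normr1 ?normr0.
  move=> u _; rewrite ler_piMl ?mass_ge0// indicE; case: (_ \in _) => //.
(* These differences tend to [0] almost everywhere and have Cauchy integrals over every Borel set,
   as [simple_integral_unique] asks. *)
pose r n := sfD (s n) (sfZ (-1) (s' n)).
have rI n C w : simple_integral L (r n) C w =
    simple_integral L (s n) C w - simple_integral L (s' n) C w.
  by rewrite simple_integralD simple_integralZ; ring.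
have r0 : {ae leb, forall u, simple_eval (r n) u @[n --> \oo] --> 0}.
  apply: filterS cs => u cu.
  have rE n : simple_eval (r n) u = simple_eval (s n) u - simple_eval (s' n) u.
    by rewrite simple_evalD simple_evalZ mulN1r.
  by under eq_fun do rewrite rE; have := cvgB cu (cs' u); rewrite subrr; exact.
have rC C : measurable C -> forall e e' : R, 0 < e -> 0 < e' -> exists N, forall n m,
    (N <= n)%N -> (N <= m)%N ->
    pr P [set w | e <= `|simple_integral L (r n) C w - simple_integral L (r m) C w|] <= e'.
  move=> mC e e' e0 e'0; have [WB /cvgP_cvg_in_probability cB] := HB C mC.
  have e3 : 0 < e / 3 by rewrite divr_gt0.
  have e'3 : 0 < e' / 3 by rewrite divr_gt0.
  have [N1 h1] := cB _ _ e3 e'3; have [N2 h2] := cau' C mC _ _ e3 e'3.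
  exists (maxn N1 N2) => n m; rewrite !geq_max => /andP[n1 n2] /andP[m1 m2].
  have q1 := h1 n n1; have q2 := h1 m m1; have q3 := h2 n m n2 m2.
  have := @pr_le3_ae _ _ _ P _ _ _ _
    (measurable_dist_ge e (mI (r n) C) (mI (r m) C))
    (measurable_dist_ge (e / 3) (mI (s n) C) (measurable_funP WB))
    (measurable_dist_ge (e / 3) (mI (s m) C) (measurable_funP WB))
    (measurable_dist_ge (e / 3) (mI (s' n) C) (mI (s' m) C)).
  move=> H; apply: (le_trans (H _)); last exact: le_thirds.
  apply: aeW => w /=; rewrite !rI => h.
  have [?|k1] := leP (e / 3) `|simple_integral L (s n) C w - WB w|; first by constructor 1.
  have [?|k2] := leP (e / 3) `|simple_integral L (s m) C w - WB w|; first by constructor 2.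
  constructor 3; move: h k1 k2.
  set x := simple_integral L (s n) C w; set y := simple_integral L (s m) C w.
  set x' := simple_integral L (s' n) C w; set y' := simple_integral L (s' m) C w.
  have -> : x - x' - (y - y') = (x - WB w) + - (y - WB w) + - (x' - y') by ring.
  by move=> h; rewrite -[ `|y - _|]normrN -[ `|x' - _|]normrN; exact: norm_ge_third h.
have uniq := simple_integral_unique lL lab cfL r0 rC.
move=> e e' e0 e'0.
have e3 : 0 < e / 3 by rewrite divr_gt0.
have e'3 : 0 < e' / 3 by rewrite divr_gt0.
have [N1 h1] := cW _ _ e3 e'3; have [N2 h2] := cau' setT measurableT _ _ e3 e'3.
(* One late index [m] at which both sequences have close integrals suffices: there the integral of
   [s] is close to [W], and that of [s'] is close to all later ones. *)
have [m] := uniq _ _ (maxn N1 N2) e3 e'3.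
rewrite geq_max => /andP[m1 m2] h3.
exists N2 => n n2.
have q1 := h1 m m1; have q2 := h2 n m n2 m2.
have mE : measurable [set w | e / 3 <= `|I (r m) w|].
  have := measurable_dist_ge (e / 3) (mI (r m) setT) (measurable_cst (0 : R)).
  by under eq_set do rewrite subr0.
have := @pr_le3_ae _ _ _ P _ _ _ _
    (measurable_dist_ge e (mI (s' n) setT) (measurable_funP W))
    (measurable_dist_ge (e / 3) (mI (s m) setT) (measurable_funP W))
    (measurable_dist_ge (e / 3) (mI (s' n) setT) (mI (s' m) setT)) mE.
move=> H; apply: (le_trans (H _)); last exact: le_thirds.
apply: aeW => w /= h.
have [?|k1] := leP (e / 3) `|I (s m) w - W w|; first by constructor 1.
have [?|k2] := leP (e / 3) `|I (s' n) w - I (s' m) w|; first by constructor 2.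
constructor 3; rewrite rI; move: h k1 k2.
set x := I (s m) w; set x' := I (s' n) w; set y' := I (s' m) w.
have -> : x' - W w = (x - W w) + (x' - y') + - (x - y') by ring.
by move=> h; rewrite -[ `|x - y'|]normrN; exact: norm_ge_third h.
Qed.

End levy_integral_limit.

(** * Reflection invariance of Lebesgue measure *)

Section reflection.
Variable R : realType.
Local Open Scope ereal_scope.

Lemma ge0_integral_lebesgue_rVS d (h : 'rV[R]_d.+1 -> \bar R) :
  measurable_fun setT h -> (forall u, 0 <= h u) ->
  \int[lebesgue_rV R d.+1]_u h u =
  \int[@lebesgue_measure R]_x \int[lebesgue_rV R d]_u h (cons_rV (x, u)).
Proof.
move=> mh h0.
transitivity (\int[(@lebesgue_measure R \x lebesgue_rV R d)%E]_p (h \o @cons_rV R d) p).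
  pose M : {measure set (measurableTypeR R * 'rV[R]_d)%type -> \bar R} :=
    (@lebesgue_measure R \x lebesgue_rV R d)%E.
  have mc : measurable_fun [set: (measurableTypeR R * 'rV[R]_d)%type] (@cons_rV R d).
    exact: measurable_cons_rV.
  have E := @ge0_integral_pushforward _ _ _ _ R _ mc
    M setT h measurableT mh (fun u _ => h0 u).
  rewrite preimage_setT in E.
  rewrite -E; exact: eq_measure_integral.
rewrite fubini_tonelli1//.
  by apply: measurableT_comp => //; exact: measurable_cons_rV.
by move=> p; exact: h0.
Qed.

(** The reflection carries []a, b]] to an interval of the same length, and half-open intervals
    determine the measure. *)
Lemma lebesgue_measure_reflect (c : R) (A : set R) : measurable A ->
  pushforward (@lebesgue_measure R) (fun x : measurableTypeR R => (c - x)%R : measurableTypeR R) A =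
  lebesgue_measure A.
Proof.
have mf : measurable_fun setT (fun x : measurableTypeR R => (c - x)%R : measurableTypeR R).
  exact: measurable_funB.
move=> mA; apply/esym.
pose m := (measure_function_pushforward__canonical__measure_function_Measure
   (@lebesgue_measure R) mf).
apply: (lebesgue_measure_unique (mu := m)) => //= _ [[a b]] _ <-.
rewrite /pushforward.
have -> : (fun x : R => (c - x)%R) @^-1` `]a, b]%classic = `[(c - b)%R, (c - a)%R[%classic.
  apply/seteqP; split => x /=; rewrite !in_itv/= => /andP[h1 h2]; apply/andP; split; lra.
rewrite !lebesgue_measure_itv/= !lte_fin.
rewrite ltrD2l ltrN2; case: ifPn => // _; congr (_%:E); lra.
Qed.

Lemma ge0_integral_reflect1 (c : R) (h : R -> \bar R) :
  measurable_fun setT h -> (forall u, 0 <= h u) ->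
  \int[@lebesgue_measure R]_x h (c - x)%R = \int[@lebesgue_measure R]_x h x.
Proof.
move=> mh h0.
have mf : measurable_fun setT (fun x : measurableTypeR R => (c - x)%R : measurableTypeR R).
  exact: measurable_funB.
transitivity (\int[pushforward (@lebesgue_measure R) (fun x : measurableTypeR R => (c - x)%R : measurableTypeR R)]_x h x).
  apply/esym; rewrite -[in RHS](preimage_setT (fun x : measurableTypeR R => (c - x)%R : measurableTypeR R)).
  exact: (@ge0_integral_pushforward _ _ _ _ R _ mf).
by apply: eq_measure_integral => A mA _; exact: lebesgue_measure_reflect.
Qed.

Lemma measurable_reflect d (c : 'rV[R]_d) : measurable_fun setT (fun u : 'rV[R]_d => (c - u)%R).
Proof.
apply: measurable_fun_mx => i j.
rewrite (_ : (fun x : 'rV[R]_d => (c - x)%R i j) = (fun x => (c i j - x i j)%R)).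
  by apply: measurable_funB => //; exact: measurable_coord_mx.
by apply/funext => x; rewrite !mxE.
Qed.

(** Induction on the dimension, one coordinate at a time. Reflections are the natural substitutions
    here, since the kernels have the form [f (t - u)], and two of them compose to a translation. *)
Lemma ge0_integral_reflect d (c : 'rV[R]_d) (h : 'rV[R]_d -> \bar R) :
  measurable_fun setT h -> (forall u, 0 <= h u) ->
  \int[lebesgue_rV R d]_u h (c - u)%R = \int[lebesgue_rV R d]_u h u.
Proof.
elim: d c h => [|d IH] c h mh h0.
  by apply: eq_integral => u _; rewrite (_ : (c - u)%R = u)//; apply/rowP => -[].
have mB := measurable_reflect c.
rewrite (ge0_integral_lebesgue_rVS mh h0).
have mh' : measurable_fun setT (fun u : 'rV[R]_d.+1 => h (c - u)%R) by exact: measurableT_comp.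
rewrite (ge0_integral_lebesgue_rVS mh' (fun u => h0 _)).
pose G x := \int[lebesgue_rV R d]_u h (cons_rV (x, u)).
transitivity (\int[@lebesgue_measure R]_x G (c ord0 ord0 - x)%R).
  apply: eq_integral => x _.
  rewrite -(IH (uncons_rV c).2) //.
    apply: eq_integral => u _; congr (h _); apply/rowP => i.
    have [j ->|->] := unliftP ord0 i.
      by rewrite cons_rVS [LHS]mxE [X in (_ + X)%R]mxE cons_rVS !mxE subKr.
    by rewrite cons_rV0 [LHS]mxE [X in (_ + X)%R]mxE cons_rV0.
  have m1 := measurableT_comp mh (measurableT_comp mB (@measurable_cons_rV R d)).
  exact: (measurableT_comp m1 (measurable_pair1 x)).
rewrite ge0_integral_reflect1//.
  apply: (@measurable_fun_fubini_tonelli_F _ _ _ _ R (lebesgue_rV R d) (fun p => h (cons_rV p))) => [|p].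
    by apply: (measurableT_comp mh); exact: measurable_cons_rV.
  exact: h0.
by move=> x; apply: integral_ge0.
Qed.

Local Close Scope ereal_scope.
Variable d : nat.
Local Notation leb := (lebesgue_rV R d).
Implicit Types (c : 'rV[R]_d) (g : 'rV[R]_d -> R).

Lemma Rintegral_reflect c g : measurable_fun setT g ->
  \int[leb]_u g (c - u) = \int[leb]_u g u.
Proof.
move=> mg; rewrite /Rintegral; congr fine.
rewrite integralE [RHS]integralE.
have mg' : measurable_fun setT (EFin \o g) by exact/measurable_EFinP.
congr (_ - _)%E.
  rewrite -(ge0_integral_reflect c (measurable_funepos mg')); last by move=> u; exact: funepos_ge0.
  by apply: eq_integral => u _; rewrite !funeposE.
rewrite -(ge0_integral_reflect c (measurable_funeneg mg')); last by move=> u; exact: funeneg_ge0.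
by apply: eq_integral => u _; rewrite !funenegE.
Qed.

Lemma integrable_reflect c g : leb.-integrable setT (EFin \o g) ->
  leb.-integrable setT (EFin \o (fun u => g (c - u))).
Proof.
move=> ig; have mg := integrable_real_meas ig.
apply/integrableP; split.
  by apply/measurable_EFinP; apply: (measurableT_comp mg); exact: measurable_reflect.
have /integrableP[_] := ig; congr (_ < _)%E; apply/esym.
apply: (ge0_integral_reflect c (h := fun u => `|(g u)%:E|%E)) => // u.
by apply: measurableT_comp => //; apply/measurable_EFinP.
Qed.

Lemma L12_reflect c g : L12 g -> L12 (fun u => g (c - u)).
Proof. by move=> [i1 i2]; split; [exact: integrable_reflect|exact: (integrable_reflect c i2)]. Qed.

End reflection.

(** * Lattice windows *)

Section lattice_windows.
Variable d : nat.
Local Notation Zd := 'rV[int]_d.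

Definition Wn (n : nat) : {fset Zd} := fset_set (@window d n).

Lemma in_Wn n t : (t \in Wn n) = `[< window n t >].
Proof. rewrite in_fset_set; last exact: finite_window.
by apply/idP/asboolP => [/set_mem|/mem_set]. Qed.

Lemma card_Wn n : #|` Wn n| = ((n + n) ^ d)%N.
Proof.
pose phi (s : 'rV['I_(n + n)]_d) : Zd := \row_i ((s ord0 i : nat)%:Z - n%:Z).
have phi_inj : injective phi.
  move=> s s' /rowP h; apply/rowP => i; apply/val_inj.
  by have := h i; rewrite !mxE => /addIr[].
have -> : #|` Wn n| = size (map phi (enum 'rV['I_(n + n)]_d)).
  apply: perm_size; apply: uniq_perm => //.
    by rewrite map_inj_uniq// enum_uniq.
  move=> t; rewrite in_Wn; apply/asboolP/mapP => [tn|[s _ ->] i]; last first.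
    have := ltn_ord (s ord0 i); rewrite mxE => h; apply/andP; split.
      by rewrite lerBrDr addNr.
    by rewrite ltrBlDr -PoszD ltz_nat.
  have H i : (`|(t ord0 i + n%:Z)%R|%N < n + n)%N.
    have /andP[t1 t2] := tn i.
    rewrite -ltz_nat gez0_abs; last by rewrite -lerBlDr sub0r.
    by rewrite PoszD ltrD2r.
  exists (\row_i Ordinal (H i)); first by rewrite mem_enum.
  apply/rowP => i; rewrite !mxE/= gez0_abs; first by rewrite addrK.
  by have /andP[t1 t2] := tn i; rewrite -lerBlDr sub0r.
by rewrite size_map -cardE card_mx card_ord mul1n.
Qed.

Lemma window_norm (h : Zd) : exists m : nat, forall i, (`|h ord0 i| <= m%:Z)%R.
Proof.
exists (\max_(i < d) `|h ord0 i|%N)%N => i.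
by rewrite -abszE lez_nat (leq_bigmax_cond (F := fun i => `|h ord0 i|%N)).
Qed.

Lemma card_filter_Wn (k : nat) (s : Zd) (W : {fset Zd}) :
  (size [seq t <- W | (t - s)%R \in Wn k] <= (k + k) ^ d)%N.
Proof.
rewrite -(card_Wn k) -(size_map (fun t => t - s)).
apply: uniq_leq_size => [|t' /mapP[t + ->]].
  rewrite map_inj_uniq; [exact/filter_uniq/fset_uniq|exact: (@addIr _ (- s))].
by rewrite mem_filter => /andP[].
Qed.

(** With [m] bounding the coordinates of [h], no point of the window of radius [n - m] is moved out
    of the window of radius [n], so the boundary points avoid the smaller window. *)
Lemma boundary_Wn (h : Zd) : exists m, forall n,
  (size [seq s <- Wn n | (s + h)%R \notin Wn n] + ((n - m) + (n - m)) ^ d <= (n + n) ^ d)%N.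
Proof.
have [m hm] := window_norm h; exists m => n.
rewrite -(card_Wn n) -(card_Wn (n - m)).
rewrite -[X in (_ <= X)%N](count_predC (fun s => (s + h)%R \notin Wn n)) -size_filter leq_add2l.
rewrite -size_filter; apply: uniq_leq_size => // s.
rewrite in_Wn mem_filter /= negbK !in_Wn => /asboolP sn.
have key i : - n%:Z <= s ord0 i + h ord0 i < n%:Z /\ - n%:Z <= s ord0 i < n%:Z.
  have := sn i; have := hm i; rewrite ler_norml.
  move: (s ord0 i) (h ord0 i) => x y /andP[b1 b2] /andP[a1 a2].
  have nm : (n - m)%N%:Z = n%:Z - m%:Z :> int by lia.
  rewrite nm in a1 a2.
  by split; apply/andP; split; lra.
by apply/andP; split; apply/asboolP => i; [rewrite mxE; exact: (key i).1|exact: (key i).2].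
Qed.

Variable R : realType.

Lemma one_sub_pow_ge (x : R) : 0 <= x <= 1 -> 1 - d%:R * x <= (1 - x) ^+ d.
Proof.
move=> /andP[x0 x1]; elim: d => [|k IH]; first by rewrite mul0r subr0 expr0.
have k0 : (0 : R) <= k%:R by [].
have : (1 - k%:R * x) * (1 - x) <= (1 - x) ^+ k * (1 - x) by rewrite ler_wpM2r// subr_ge0.
by rewrite exprSr -natr1; nra.
Qed.

Definition vol (n : nat) : R := ((n + n) ^ d)%N%:R.

Lemma vol_gt0 n : (0 < n)%N -> 0 < vol n.
Proof. by move=> n0; rewrite ltr0n expn_gt0 addn_gt0 n0. Qed.

Lemma boundary_ratio (h : Zd) (e : R) : 0 < e -> exists N, forall n, (N <= n)%N ->
  (size [seq s <- Wn n | (s + h)%R \notin Wn n])%:R / vol n <= e.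
Proof.
move=> e0; have [m hm] := boundary_Wn h.
exists (maxn m (Num.truncn (d%:R * m%:R / e)).+1) => n; rewrite geq_max => /andP[mn Nn].
have n0 : (0 < n)%N by exact: leq_trans Nn.
have nR : (0 : R) < n%:R by rewrite ltr0n.
have V0 := vol_gt0 n0.
rewrite ler_pdivrMr//.
have x01 : (0 <= m%:R / n%:R :> R) && (m%:R / n%:R <= 1 :> R).
  by rewrite divr_ge0//= ler_pdivrMr// mul1r ler_nat.
have h1 := one_sub_pow_ge x01.
have h2 : (size [seq s <- Wn n | (s + h)%R \notin Wn n])%:R + (((n - m) + (n - m)) ^ d)%N%:R <= vol n.
  by rewrite -natrD ler_nat.
have h3 : (((n - m) + (n - m)) ^ d)%N%:R = (1 - m%:R / n%:R) ^+ d * vol n :> R.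
  rewrite /vol !natrX -exprMn; congr (_ ^+ _).
  by rewrite !natrD natrB//; field; rewrite gt_eqF.
have h4 : d%:R * (m%:R / n%:R) <= e :> R.
  rewrite mulrA ler_pdivrMr// [e * _]mulrC -ler_pdivrMr//.
  apply: le_trans (ltW (truncnS_gt _)) _.
  by rewrite ler_nat.
have : (1 - d%:R * (m%:R / n%:R)) * vol n <= (1 - m%:R / n%:R) ^+ d * vol n by rewrite ler_wpM2r// ltW.
have := ler_wpM2r (ltW V0) h4.
by lra.
Qed.

End lattice_windows.

Section weighted_limits.
Variables (R : realType) (I : Type).

Lemma eventually_sum (u : I -> nat -> R) (c : I -> R) (r : seq I) :
  (forall i e, 0 < e -> exists N, forall n, (N <= n)%N -> u i n <= e) -> (forall i, 0 <= c i) ->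
  forall e, 0 < e -> exists N, forall n, (N <= n)%N -> \sum_(i <- r) c i * u i n <= e.
Proof.
move=> hu c0; elim: r => [|i r IH] e e0.
  by exists 0%N => n _; rewrite big_nil ltW.
have e20 : 0 < e / 2 by lra.
have [N1 h1] := IH _ e20.
have ci : 0 < c i + 1 by have := c0 i; lra.
have [N2 h2] := hu i (e / 2 / (c i + 1)) (divr_gt0 e20 ci).
exists (maxn N1 N2) => n; rewrite geq_max => /andP[n1 n2].
rewrite big_cons (splitr e); apply: lerD; last exact: h1.
apply: (@le_trans _ _ (c i * (e / 2 / (c i + 1)))); first by rewrite ler_wpM2l//; exact: h2.
rewrite mulrA ler_pdivrMr// mulrC ler_wpM2l//; [lra|have := c0 i; lra].
Qed.

End weighted_limits.

(** * Law of large numbers for pairs *)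

Section random_field_averages.
Context {disp} {T : measurableType disp} {R : realType} (P : probability T R) (d : nat).
Local Notation Zd := 'rV[int]_d.
Variable Y : Zd -> {RV P >-> R}.
Hypothesis d_gt0 : (0 < d)%N.
Hypothesis Y01 : forall t w, Y t w = 0 \/ Y t w = 1.
Hypothesis stY : stationary Y.
Hypothesis mixY : alpha_field Y k 2 2 @[k --> \oo] --> 0%E.
Local Notation intble f := (P.-integrable setT (EFin \o f)).
Local Notation W := (Wn d).
Local Notation V := (vol d R).

Definition occ2 (s t : Zd) : set T := [set w | Y s w = 1 /\ Y t w = 1].

Definition pair_prob (h : Zd) : R := pr P (occ2 0 h).

Lemma YY_indic s t w : Y s w * Y t w = \1_(occ2 s t) w.
Proof.
rewrite indicE; have [h|h] := boolP (w \in occ2 s t).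
  by have [-> ->] := set_mem h; rewrite mulr1.
case: (Y01 s w) => e1; first by rewrite e1 mul0r.
case: (Y01 t w) => e2; first by rewrite e2 mulr0.
by exfalso; move/negP : h; apply; apply/mem_set.
Qed.

Lemma sigma_occ2 (A : set Zd) s t : A s -> A t -> sigma_family A Y (occ2 s t).
Proof.
move=> As At.
have sub r : A r -> sigma_family A Y (Y r @^-1` [set 1]).
  move=> Ar; apply: sub_sigma_algebra; exists r => //=.
  by exists [set 1] => //; rewrite setTI.
have -> : occ2 s t = (Y s @^-1` [set 1]) `&` (Y t @^-1` [set 1]) by [].
exact: (@measurableI _ (g_sigma_algebraType (\bigcup_(i in A) preimage_set_system setT (Y i) measurable))
  _ _ (sub s As) (sub t At)).
Qed.

Lemma measurable_occ2 s t : measurable (occ2 s t).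
Proof.
have m r : measurable (Y r @^-1` [set 1]).
  by rewrite -[X in measurable X]setTI; exact: (measurable_funPT (Y r)).
exact: (measurableI _ _ (m s) (m t)).
Qed.

Lemma pr_occ2 s t : pr P (occ2 s t) = pair_prob (t - s).
Proof.
pose B := [set x : 2.-tuple R | tnth x ord0 = 1 /\ tnth x ord_max = 1].
have mB : measurable B.
  have m i : measurable ((fun x : 2.-tuple R => tnth x i) @^-1` [set 1]).
    by rewrite -[X in measurable X]setTI; exact: measurable_tnth.
  exact: (measurableI _ _ (m ord0) (m ord_max)).
have := stY (fun i : 'I_2 => if i == ord0 then 0 else t - s) s mB.
have -> : [set w | B [tuple Y ((if i == ord0 then 0 else t - s) + s) w | i < 2]] = occ2 s t.
  by rewrite /B/=; under eq_set do rewrite !tnth_mktuple /= add0r subrK.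
have -> : [set w | B [tuple Y (if i == ord0 then 0 else t - s) w | i < 2]] = occ2 0 (t - s).
  by rewrite /B/=; under eq_set do rewrite !tnth_mktuple /=.
by rewrite /pair_prob /pr => ->.
Qed.

Lemma pair_prob_ge0 h : 0 <= pair_prob h. Proof. exact: pr_ge0. Qed.

Lemma integrable_YY s t : intble (fun w => Y s w * Y t w).
Proof.
by under eq_fun do rewrite YY_indic; exact: (integrable_indicP P (measurable_occ2 _ _)).
Qed.

Lemma Rintegral_YY s t : \int[P]_w (Y s w * Y t w) = pair_prob (t - s).
Proof.
under eq_Rintegral do rewrite YY_indic.
by rewrite (pr_Rintegral P (measurable_occ2 _ _)) pr_occ2.
Qed.

Lemma lattice_dist_ge (A B : set Zd) (k : nat) :
  (forall x y, A x -> B y -> exists i, (k%:Z <= `|x ord0 i - y ord0 i|)%R) ->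
  (k%:R%:E <= lattice_dist R A B)%E.
Proof.
move=> h; apply: le_ereal_inf_tmp => _ [x Ax [y By <-]].
rewrite lee_fin; have [i hi] := h x y Ax By.
rewrite /euclidean_norm.
apply: (@le_trans _ _ `|(of_lattice R x - of_lattice R y) ord0 i|).
  rewrite !mxE -rmorphB/= -intr_norm -[k%:R]/((k%:Z)%:~R) ler_int; exact: hi.
rewrite -sqrtr_sqr ler_sqrt; last by apply: sumr_ge0 => j _; exact: sqr_ge0.
rewrite (bigD1 i)//= lerDl; apply: sumr_ge0 => j _; exact: sqr_ge0.
Qed.

Lemma alpha_far (e : R) : 0 < e -> exists k : nat, forall (A B : {fset Zd}) EA EB,
  (#|` A| <= 2)%N -> (#|` B| <= 2)%N ->
  (forall x y, x \in A -> y \in B -> exists i, (k%:Z <= `|x ord0 i - y ord0 i|)%R) ->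
  measurable EA -> measurable EB ->
  sigma_family [set` A] Y EA -> sigma_family [set` B] Y EB ->
  `|pr P (EA `&` EB) - pr P EA * pr P EB| <= e.
Proof.
move=> e0.
have : \forall k \near \oo, (alpha_field Y k 2 2 < e%:E)%E.
  have e0' : (0 < e%:E)%E by rewrite lte_fin.
  exact: (mixY (open_ereal_lt' e0')).
move=> [k _ /(_ k (leqnn k)) hk]; exists k => A B EA EB cA cB far mA mB sA sB.
have : (`|P EA * P EB - P (EA `&` EB)| <= alpha_field Y k 2 2)%E.
  apply: (@le_trans _ _ (alpha_coef P (sigma_family [set` A] Y) (sigma_family [set` B] Y))).
    by apply: ereal_sup_ubound; exists EA => //; exists EB.
  apply: ereal_sup_ubound; exists (A, B) => //; split => //=.
  by apply: lattice_dist_ge => x y xA yB; exact: far.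
move=> /le_lt_trans /(_ hk).
rewrite (prE P mA) (prE P mB) (prE P (measurableI _ _ mA mB)).
by rewrite -EFinM -EFinB abse_EFin lte_fin distrC => /ltW.
Qed.

Definition pairs (h : Zd) n w : R := \sum_(s <- W n) Y s w * Y (s + h) w.

Lemma integrable_pairs h n : intble (pairs h n).
Proof. by apply: integrable_sum_real => s; exact: integrable_YY. Qed.

Lemma pair_cov (h : Zd) (e : R) : 0 < e -> exists k : nat, forall s s',
  ~~ ((s' - s)%R \in Wn d k) ->
  pr P (occ2 s (s + h) `&` occ2 s' (s' + h)) - pair_prob h ^+ 2 <= e.
Proof.
move=> e0; have [k hk] := alpha_far e0; have [m hm] := window_norm h.
(* Outside the window of radius [k + m] some coordinate of [s' - s] is at least [k + m] in modulus.
   Adding or subtracting [h], with coordinates at most [m], still leaves [k] between the two-point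
   sets. *)
exists (k + m)%N => s s' ss'.
have [i hi] : exists i, (k%:Z + m%:Z <= `|(s' - s) ord0 i|)%R.
  apply: contrapT => hn; move/negP : ss'; apply.
  rewrite in_Wn; apply/asboolP => i; apply: contrapT => hi; apply: hn; exists i.
  move: hi; move: ((s' - s) ord0 i) => x hi.
  rewrite leNgt; apply/negP => hx; apply: hi; move: hx; rewrite ltr_norml PoszD => /andP[? ?].
  by apply/andP; split; lra.
have hi' := hm i.
have := hk [fset s; (s + h)%R]%fset [fset s'; (s' + h)%R]%fset (occ2 s (s + h)) (occ2 s' (s' + h)).
rewrite !pr_occ2 [s + h]addrC addrK [s' + h]addrC addrK -expr2 => H.
apply: le_trans (ler_norm _) _; apply: H.
- by rewrite cardfs2; case: (_ != _).
- by rewrite cardfs2; case: (_ != _).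
- move=> x y; rewrite !inE => xs ys; exists i.
  move: hi; rewrite [(s' - s) _ _]mxE [(- s) _ _]mxE.
  by case/orP : xs => /eqP ->; case/orP : ys => /eqP ->; rewrite ?mxE; move: hi';
    move: (s ord0 i) (s' ord0 i) (h ord0 i) => a b c; lia.
- exact: measurable_occ2.
- exact: measurable_occ2.
- by apply: sigma_occ2; rewrite /= !inE eqxx ?orbT.
- by apply: sigma_occ2; rewrite /= !inE eqxx ?orbT.
Qed.

(** The square expands into a double sum over [s] and [s']: for each [s] at most [(2k)^d] points are
    close and contribute at most [1] each, all others contribute at most [e]. *)
Lemma pairs_variance (h : Zd) (e : R) : 0 < e -> exists2 c : R, 0 <= c & forall n,
  intble (fun w => (pairs h n w - V n * pair_prob h) ^+ 2) /\
  \int[P]_w ((pairs h n w - V n * pair_prob h) ^+ 2) <= V n * (V n * e + c).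
Proof.
move=> e0; have [k hk] := pair_cov h e0.
exists ((k + k) ^ d)%:R => // n.
pose p := pair_prob h.
pose xi s w : R := \1_(occ2 s (s + h)) w - p.
have sumE w : (pairs h n w - V n * p) ^+ 2 = \sum_(s <- W n) \sum_(s' <- W n) xi s w * xi s' w.
  have -> : pairs h n w - V n * p = \sum_(s <- W n) xi s w.
    rewrite /xi sumrB big_const_seq count_predT iter_addr_0 card_Wn mulr_natl.
    by congr (_ - _); apply: eq_bigr => s _; rewrite YY_indic.
  by rewrite expr2 big_distrlr.
have xi2 s s' w : xi s w * xi s' w = \1_(occ2 s (s + h) `&` occ2 s' (s' + h)) w
    - p * \1_(occ2 s (s + h)) w - p * \1_(occ2 s' (s' + h)) w + p ^+ 2.
  by rewrite /xi indicI /=; ring.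
have i1 s := integrable_indicP P (measurable_occ2 s (s + h)).
have i2 s s' := integrable_indicP P (measurableI _ _ (measurable_occ2 s (s + h)) (measurable_occ2 s' (s' + h))).
have ic : intble (fun=> p ^+ 2) by apply: (@integrable_bounded _ _ _ P _ `|p ^+ 2|).
have ixi s s' : intble (fun w => xi s w * xi s' w).
  under eq_fun do rewrite xi2.
  apply: integrableD_real ic; apply: integrableB_real (integrableZ_real p (i1 s')).
  exact: integrableB_real (i2 s s') (integrableZ_real p (i1 s)).
have Exi s s' : \int[P]_w (xi s w * xi s' w) = pr P (occ2 s (s + h) `&` occ2 s' (s' + h)) - p ^+ 2.
  under eq_Rintegral do rewrite xi2.
  rewrite RintegralD//; last first.
    apply: integrableB_real (integrableZ_real p (i1 s')).
    exact: integrableB_real (i2 s s') (integrableZ_real p (i1 s)).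
  rewrite RintegralB//; last 2 first.
    exact: integrableB_real (i2 s s') (integrableZ_real p (i1 s)).
    exact: integrableZ_real.
  rewrite RintegralB//; last exact: integrableZ_real.
  rewrite Rintegral_prob_cst !RintegralZl// !pr_Rintegral//; try exact: measurable_occ2; last first.
    by apply: measurableI; exact: measurable_occ2.
  by rewrite !pr_occ2 [s + h]addrC addrK [s' + h]addrC addrK -/p; lra.
split.
  by under eq_fun do rewrite sumE; do 2 (apply: integrable_sum_real => ?).
under eq_Rintegral do rewrite sumE.
rewrite Rintegral_sum; last by move=> s; apply: integrable_sum_real.
apply: (@le_trans _ _ (\sum_(s <- W n) (V n * e + ((k + k) ^ d)%:R))); last first.
  by rewrite big_const_seq count_predT iter_addr_0 card_Wn -[X in X <= _]mulr_natl.
apply: ler_sum => s _; rewrite Rintegral_sum//.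
apply: (@le_trans _ _ (\sum_(s' <- W n) (e + if (s' - s)%R \in W k then 1 else 0))).
  apply: ler_sum => s' _; rewrite Exi; case: ifPn => [_|/hk]; last by rewrite addr0.
  apply: (@le_trans _ _ 1); last by lra.
  have := sqr_ge0 p.
  have := pr_le1 P (measurableI _ _ (measurable_occ2 s (s + h)) (measurable_occ2 s' (s' + h))).
  lra.
rewrite big_split/= big_const_seq count_predT iter_addr_0 card_Wn mulr_natl lerD2l.
rewrite -big_mkcond/= -big_filter big_const_seq count_predT iter_addr_0 -/(1 *+ _) ler_nat.
exact: card_filter_Wn.
Qed.

Lemma vol_ge n : n%:R <= V n.
Proof.
rewrite ler_nat -[d]prednK// expnS.
case: n => [//|n]; apply: (@leq_trans (n.+1 + n.+1)); first exact: leq_addr.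
by rewrite leq_pmulr// expn_gt0 addn_gt0.
Qed.

(** From the variance by [|x| <= x^2 / (2e) + e / 2]. Convergence is stated in mean because the
    error bound for the conditional characteristic function will be integrated. *)
Lemma pairs_cvg (h : Zd) (e : R) : 0 < e -> exists N, forall n, (N <= n)%N ->
  \int[P]_w `|pairs h n w / V n - pair_prob h| <= e.
Proof.
move=> e0; have e2 : 0 < e ^+ 2 / 2 by rewrite divr_gt0// exprn_gt0.
have [c c0 hc] := pairs_variance h e2.
(* As [V n >= n], this gives [c <= (e^2 / 2) V n], and the variance is at most [e^2 (V n)^2]. *)
exists (Num.truncn (c / (e ^+ 2 / 2))).+1 => n Nn.
have n0 : (0 < n)%N by exact: leq_trans Nn.
have V0 := vol_gt0 d R n0.
have cV : c <= e ^+ 2 / 2 * V n.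
  rewrite mulrC -ler_pdivrMr//; apply: le_trans (vol_ge n).
  by apply: le_trans (ltW (truncnS_gt _)) _; rewrite ler_nat.
have [iX EX] := hc n; set X := fun w => pairs h n w - V n * pair_prob h in iX EX.
have iX2 : intble (fun w => (2 * e * V n ^+ 2)^-1 * X w ^+ 2) by exact: integrableZ_real.
have ice : intble (fun=> e / 2) by apply: (@integrable_bounded _ _ _ P _ `|e / 2|).
apply: (@le_trans _ _ (\int[P]_w ((2 * e * V n ^+ 2)^-1 * X w ^+ 2 + e / 2))); last first.
  rewrite RintegralD// Rintegral_prob_cst RintegralZl//.
  rewrite [X in _ <= X](_ : _ = (2 * e * V n ^+ 2)^-1 * (e ^+ 2 * V n ^+ 2) + e / 2); last first.
    by field; rewrite !gt_eqF.
  rewrite lerD2r ler_wpM2l// ?invr_ge0 ?mulr_ge0 ?sqr_ge0 ?(ltW e0)//.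
  apply: le_trans EX _; rewrite [X in _ <= X](_ : _ = V n * (V n * e ^+ 2)); last by lra.
  by rewrite ler_wpM2l ?(ltW V0)//; lra.
apply: le_trans (ler_norm _) _; apply: Rintegral_abs_le; last exact: integrableD_real.
  apply: integrable_real_meas; apply: integrable_abs; apply: integrableB_real.
    by under eq_fun do rewrite mulrC; apply: integrableZ_real; exact: integrable_pairs.
  by apply: (@integrable_bounded _ _ _ P _ `|pair_prob h|).
move=> w; rewrite normr_id.
have -> : pairs h n w / V n - pair_prob h = X w / V n by rewrite /X; field; rewrite gt_eqF.
set x := X w / V n.
have -> : (2 * e * V n ^+ 2)^-1 * X w ^+ 2 = x ^+ 2 / (2 * e).
  by rewrite /x; field; rewrite !gt_eqF.
rewrite -subr_ge0 -(real_normK (num_real x)).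
have -> : `|x| ^+ 2 / (2 * e) + e / 2 - `|x| = (`|x| - e) ^+ 2 / (2 * e) by field; rewrite gt_eqF.
by rewrite divr_ge0 ?sqr_ge0// mulr_ge0// ltW.
Qed.

End random_field_averages.

(** * Quadratic forms of the field *)

Section quadratic_averages.
Context {disp} {T : measurableType disp} {R : realType} (P : probability T R) (d : nat).
Local Notation Zd := 'rV[int]_d.
Variable Y : Zd -> {RV P >-> R}.
Hypothesis d_gt0 : (0 < d)%N.
Hypothesis Y01 : forall t w, Y t w = 0 \/ Y t w = 1.
Hypothesis stY : stationary Y.
Hypothesis mixY : alpha_field Y k 2 2 @[k --> \oo] --> 0%E.
Local Notation intble f := (P.-integrable setT (EFin \o f)).
Local Notation W := (Wn d).
Local Notation V := (vol d R).
Local Notation p := (pair_prob Y).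

(** The Cauchy criterion for unconditional sums, phrased with finite sums only. *)
Definition tail_le (c : Zd -> R) (H : {fset Zd}) (e : R) := forall r : seq Zd,
  uniq r -> {in r, forall h, h \notin H} -> \sum_(h <- r) c h <= e.

(** For [g = corr f] this is the integral of the square of [sum f (t - u)] over the sampled points,
    by [quad_sampled] and [Rintegral_sq_shift_sum]. *)
Definition quad (g : Zd -> R) n w : R :=
  \sum_(s <- W n) \sum_(t <- W n) Y s w * Y t w * g (t - s).

Lemma sum_shift (G : Zd -> R) (s : Zd) n (H : {fset Zd}) :
  \sum_(t <- W n | (t - s)%R \in H) G t = \sum_(h <- H | (s + h)%R \in W n) G (s + h).
Proof.
rewrite -big_filter -[RHS]big_filter -[RHS](big_map (fun h => s + h) xpredT G).
apply: perm_big; apply: uniq_perm.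
- exact/filter_uniq/fset_uniq.
- by rewrite map_inj_uniq; [exact/filter_uniq/fset_uniq|exact: addrI].
- move=> t; rewrite mem_filter; apply/andP/mapP => [[tH tW]|[h]].
    by exists (t - s); rewrite ?mem_filter addrC subrK// tW tH.
  by rewrite mem_filter => /andP[hW hH] ->; rewrite hW [s + h]addrC addrK.
Qed.

Lemma tail_shift c H e s n : tail_le c H e ->
  \sum_(t <- W n | (t - s)%R \notin H) c (t - s) <= e.
Proof.
move=> he; rewrite -big_filter -(big_map (fun t => t - s) xpredT c); apply: he.
  by rewrite map_inj_uniq; [exact/filter_uniq/fset_uniq|exact: (@addIr _ (- s))].
by move=> h /mapP[t]; rewrite mem_filter => /andP[th _] ->.
Qed.

Lemma integrable_quad g n : intble (quad g n).
Proof.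
apply: integrable_sum_real => s; apply: integrable_sum_real => t.
by under eq_fun do rewrite mulrC; apply: integrableZ_real; exact: integrable_YY.
Qed.

Lemma Rintegral_quad g n :
  \int[P]_w quad g n w = \sum_(s <- W n) \sum_(t <- W n) p (t - s) * g (t - s).
Proof.
have iY s t : intble (fun w => Y s w * Y t w * g (t - s)).
  by under eq_fun do rewrite mulrC; apply: integrableZ_real; exact: integrable_YY.
rewrite Rintegral_sum; last by move=> s; apply: integrable_sum_real.
apply: eq_bigr => s _; rewrite Rintegral_sum//; apply: eq_bigr => t _.
under eq_Rintegral do rewrite mulrC.
by rewrite RintegralZl//; [rewrite (Rintegral_YY Y01 stY) mulrC|exact: integrable_YY].
Qed.

Lemma quad_le g H e n : (forall h, 0 <= g h) -> tail_le (fun h => p h * g h) H e ->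
  \int[P]_w quad g n w <= V n * (\sum_(h <- H) p h * g h + e).
Proof.
move=> g0 he; rewrite Rintegral_quad.
apply: (@le_trans _ _ (\sum_(s <- W n) (\sum_(h <- H) p h * g h + e))); last first.
  by rewrite big_const_seq count_predT iter_addr_0 card_Wn -[X in X <= _]mulr_natl.
apply: ler_sum => s _; rewrite (bigID (fun t => (t - s)%R \in H))/=.
apply: lerD; last exact: (tail_shift s n he).
rewrite (sum_shift (fun t => p (t - s) * g (t - s))) big_mkcond/=.
apply: ler_sum => h _; rewrite [s + h]addrC addrK; case: ifP => // _.
by rewrite mulr_ge0// pair_prob_ge0.
Qed.

(** Terms are grouped by the lag [h = t - s]. For the finitely many lags in [H] the law of large
    numbers applies, up to pairs crossing the boundary of the window. The other lags are bounded in
    mean, uniformly in [n], through the majorant [k]. [H] contains [H0], to be close to [q], and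
    [H1], to have a small tail. *)
Lemma quad_cvg (g k : Zd -> R) (q : R) : (forall h, `|g h| <= k h) ->
  (forall e, 0 < e -> exists H, tail_le (fun h => p h * k h) H e) ->
  (forall e, 0 < e -> exists H0 : {fset Zd}, forall H : {fset Zd}, (H0 `<=` H)%fset ->
     `|\sum_(h <- H) p h * g h - q| <= e) ->
  forall e, 0 < e -> exists N, forall n, (N <= n)%N ->
  \int[P]_w `|quad g n w / V n - q| <= e.
Proof.
move=> gk tailk apq e e0.
have e4 : 0 < e / 4 by lra.
have [H1 hH1] := tailk _ e4; have [H0 hH0] := apq _ e4.
pose H := (H0 `|` H1)%fset.
have hH : tail_le (fun h => p h * k h) H (e / 4).
  by move=> r ur rH; apply: hH1 => // h /rH; rewrite inE negb_or => /andP[].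
have hq := hH0 H (fsubsetUl _ _).
pose B h n := size [seq s <- W n | (s + h)%R \notin W n].
pose u (h : Zd) n : R := \int[P]_w `|pairs Y h n w / V n - p h| + (B h n)%:R / V n.
have hu h e' : 0 < e' -> exists N, forall n, (N <= n)%N -> u h n <= e'.
  move=> e'0; have e'2 : 0 < e' / 2 by lra.
  have [N1 h1] := pairs_cvg d_gt0 Y01 stY mixY h e'2.
  have [N2 h2] := boundary_ratio h e'2.
  exists (maxn N1 N2) => n; rewrite geq_max => /andP[n1 n2].
  by rewrite (splitr e'); apply: lerD; [exact: h1|exact: h2].
have [N hN] := eventually_sum H hu (fun h => normr_ge0 (g h)) e4.
exists (maxn N 1) => n; rewrite geq_max => /andP[Nn n0].
have V0 := vol_gt0 d R n0.
pose A h w : R := \sum_(s <- W n | (s + h)%R \in W n) Y s w * Y (s + h) w.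
pose tl w : R := \sum_(s <- W n) \sum_(t <- W n | (t - s)%R \notin H) Y s w * Y t w * k (t - s).
have YY0 s t w : 0 <= Y s w * Y t w by rewrite (YY_indic Y01).
have YY1 s t w : Y s w * Y t w <= 1.
  by rewrite (YY_indic Y01) indicE lern1; case: (_ \in _).
have ptw w : `|quad g n w / V n - q| <=
    \sum_(h <- H) `|g h| * (`|pairs Y h n w / V n - p h| + (B h n)%:R / V n) +
    e / 4 + tl w / V n.
  have -> : quad g n w / V n - q = \sum_(h <- H) g h * (A h w / V n - p h) +
      (\sum_(h <- H) p h * g h - q) +
      (\sum_(s <- W n) \sum_(t <- W n | (t - s)%R \notin H) Y s w * Y t w * g (t - s)) / V n.
    have -> : quad g n w = \sum_(h <- H) g h * A h w +
        \sum_(s <- W n) \sum_(t <- W n | (t - s)%R \notin H) Y s w * Y t w * g (t - s).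
      rewrite /quad; under eq_bigr => s _ do rewrite (bigID (fun t => (t - s)%R \in H))/=.
      rewrite big_split/=; congr (_ + _).
      under eq_bigr => s _ do rewrite (sum_shift (fun t => Y s w * Y t w * g (t - s))) big_mkcond/=.
      rewrite exchange_big/=; apply: eq_bigr => h _.
      rewrite /A big_mkcond/= mulr_sumr [RHS]big_mkcond/= big_mkcond/=.
      by apply: eq_bigr => s _; case: ifP => _; rewrite ?mulr0// [s + h]addrC addrK mulrC.
    rewrite mulrDl addrAC; congr (_ + _).
    rewrite (_ : \sum_(h <- H) g h * (A h w / V n - p h) =
      (\sum_(h <- H) g h * A h w) / V n - \sum_(h <- H) p h * g h); first by lra.
    rewrite mulr_suml -sumrB; apply: eq_bigr => h _.
    by rewrite mulrBr mulrA [g h * p h]mulrC.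
  apply: le_trans (ler_normD _ _) _; apply: lerD; last first.
    rewrite normrM (gtr0_norm (x := (V n)^-1)) ?invr_gt0// ler_wpM2r// ?invr_ge0 ?(ltW V0)//.
    apply: le_trans (ler_norm_sum _ _ _) _; apply: ler_sum => s _.
    apply: le_trans (ler_norm_sum _ _ _) _; apply: ler_sum => t _.
    by rewrite normrM (ger0_norm (YY0 _ _ _)) ler_wpM2l.
  apply: le_trans (ler_normD _ _) _; apply: lerD => //.
  apply: le_trans (ler_norm_sum _ _ _) _; apply: ler_sum => h _.
  rewrite normrM ler_wpM2l//.
  have AE : pairs Y h n w - A h w = \sum_(s <- W n | (s + h)%R \notin W n) Y s w * Y (s + h) w.
    by rewrite /pairs (bigID (fun s => (s + h)%R \in W n))/= addrAC subrr add0r.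
  have AB : `|A h w - pairs Y h n w| <= (B h n)%:R.
    rewrite distrC AE ger0_norm; last by apply: sumr_ge0.
    apply: (@le_trans _ _ (\sum_(s <- W n | (s + h)%R \notin W n) 1)); first exact: ler_sum.
    by rewrite -big_filter big_const_seq count_predT iter_addr_0.
  have -> : A h w / V n - p h = (pairs Y h n w / V n - p h) + (A h w - pairs Y h n w) / V n.
    by rewrite mulrBl; lra.
  apply: le_trans (ler_normD _ _) _; rewrite lerD2l normrM.
  by rewrite (gtr0_norm (x := (V n)^-1)) ?invr_gt0// ler_wpM2r// ?invr_ge0 ?(ltW V0).
have ip h : intble (fun w => `|pairs Y h n w / V n - p h|).
  apply: integrable_abs; apply: integrableB_real.
    by under eq_fun do rewrite mulrC; apply: integrableZ_real; exact: integrable_pairs.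
  by apply: (@integrable_bounded _ _ _ P _ `|p h|).
have icst (c : R) : intble (fun=> c) by apply: (@integrable_bounded _ _ _ P _ `|c|).
have i1 h : intble (fun w => `|g h| * (`|pairs Y h n w / V n - p h| + (B h n)%:R / V n)).
  by apply: integrableZ_real; exact: integrableD_real.
have iYk s t : intble (fun w => Y s w * Y t w * k (t - s)).
  by under eq_fun do rewrite mulrC; apply: integrableZ_real; exact: integrable_YY.
have itl : intble tl.
  apply: integrable_sum_real => s; under eq_fun do rewrite -big_filter.
  exact: integrable_sum_real.
have i2 : intble (fun w => tl w / V n).
  by under eq_fun do rewrite mulrC; exact: integrableZ_real.
have i12 : intble (fun w => \sum_(h <- H) `|g h| * (`|pairs Y h n w / V n - p h| + (B h n)%:R / V n) + e / 4).
  by apply: integrableD_real => //; exact: integrable_sum_real.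
apply: (@le_trans _ _ (\int[P]_w (\sum_(h <- H) `|g h| * (`|pairs Y h n w / V n - p h| + (B h n)%:R / V n) +
    e / 4 + tl w / V n))).
  apply: le_trans (ler_norm _) _; apply: Rintegral_abs_le; last exact: integrableD_real.
    apply: integrable_real_meas; apply: integrable_abs; apply: integrableB_real => //.
    by under eq_fun do rewrite mulrC; apply: integrableZ_real; exact: integrable_quad.
  by move=> w; rewrite normr_id.
rewrite RintegralD// RintegralD//; last exact: integrable_sum_real.
rewrite Rintegral_sum// Rintegral_prob_cst.
rewrite [X in X + e / 4 + _ <= _](_ : _ = \sum_(h <- H) `|g h| * u h n); last first.
  apply: eq_bigr => h _; rewrite RintegralZl//; last exact: integrableD_real.
  by rewrite RintegralD// Rintegral_prob_cst.
have hA := hN n Nn.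
have hT : \int[P]_w (tl w / V n) <= e / 4.
  under eq_Rintegral do rewrite mulrC.
  rewrite RintegralZl// ler_pdivrMl//.
  rewrite Rintegral_sum; last by move=> s; under eq_fun do rewrite -big_filter; exact: integrable_sum_real.
  apply: (@le_trans _ _ (\sum_(s <- W n) (e / 4))); last first.
    by rewrite big_const_seq count_predT iter_addr_0 card_Wn -[X in X <= _]mulr_natl.
  apply: ler_sum => s _; under eq_Rintegral do rewrite -big_filter.
  rewrite Rintegral_sum// big_filter.
  apply: le_trans (tail_shift s n hH); rewrite le_eqVlt; apply/orP; left; apply/eqP.
  apply: eq_bigr => t _; under eq_Rintegral do rewrite mulrC.
  by rewrite RintegralZl//; [rewrite (Rintegral_YY Y01 stY) mulrC|exact: integrable_YY].
by clear -e0 hA hT; lra.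
Qed.

End quadratic_averages.

(** * Autocorrelation and truncation *)

Section autocorrelation.
Context {R : realType} (d : nat).
Local Notation Zd := 'rV[int]_d.
Local Notation leb := (lebesgue_rV R d).
Local Notation intble f := (leb.-integrable setT (EFin \o f)).
Local Notation lat := (of_lattice R).
Implicit Types f g : 'rV[R]_d -> R.

Lemma of_latticeB (s t : Zd) : lat (t - s) = lat t - lat s.
Proof. by rewrite /of_lattice map_mxB. Qed.

Lemma L12_meas g : L12 g -> measurable_fun setT g.
Proof. by move=> [/integrable_real_meas]. Qed.

Lemma integrable_mul_L12 f g : L12 f -> L12 g -> intble (fun u => f u * g u).
Proof.
move=> hf hg; apply: le_integrable_real (integrableD_real hf.2 hg.2) => [|u].
  exact: measurable_funM (L12_meas hf) (L12_meas hg).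
rewrite normrM -(real_normK (num_real (f u))) -(real_normK (num_real (g u))).
have := sqr_ge0 (`|f u| - `|g u|); have := sqr_ge0 (`|f u| + `|g u|); nra.
Qed.

Definition corr g (h : Zd) : R := \int[leb]_u (g (- u) * g (lat h - u)).

(** Both sides are the integral of [g u * g (u + t - s)], reflected about [s] on the left and about
    [0] on the right. *)
Lemma corrE g (s t : Zd) : measurable_fun setT g ->
  \int[leb]_u (g (lat s - u) * g (lat t - u)) = corr g (t - s).
Proof.
move=> mg; pose K u := g u * g (lat (t - s) + u).
have mK : measurable_fun setT K.
  apply: measurable_funM => //.
  have m2 := measurableT_comp mg (measurable_reflect (lat (t - s))).
  have := measurableT_comp m2 (measurable_reflect (0 : 'rV[R]_d)).
  by apply: eq_measurable_fun => u _ /=; rewrite sub0r opprK.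
transitivity (\int[leb]_u K u).
  rewrite -(Rintegral_reflect (lat s) mK); apply: eq_Rintegral => u _.
  by rewrite /K of_latticeB addrA subrK.
rewrite /corr -(Rintegral_reflect 0 mK); apply: eq_Rintegral => u _.
by rewrite /K sub0r.
Qed.

Lemma integrable_corr g (s t : Zd) : L12 g -> intble (fun u => g (lat s - u) * g (lat t - u)).
Proof. by move=> hg; apply: integrable_mul_L12; exact: L12_reflect. Qed.

Lemma integrable_corr0 g (t : Zd) : L12 g -> intble (fun u => g (- u) * g (lat t - u)).
Proof.
move=> hg; apply: integrable_mul_L12; last exact: L12_reflect.
by have := L12_reflect 0 hg; under eq_fun do rewrite sub0r.
Qed.

Lemma corr_abs g h : L12 g -> `|corr g h| <= corr (fun u => `|g u|) h.
Proof.
move=> hg; apply: Rintegral_abs_le => [|u|].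
- exact: integrable_real_meas (integrable_corr0 h hg).
- by rewrite normrM.
- exact: integrable_corr0 (L12_abs hg).
Qed.

Lemma corr_ge0 g h : (forall u, 0 <= g u) -> 0 <= corr g h.
Proof. by move=> g0; apply: Rintegral_ge0 => u _; rewrite mulr_ge0. Qed.

Lemma corr_le f g h : measurable_fun setT f -> (forall u, 0 <= f u <= g u) -> L12 g ->
  corr f h <= corr g h.
Proof.
move=> mf fg hg; apply: le_trans (ler_norm _) _.
have hf : L12 f.
  by apply: L12_le hg => // u; have /andP[? ?] := fg u; rewrite ger0_norm.
apply: Rintegral_abs_le; [|move=> u|exact: integrable_corr0].
  exact: integrable_real_meas (integrable_corr0 h hf).
have /andP[? ?] := fg (- u); have /andP[? ?] := fg (lat h - u).
by rewrite ger0_norm ?mulr_ge0// ler_pM.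
Qed.

Lemma Rintegral_shift_sum g (G : seq Zd) : L12 g ->
  \int[leb]_u (\sum_(t <- G) g (lat t - u)) = (size G)%:R * \int[leb]_u g u.
Proof.
move=> hg; rewrite Rintegral_sum; last by move=> t; exact: integrable_reflect hg.1.
under eq_bigr do rewrite (Rintegral_reflect _ (L12_meas hg)).
by rewrite big_const_seq count_predT iter_addr_0 mulr_natl.
Qed.

Lemma L12_shift_sum g (G : seq Zd) : L12 g -> L12 (fun u => \sum_(t <- G) g (lat t - u)).
Proof.
move=> hg; elim: G => [|t G IH].
  under eq_fun do rewrite big_nil.
  by have := L12Z 0 hg; under eq_fun do rewrite mul0r.
by under eq_fun do rewrite big_cons; apply: L12D IH; exact: L12_reflect.
Qed.

Lemma Rintegral_sq_shift_sum g (G : seq Zd) : L12 g ->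
  \int[leb]_u ((\sum_(t <- G) g (lat t - u)) ^+ 2) = \sum_(s <- G) \sum_(t <- G) corr g (t - s).
Proof.
move=> hg; under eq_Rintegral do rewrite expr2 big_distrlr/=.
have i s t := integrable_corr s t hg.
rewrite Rintegral_sum; last by move=> s; apply: integrable_sum_real.
apply: eq_bigr => s _; rewrite Rintegral_sum//; apply: eq_bigr => t _.
exact: corrE (L12_meas hg).
Qed.

Section truncation.
Variables (f : 'rV[R]_d -> R) (K : nat).

Definition core : set 'rV[R]_d :=
  [set u | `|f u| <= K%:R /\ forall i, u ord0 i \in `[- K%:R, K%:R]].

Definition rest u : R := \1_(~` core) u * f u.

Lemma restE u : f u = \1_core u * f u + rest u.
Proof.
rewrite /rest -mulrDl indicE indicE in_setC.
by case: (u \in core); rewrite ?addr0 ?add0r mul1r.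
Qed.

Lemma measurable_core : measurable_fun setT f -> measurable core.
Proof.
move=> mf; apply: measurableI; last first.
  have := measurable_box (const_mx (- K%:R) : 'rV[R]_d) (const_mx K%:R).
  by congr measurable; apply/seteqP; split => u /= h i; have := h i; rewrite !mxE.
rewrite -[X in measurable X]setTI; apply: measurable_fun_le => //.
exact: measurableT_comp.
Qed.

Lemma measurable_rest : measurable_fun setT f -> measurable_fun setT rest.
Proof.
move=> mf; apply: measurable_funM => //; apply: measurable_indic.
by apply: measurableC; exact: measurable_core.
Qed.

Lemma rest_le u : `|rest u| <= `|f u|.
Proof.
rewrite /rest normrM indicE; case: (_ \in _); rewrite ?normr1 ?mul1r//.
by rewrite normr0 mul0r.
Qed.

(** For fixed [u] the number of lattice points [t] with [t - u] in the core is bounded whatever [G]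
    is, and each contributes at most [K]. *)
Lemma core_sum_le (G : {fset Zd}) u :
  `|\sum_(t <- G) \1_core (lat t - u) * f (lat t - u)| <= K%:R * ((K.+1 + K.+1) ^ d)%:R.
Proof.
(* Rounding [u] down to the lattice moves each coordinate by less than one unit, hence the window of
   radius [K + 1] around [m]. *)
pose m : Zd := \row_i Num.floor (u ord0 i).
apply: le_trans (ler_norm_sum _ _ _) _.
apply: (@le_trans _ _ (\sum_(t <- G) if (t - m)%R \in Wn d K.+1 then K%:R else 0)).
  apply: ler_sum => t _; rewrite indicE; have [tc|_] := boolP (_ \in core); last first.
    by rewrite mul0r normr0; case: ifP.
  have [tK tb] := set_mem tc; rewrite mul1r ifT//.
  rewrite in_Wn; apply/asboolP => i.
  have := tb i; rewrite !mxE in_itv/= => /andP[t1 t2].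
  have fl := floor_itv (u ord0 i); move: fl => /andP[f1 f2].
  have k1 : (K.+1%:Z%:~R : R) = K%:R + 1 by rewrite -addn1 PoszD intrD.
  apply/andP; split.
    rewrite -(ler_int R) intrB intrN k1; lra.
  rewrite -(ltr_int R) intrB k1; rewrite intrD in f2; lra.
rewrite -big_mkcond/= -big_filter big_const_seq count_predT iter_addr_0 -[X in X <= _]mulr_natr.
by rewrite ler_wpM2l// ler_nat; exact: card_filter_Wn.
Qed.

(** Where [|g| > rho] the sum [S] exceeds twice the bound [C] of its truncated part, so at least
    half of it comes from the rest [r]: [|S| <= 2 |r|], whence [g^2 <= 4 c^2 r^2]. *)
Lemma tail_shift_sum (G : {fset Zd}) (c rho : R)
    (g := fun u => c * \sum_(t <- G) f (lat t - u)) : L12 f ->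
  `|c| * (2 * (K%:R * ((K.+1 + K.+1) ^ d)%:R)) <= rho ->
  \int[leb]_u (\1_[set u | rho < `|g u|] u * g u ^+ 2) <=
  4 * c ^+ 2 * \sum_(s <- G) \sum_(t <- G) corr rest (t - s).
Proof.
move=> hf hc.
have hr : L12 rest.
  by apply: L12_le (L12_abs hf); [exact: measurable_rest (L12_meas hf)|exact: rest_le].
have hg : L12 g by apply: L12Z; exact: L12_shift_sum.
have hrs := L12_shift_sum G hr.
rewrite -Rintegral_sq_shift_sum// -RintegralZl//; last exact: hrs.2.
apply: le_trans (ler_norm _) _; apply: Rintegral_abs_le; last exact: integrableZ_real hrs.2.
  exact: integrable_real_meas (integrable_tail rho hg).
move=> u; rewrite ger0_norm; last by apply: mulr_ge0 => //; exact: sqr_ge0.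
rewrite indicE; have [/set_mem/= gu|_] := boolP (u \in _); last first.
  by rewrite mul0r; apply: mulr_ge0; [apply: mulr_ge0 => //|]; exact: sqr_ge0.
rewrite mul1r /g !exprMn.
set S := \sum_(t <- G) f (lat t - u); set r := \sum_(t <- G) rest (lat t - u).
have hC := core_sum_le G u; set C := K%:R * _ in hc hC.
set k := \sum_(t <- G) \1_core (lat t - u) * f (lat t - u) in hC.
have Sk : S = k + r.
  by rewrite /S /k /r -big_split/=; apply: eq_bigr => t _; rewrite -restE.
have hS : 2 * C < `|S|.
  move: (le_lt_trans hc gu); rewrite /g normrM -/S.
  have [->|c0] := eqVneq c 0; first by rewrite normr0 !mul0r ltxx.
  by rewrite ltr_pM2l// normr_gt0.
have : `|S| <= 2 * `|r|.
  have : `|S| <= `|k| + `|r| by rewrite Sk; exact: ler_normD.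
  lra.
move=> Sr; rewrite (_ : 4 * c ^+ 2 * r ^+ 2 = c ^+ 2 * (4 * r ^+ 2)); last by ring.
apply: ler_wpM2l; first exact: sqr_ge0.
rewrite -(real_normK (num_real S)) -(real_normK (num_real r)).
have := normr_ge0 S; have := normr_ge0 r; nra.
Qed.

End truncation.

Lemma corr_rest_cvg f (h : Zd) (e : R) : L12 f -> 0 < e -> exists K0, forall K, (K0 <= K)%N ->
  corr (fun u => `|rest f K u|) h <= e.
Proof.
move=> hf e0; have mf := L12_meas hf.
have rest0 u : \forall K \near \oo, rest f K u = 0.
  have [m hm] : exists m : nat, `|f u| <= m%:R /\ forall i, `|u ord0 i| <= m%:R.
    exists (maxn (Num.truncn `|f u|).+1 (\max_(i < d) (Num.truncn `|u ord0 i|).+1)); split => [|i].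
      apply: le_trans (ltW (truncnS_gt _)) _; rewrite ler_nat; exact: leq_maxl.
    apply: le_trans (ltW (truncnS_gt _)) _; rewrite ler_nat.
    exact: leq_trans (leq_bigmax_cond (F := fun i => (Num.truncn `|u ord0 i|).+1) i isT) (leq_maxr _ _).
  exists m => // K /= mK; rewrite /rest indicE memNset ?mul0r//; apply; split.
    by apply: le_trans hm.1 _; rewrite ler_nat.
  move=> i; rewrite in_itv/= -ler_norml; apply: le_trans (hm.2 i) _; rewrite ler_nat.
  exact: mK.
have cvg0 : corr (fun u => `|rest f K u|) h @[K --> \oo] --> \int[leb]_u (0 : R).
  pose F (u : 'rV[R]_d) := `|f (- u)| * `|f (lat h - u)|.
  pose F' K u := `|rest f K (- u)| * `|rest f K (lat h - u)|.
  suff [] : [/\ measurable_fun setT (fun _ : 'rV[R]_d => 0 : R), intble (fun=> 0 : R) &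
      (\int[leb]_u F' K u) @[K --> \oo] --> \int[leb]_u (0 : R)] by [].
  apply: (@Rintegral_dct _ _ _ leb F' _ F).
  - move=> K; apply: integrable_real_meas; apply: (integrable_corr0 (g := fun u => `|rest f K u|) h).
    by apply: L12_abs; apply: L12_le (L12_abs hf); [exact: measurable_rest|exact: rest_le].
  - move=> u; apply: cvg_near_cst; near=> K; rewrite /F'.
    have -> : rest f K (- u) = 0 by near: K; exact: rest0.
    by rewrite normr0 mul0r.
  - exact: integrable_corr0 (L12_abs hf).
  - by move=> K u; rewrite normrM !normr_id ler_pM//; exact: rest_le.
move: cvg0; rewrite /Rintegral integral0/= => /cvgrPdist_le /(_ e e0)[K0 _ hK].
by exists K0 => K /hK /=; rewrite sub0r normrN; apply: le_trans; exact: ler_norm.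
Unshelve. all: by end_near.
Qed.

End autocorrelation.

(** * Summation over the lattice *)

Section lattice_nets.
Context {R : realType} (d : nat).
Local Notation Zd := 'rV[int]_d.
Implicit Types (c x : Zd -> R) (H : {fset Zd}).

Lemma sum_subset_le c (s s' : seq Zd) : (forall t, 0 <= c t) -> uniq s -> uniq s' ->
  {subset s <= s'} -> \sum_(t <- s) c t <= \sum_(t <- s') c t.
Proof.
move=> c0 us us' ss'.
have /(perm_big _) -> : perm_eq s' (s ++ [seq t <- s' | t \notin s]).
  apply: uniq_perm => //.
    rewrite cat_uniq us filter_uniq// andbT; apply/hasPn => t.
    by rewrite mem_filter => /andP[].
  move=> t; rewrite mem_cat mem_filter; have [ts|] := boolP (t \in s) => //=.
  exact: ss'.
by rewrite big_cat/= lerDl; apply: sumr_ge0.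
Qed.

Section nonneg.
Variable c : Zd -> R.
Hypotheses (c0 : forall t, 0 <= c t) (clt : (\esum_(t in [set: Zd]) (c t)%:E < +oo)%E).
Local Notation S := (\esum_(t in [set: Zd]) (c t)%:E)%E.

Let Sfin : S \is a fin_num.
Proof. by rewrite ge0_fin_numE//; apply: esum_ge0 => t _; rewrite lee_fin. Qed.

Let fsE H : (\sum_(t \in [set` H]) (c t)%:E)%E = (\sum_(t <- H) c t)%:E.
Proof. by rewrite -fsbig_seq ?fset_uniq// sumEFin. Qed.

Lemma sum_le_esum H : \sum_(t <- H) c t <= fine S.
Proof.
rewrite -lee_fin fineK// -fsE; apply: ereal_sup_ubound; by exists [set` H].
Qed.

Lemma esum_net e : 0 < e -> exists H0, forall H, (H0 `<=` H)%fset ->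
  fine S - e <= \sum_(t <- H) c t.
Proof.
move=> e0; have [x [X [fX _] <-] hx] := ub_ereal_sup_adherent e0 Sfin.
exists (fset_set X) => H XH.
move: hx; rewrite -[X in (\sum_(_ \in X) _)%E](fset_setK fX) fsE -[X in (X - _)%E](fineK Sfin) -EFinB lte_fin => /ltW h.
by apply: le_trans h _; exact: (sum_subset_le c0 (fset_uniq _) (fset_uniq _) (fsubsetP XH)).
Qed.

Lemma esum_tail e : 0 < e -> exists H, tail_le c H e.
Proof.
move=> /esum_net[H hH]; exists H => r ur rH.
have := hH H (fsubset_refl H); have := sum_le_esum (H `|` [fset t in r])%fset.
have -> : \sum_(t <- (H `|` [fset t in r])%fset) c t = \sum_(t <- H) c t + \sum_(t <- r) c t.
  rewrite -big_cat/=; apply: perm_big; apply: uniq_perm => [||t]; rewrite ?fset_uniq//.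
    by rewrite cat_uniq fset_uniq ur andbT; apply/hasPn => t /rH.
  by rewrite mem_cat !inE.
lra.
Qed.

End nonneg.

(** [lattice_sum] is a difference of two sums of nonnegative terms. Seen as a limit along finite
    sets it can be compared with other sums by [net_unique], in particular scaled. *)
Lemma lattice_sum_net x : summable [set: Zd] (fun t => (x t)%:E) ->
  forall e, 0 < e -> exists H0, forall H, (H0 `<=` H)%fset ->
  `|\sum_(t <- H) x t - lattice_sum (fun t => (x t)%:E)| <= e.
Proof.
move=> sx e e0; have e2 : 0 < e / 2 by lra.
have [sp sn] := (summable_funepos sx, summable_funeneg sx).
pose xp t := Num.max (x t) 0; pose xn t := Num.max (- x t) 0.
have xp0 t : 0 <= xp t by rewrite /xp le_max lexx orbT.
have xn0 t : 0 <= xn t by rewrite /xn le_max lexx orbT.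
have pE t : ((fun t => (x t)%:E)^\+ t = (xp t)%:E)%E by rewrite funeposE EFin_max.
have nE t : ((fun t => (x t)%:E)^\- t = (xn t)%:E)%E by rewrite funenegE -EFinN EFin_max.
have fp : (\esum_(t in [set: Zd]) (xp t)%:E < +oo)%E.
  move: sp; rewrite /summable; congr (_ < _)%E; apply: eq_esum => t _.
  by rewrite pE gee0_abs// lee_fin.
have fn : (\esum_(t in [set: Zd]) (xn t)%:E < +oo)%E.
  move: sn; rewrite /summable; congr (_ < _)%E; apply: eq_esum => t _.
  by rewrite nE gee0_abs// lee_fin.
have [H1 h1] := esum_net xp0 fp e2; have [H2 h2] := esum_net xn0 fn e2.
exists (H1 `|` H2)%fset => H; rewrite fsubUset => /andP[/h1 a1 /h2 a2].
have b1 := sum_le_esum xp0 fp H; have b2 := sum_le_esum xn0 fn H.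
rewrite /lattice_sum (eq_esum (b := fun t => (xp t)%:E)) => [|t _]; last exact: pE.
rewrite [X in (_ - X)%E](eq_esum (b := fun t => (xn t)%:E)) => [|t _]; last exact: nE.
rewrite fineB; [|by rewrite ge0_fin_numE//; apply: esum_ge0 => t _; rewrite lee_fin..].
have -> : \sum_(t <- H) x t = \sum_(t <- H) xp t - \sum_(t <- H) xn t.
  rewrite -sumrB; apply: eq_bigr => t _; rewrite /xp /xn.
  by clear; case: (lerP (x t) 0) => h; case: (lerP (- x t) 0) => h'; lra.
by rewrite ler_norml; apply/andP; split; lra.
Qed.

Lemma net_unique x (l l' : R) :
  (forall e, 0 < e -> exists H0, forall H, (H0 `<=` H)%fset -> `|\sum_(t <- H) x t - l| <= e) ->
  (forall e, 0 < e -> exists H0, forall H, (H0 `<=` H)%fset -> `|\sum_(t <- H) x t - l'| <= e) ->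
  l = l'.
Proof.
move=> h h'; apply/eqP; rewrite -subr_eq0 -normr_le0; apply/ler_addgt0Pl => e e0; rewrite addr0.
have e2 : 0 < e / 2 by lra.
have [H1 h1] := h _ e2; have [H2 h2] := h' _ e2.
have := h1 _ (fsubsetUl H1 H2); have := h2 _ (fsubsetUr H1 H2).
set s := \sum_(t <- _) _; rewrite !ler_norml => /andP[? ?] /andP[? ?].
by apply/andP; split; lra.
Qed.

End lattice_nets.

(** * Conditioning on the sampled set *)

Section sampled_sums.
Context {disp} {T : measurableType disp} {R : realType} (P : probability T R) (d : nat).
Context (L : set 'rV[R]_d -> {RV P >-> R}) (Y : 'rV[int]_d -> {RV P >-> R}).
Local Notation Zd := 'rV[int]_d.
Local Notation leb := (lebesgue_rV R d).
Local Notation lat := (of_lattice R).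
Local Notation W := (Wn d).
Local Notation V := (vol d R).
Hypothesis Y01 : forall t w, Y t w = 0 \/ Y t w = 1.
Hypothesis indYL : independent_systems P (sigma_family [set: Zd] Y)
  (sigma_family (@bounded_borel R d) L).

Definition sampled_fset n w : {fset Zd} := fset_set (sampled Y n w).
Local Notation Gn := sampled_fset.

Lemma finite_sampled n w : finite_set (sampled Y n w).
Proof. by apply: sub_finite_set (@finite_window d n) => t []. Qed.

Lemma in_sampled_fset n w t : (t \in Gn n w) = (t \in W n) && (Y t w == 1).
Proof.
rewrite /sampled_fset in_fset_set ?in_Wn; last exact: finite_sampled.
apply/idP/andP => [/set_mem[tn /eqP ->]|[/asboolP tn /eqP Yt]].
  by split => //; exact/asboolP.
exact/mem_set.
Qed.

Lemma sampled_fset_sub n w : Gn n w \in fpowerset (W n).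
Proof. by rewrite fpowersetE; apply/fsubsetP => t; rewrite in_sampled_fset => /andP[]. Qed.

Definition sampled_event n (G : {fset Zd}) : set T := [set w | Gn n w = G].

Lemma sigma_sampled_event n G : sigma_family [set: Zd] Y (sampled_event n G).
Proof.
pose gT := g_sigma_algebraType (\bigcup_(i in [set: Zd]) preimage_set_system setT (Y i) measurable).
have sub r : measurable (Y r @^-1` [set 1] : set gT).
  apply: sub_sigma_algebra; exists r => //=.
  by exists [set 1] => //; rewrite setTI.
have [GW|GW] := boolP (G \in fpowerset (W n)); last first.
  rewrite (_ : sampled_event n G = set0); first exact: (@measurable0 _ gT).
  by apply/seteqP; split => // w /= e; move: GW; rewrite -e sampled_fset_sub.
have -> : sampled_event n G =
    \bigcap_(t in [set` W n]) (if t \in G then Y t @^-1` [set 1] else ~` (Y t @^-1` [set 1])).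
  move: GW; rewrite fpowersetE => /fsubsetP GW; apply/seteqP; split => w /=.
    by move=> <- t /= tW; rewrite in_sampled_fset tW /=; case: eqP.
  move=> h; apply/fsetP => t; rewrite in_sampled_fset.
  have [tW|tW] /= := boolP (t \in W n); last by apply/esym/negbTE; apply: contra tW => /GW.
  by have := h t tW; case: ifPn => [tG /= ->|tG /= /eqP/negbTE ->//]; rewrite eqxx.
apply: (@fin_bigcap_measurable _ gT) => [|t _]; first exact: finite_fset.
by case: ifP => _; [exact: sub|exact: measurableC].
Qed.

Lemma sigma_family_measurable (A : set T) : sigma_family [set: Zd] Y A -> measurable A.
Proof.
apply: smallest_sub; first exact: sigma_algebra_measurable.
by move=> _ [t _ [B mB <-]]; exact: measurable_funPT.
Qed.

Lemma measurable_sampled_event n G : measurable (sampled_event n G).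
Proof. by apply: sigma_family_measurable; exact: sigma_sampled_event. Qed.

Lemma indep_sigma_family (A : set T) : sigma_family [set: Zd] Y A -> indep_event L A.
Proof.
by move=> sA; split => [|E sE]; [exact: sigma_family_measurable|exact: indYL].
Qed.

(** The window has finitely many subsets, so conditioning on the sampled set is a finite sum over
    events. *)
Lemma sampled_partition n w (h : {fset Zd} -> R) :
  h (Gn n w) = \sum_(G <- fpowerset (W n)) \1_(sampled_event n G) w * h G.
Proof.
rewrite (bigD1_seq (Gn n w)) ?sampled_fset_sub ?fset_uniq//=.
rewrite indicE mem_set// mul1r big1 ?addr0// => G nG.
by rewrite indicE memNset ?mul0r// => e; rewrite -e eqxx in nG.
Qed.

(** At lag [0] one has [Y_t^2 = Y_t], so the law of large numbers for pairs also covers the number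
    of sampled points. *)
Lemma size_sampled n w : (size (Gn n w))%:R = pairs Y 0 n w.
Proof.
rewrite /pairs -sum1_size natr_sum.
have /(perm_big _) -> : perm_eq (Gn n w) [seq t <- W n | Y t w == 1].
  by apply: uniq_perm; rewrite ?filter_uniq// => t; rewrite in_sampled_fset mem_filter andbC.
rewrite big_filter big_mkcond/=; apply: eq_bigr => t _; rewrite addr0.
by case: (Y01 t w) => ->; rewrite ?mul0r ?mul1r ?eqxx// eq_sym oner_eq0.
Qed.

Lemma quad_sampled g n w : \sum_(s <- Gn n w) \sum_(t <- Gn n w) g (t - s) = quad Y g n w.
Proof.
have /(perm_big _) E : perm_eq (Gn n w) [seq t <- W n | Y t w == 1].
  by apply: uniq_perm; rewrite ?filter_uniq// => t; rewrite in_sampled_fset mem_filter andbC.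
have F (h : Zd -> R) : \sum_(t <- Gn n w) h t = \sum_(t <- W n) Y t w * h t.
  rewrite E big_filter big_mkcond/=; apply: eq_bigr => t _.
  by case: (Y01 t w) => ->; rewrite ?mul0r ?mul1r ?eqxx// eq_sym oner_eq0.
rewrite F; apply: eq_bigr => s _; rewrite F mulr_sumr.
by apply: eq_bigr => t _; rewrite mulrA.
Qed.

Hypothesis lL : is_levy_basis L.
Variables (mu v : R) (a b : R -> R).
Hypothesis lab : levy_log_cf mu v a b.
Hypothesis cfL : forall A z t, bounded_borel A -> let l := fine (leb A) in
    \int[P]_w cos (z * L A w + t) = expR (l * a z) * cos (l * b z + t).
Variables (f : 'rV[R]_d -> R) (X : Zd -> {RV P >-> R}).
Hypothesis hf : L12 f.
Hypothesis hX : forall t, dominated_integral L (fun u => f (lat t - u)) (X t).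
Local Notation beta := (mu * \int[leb]_u f u).

(** Its stochastic integral is [z] times the normalised sum before centring. For empty [G] it
    vanishes, as [0^-1 = 0]. *)
Definition scaled_kernel (z : R) (G : seq Zd) u : R :=
  z / Num.sqrt (size G)%:R * \sum_(t <- G) f (lat t - u).

(** Conditional characteristic function of the centred sum given the sampled set [G], with phase
    [th]; subtracting [mu] times the integral of the kernel is the centring by [beta]. *)
Definition cond_cf (z th : R) (G : seq Zd) : R :=
  expR (\int[leb]_u a (scaled_kernel z G u)) *
  cos (\int[leb]_u b (scaled_kernel z G u) - mu * \int[leb]_u scaled_kernel z G u + th).

Lemma L12_scaled_kernel z G : L12 (scaled_kernel z G).
Proof. by apply: L12Z; exact: L12_shift_sum. Qed.

Lemma cond_cfP z th n G :
  \int[P]_w (\1_(sampled_event n G) w *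
    cos (z * ((Num.sqrt (size G)%:R)^-1 * \sum_(t <- G) (X t w - beta)) + th)) =
  pr P (sampled_event n G) * cond_cf z th G.
Proof.
have dS : dominated_integral L (scaled_kernel z G)
    (fun w => z / Num.sqrt (size G)%:R * \sum_(t <- G) X t w).
  by apply: dominated_integralZ; exact: dominated_integral_sum.
have mE : \int[leb]_u scaled_kernel z G u = z / Num.sqrt (size G)%:R * ((size G)%:R * \int[leb]_u f u).
  by rewrite RintegralZl//; [rewrite Rintegral_shift_sum|exact: (L12_shift_sum G hf).1].
have := dominated_integral_cf lL lab cfL (th - mu * \int[leb]_u scaled_kernel z G u) dS
  (indep_sigma_family (sigma_sampled_event n G)).
rewrite /cond_cf addrA addrAC => <-; apply: eq_Rintegral => w _; congr (_ * cos _).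
rewrite sumrB (_ : \sum_(t <- G) beta = (size G)%:R * beta); first by rewrite mE; ring.
by rewrite big_const_seq count_predT iter_addr_0 mulr_natl.
Qed.

Lemma integrable_sampled (h : {fset Zd} -> R) n : P.-integrable setT (EFin \o (fun w => h (Gn n w))).
Proof.
under eq_fun do rewrite (sampled_partition n _ h) /=.
apply: integrable_sum_real => G; under eq_fun do rewrite mulrC.
by apply: integrableZ_real; apply: integrable_indicP; exact: measurable_sampled_event.
Qed.

Lemma cf_mixture z th n :
  \int[P]_w cos (z * normalized_sum Y X beta n w + th) = \int[P]_w cond_cf z th (Gn n w).
Proof.
pose S (G : {fset Zd}) w := (Num.sqrt (size G)%:R)^-1 * \sum_(t <- G) (X t w - beta).
have SE w : normalized_sum Y X beta n w = S (Gn n w) w.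
  rewrite /normalized_sum /S; congr (_ * _).
  by rewrite fsbig_finite//; exact: finite_sampled.
transitivity (\int[P]_w (\sum_(G <- fpowerset (W n)) \1_(sampled_event n G) w * cos (z * S G w + th))).
  by apply: eq_Rintegral => w _; rewrite SE (sampled_partition n w (fun G => cos (z * S G w + th))).
transitivity (\int[P]_w (\sum_(G <- fpowerset (W n)) \1_(sampled_event n G) w * cond_cf z th G)); last first.
  by apply: eq_Rintegral => w _; rewrite (sampled_partition n w (cond_cf z th)).
have mS G : measurable_fun setT (S G).
  apply: measurable_funM => //; apply: measurable_sum => t; exact: measurable_funB.
have i1 G := integrable_indicP P (measurable_sampled_event n G).
have i2 G : P.-integrable setT (EFin \o (fun w => \1_(sampled_event n G) w * cond_cf z th G)).
  by under eq_fun do rewrite mulrC; exact: integrableZ_real.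
rewrite [RHS]Rintegral_sum// Rintegral_sum => [|G]; last first.
  apply: (le_integrable_real _ _ (i1 G)) => [|w].
    apply: measurable_funM; first by apply: measurable_indic; exact: measurable_sampled_event.
    apply: measurableT_comp => //; first by apply: continuous_measurable_fun; exact: continuous_cos.
    by apply: measurable_funD => //; exact: measurable_funM.
  rewrite normrM indicE ger0_norm// ler_piMr//.
  by rewrite ler_norml cos_geN1 cos_le1.
apply: eq_bigr => G _; rewrite cond_cfP.
under [RHS]eq_Rintegral do rewrite mulrC.
by rewrite RintegralZl// pr_Rintegral; [rewrite mulrC|exact: measurable_sampled_event].
Qed.

End sampled_sums.

(** * Distance of the conditional characteristic function from the normal one *)

Section cond_cf_bound.
Context {R : realType} (d : nat).
Local Notation Zd := 'rV[int]_d.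
Local Notation leb := (lebesgue_rV R d).
Variables (mu v : R) (a b : R -> R).
Hypothesis lab : levy_log_cf mu v a b.
Variables (f : 'rV[R]_d -> R).
Hypothesis hf : L12 f.

Lemma abs_cond_cf z th (G : {fset Zd}) : `|cond_cf mu a b f z th G| <= 1.
Proof.
rewrite /cond_cf normrM (ger0_norm (expR_ge0 _)) -[X in _ <= X]mulr1 ler_pM ?expR_ge0//.
  rewrite -expR0 ler_expR -oppr_ge0 -RintegralN; last first.
    exact: (log_cf_int lab (L12_scaled_kernel hf z G)).1.
  by apply: Rintegral_ge0 => u _; rewrite oppr_ge0; exact: llc_a_le0 lab _.
by rewrite ler_norml cos_geN1 cos_le1.
Qed.

(** [log_cf_est] estimates the exponent, and [tail_shift_sum] its tail term. The bound is linear in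
    the three errors, so it can be integrated over the field. [C] is fixed before the truncation
    level [K], and only the threshold [n0] depends on [K], so that [K] can be chosen later to make
    [C r] small. *)
Lemma cond_cf_bound (z th e p q : R) : 0 < e -> 0 < p -> 0 <= q ->
  exists2 C, 0 <= C & forall K : nat, exists n0 : R, forall (G : {fset Zd}) (V : R),
  0 < V -> n0 <= V ->
  forall N Q r, N = (size G)%:R / V ->
  Q = (\sum_(s <- G) \sum_(t <- G) corr f (t - s)) / V ->
  r = (\sum_(s <- G) \sum_(t <- G) corr (fun u => `|rest f K u|) (t - s)) / V ->
  `|cond_cf mu a b f z th G - expR (- (z ^+ 2 / 2 * (v * q / p))) * cos th| <=
  (4 / p + v * z ^+ 2 * q / p ^+ 2) * `|N - p| +
  (4 * e * z ^+ 2 / p + v * z ^+ 2 / p) * `|Q - q| +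
  4 * e * z ^+ 2 / p * q + C * r.
Proof.
move=> e0 p0 q0; have [C0 C00 hC] := log_cf_est d lab.
have [rho rho0 hrho] := hC e e0.
have v0 := llc_v_ge0 lab; have := sqr_ge0 z.
have [z2 z2E] : exists y, y = z ^+ 2 by exists (z ^+ 2).
rewrite -!z2E => z20.
exists (16 * C0 * z2 / p) => [|K]; first by rewrite divr_ge0 ?(ltW p0)// !mulr_ge0.
pose B : R := 2 * (K%:R * ((K.+1 + K.+1) ^ d)%:R).
have B0 : 0 <= B by rewrite !mulr_ge0.
(* With [N >= p / 2] this threshold for [V] gives [c^2 B^2 = z2 B^2 / (N V) <= rho^2], which is the
   condition of [tail_shift_sum]. *)
exists (2 * (z2 * B ^+ 2) / (rho ^+ 2 * p)) => G V V0 n0V N Q r NE QE rE.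
have hsq := Rintegral_sq_shift_sum G hf; set Q0 := \sum_(s <- G) _ in QE hsq.
have Q00 : 0 <= Q0 by rewrite -hsq; apply: Rintegral_ge0 => u _; exact: sqr_ge0.
set r0 := \sum_(s <- G) _ in rE.
have r00 : 0 <= r0 by apply: sumr_ge0 => s _; apply: sumr_ge0 => t _; exact: corr_ge0.
have Qge0 : 0 <= Q by rewrite QE divr_ge0// ltW.
have rge0 : 0 <= r by rewrite rE divr_ge0// ltW.
have a'0 : - (z2 / 2 * (v * q / p)) <= 0.
  by rewrite oppr_le0 mulr_ge0 ?divr_ge0// ?mulr_ge0// ltW.
(* If few points are sampled, possibly none, both terms are at most [1] in modulus and
   [2 <= (4 / p) |N - p|]. Otherwise [1 / N <= 2 / p] makes the quotients by [N] harmless. *)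
have [Np|Np] := ltP N (p / 2).
  apply: (@le_trans _ _ 2).
    apply: le_trans (ler_normB _ _) _.
    have h1 := abs_cond_cf z th G.
    have h2 : `|expR (- (z2 / 2 * (v * q / p))) * cos th| <= 1.
      rewrite normrM (ger0_norm (expR_ge0 _)) -[X in _ <= X]mulr1 ler_pM ?expR_ge0//.
        by rewrite -[X in _ <= X]expR0 ler_expR.
      by rewrite ler_norml cos_geN1 cos_le1.
    clear -h1 h2; lra.
  have h3 : p / 2 <= `|N - p| by rewrite distrC; apply: le_trans (ler_norm _); lra.
  have h4 : 2 <= 4 / p * `|N - p|.
    by apply: le_trans (ler_wpM2l _ h3); [rewrite le_eqVlt; apply/orP; left; apply/eqP; field; rewrite gt_eqF|rewrite divr_ge0// ltW].
  have h5 : 0 <= v * z2 * q / p ^+ 2 * `|N - p|.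
    by rewrite mulr_ge0// divr_ge0 ?sqr_ge0// !mulr_ge0.
  have h6 : 0 <= (4 * e * z2 / p + v * z2 / p) * `|Q - q|.
    by rewrite mulr_ge0// addr_ge0// divr_ge0 ?(ltW p0)// !mulr_ge0// ltW.
  have h7 : 0 <= 4 * e * z2 / p * q.
    by rewrite mulr_ge0// divr_ge0 ?(ltW p0)// !mulr_ge0// ltW.
  have h8 : 0 <= 16 * C0 * z2 / p * r.
    by rewrite mulr_ge0// divr_ge0 ?(ltW p0)// !mulr_ge0.
  clear -h4 h5 h6 h7 h8; lra.
have N0 : 0 < N by apply: lt_le_trans Np; exact: divr_gt0.
have sE : (size G)%:R = N * V by rewrite NE divfK// gt_eqF.
have s0 : 0 < (size G)%:R :> R by rewrite sE mulr_gt0.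
set c := z / Num.sqrt (size G)%:R.
have c2 : c ^+ 2 = z2 / (N * V).
  by rewrite /c exprMn -z2E exprVn sqr_sqrtr ?(ltW s0)// sE.
have hg := L12_scaled_kernel hf z G.
have [/= ha hb] := hrho _ hg.
have gE : \int[leb]_u (scaled_kernel f z G u ^+ 2) = c ^+ 2 * Q0.
  under eq_Rintegral do rewrite /scaled_kernel exprMn.
  by rewrite RintegralZl//; [rewrite hsq|exact: (L12_shift_sum G hf).2].
have tailE : \int[leb]_u (\1_[set u | rho < `|scaled_kernel f z G u|] u * scaled_kernel f z G u ^+ 2)
    <= 4 * c ^+ 2 * r0.
  apply: (@le_trans _ _ (4 * c ^+ 2 * \sum_(s <- G) \sum_(t <- G) corr (rest f K) (t - s))).
    apply: (@tail_shift_sum _ _ f K G c rho hf).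
    rewrite -(ler_pXn2r (n := 2)) ?nnegrE ?mulr_ge0 ?(ltW rho0)//.
    rewrite exprMn (real_normK (num_real c)) c2 -/B.
    have : 2 * (z2 * B ^+ 2) <= rho ^+ 2 * p * V.
      by rewrite [X in _ <= X]mulrC -ler_pdivrMr//; apply: mulr_gt0 => //; exact: exprn_gt0.
    have : rho ^+ 2 * (p / 2) * V <= rho ^+ 2 * N * V.
      by rewrite ler_pM2r// ler_pM2l// exprn_gt0.
    move=> h1 h2; rewrite mulrAC ler_pdivrMr ?mulr_gt0//; clear -h1 h2; lra.
  apply: ler_wpM2l; first exact: (mulr_ge0 (ler0n _ 4) (sqr_ge0 c)).
  apply: ler_sum => s _; apply: ler_sum => t _; apply: le_trans (ler_norm _) _.
  apply: corr_abs; apply: L12_le (L12_abs hf) => [|u]; last exact: rest_le.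
  exact: measurable_rest (L12_meas hf).
have hmul : C0 * \int[leb]_u (\1_[set u | rho < `|scaled_kernel f z G u|] u * scaled_kernel f z G u ^+ 2)
   <= C0 * (4 * c ^+ 2 * r0) by exact: ler_wpM2l.
rewrite gE in ha hb.
have aneg : \int[leb]_u a (scaled_kernel f z G u) <= 0.
  rewrite -oppr_ge0 -RintegralN; last exact: (log_cf_int lab hg).1.
  by apply: Rintegral_ge0 => u _; rewrite oppr_ge0; exact: llc_a_le0 lab _.
apply: le_trans (expR_cos_dist _ _ aneg a'0) _.
set A := \int[leb]_u a _ in ha *; set bb := _ - _ in hb *.
have step1 : `|A - - (z2 / 2 * (v * q / p))| <=
    `|A + v / 2 * (c ^+ 2 * Q0)| + v * z2 / 2 * `|Q / N - q / p|.
  have -> : A - - (z2 / 2 * (v * q / p)) =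
    (A + v / 2 * (c ^+ 2 * Q0)) + - (v * z2 / 2 * (Q / N - q / p)).
    by rewrite c2 QE; field; rewrite !gt_eqF.
  apply: le_trans (ler_normD _ _) _; rewrite normrN [X in _ + X <= _]normrM.
  by rewrite (ger0_norm (x := v * z2 / 2)) ?divr_ge0// mulr_ge0.
have cQ : c ^+ 2 * Q0 = z2 * (Q / N) by rewrite c2 QE; field; rewrite !gt_eqF.
have cr : c ^+ 2 * r0 = z2 * (r / N) by rewrite c2 rE; field; rewrite !gt_eqF.
have iN : N^-1 <= 2 / p by rewrite -[2 / p]invf_div lef_pV2 ?posrE// divr_gt0.
have QN : Q / N <= 2 / p * (`|Q - q| + q).
  apply: (@le_trans _ _ (Q * (2 / p))); first by rewrite ler_wpM2l.
  rewrite mulrC ler_wpM2l ?divr_ge0 ?(ltW p0)//.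
  by rewrite -lerBlDr; exact: ler_norm.
have rN : r / N <= 2 / p * r by rewrite mulrC ler_wpM2r.
have dQN : `|Q / N - q / p| <= 2 / p ^+ 2 * (p * `|Q - q| + q * `|N - p|).
  have -> : Q / N - q / p = (p * (Q - q) - q * (N - p)) * (N^-1 / p) by field; rewrite !gt_eqF.
  rewrite normrM [X in _ <= X]mulrC ler_pM//.
    apply: le_trans (ler_normB _ _) _; rewrite !normrM (gtr0_norm p0) (ger0_norm q0) //.
  rewrite ger0_norm ?divr_ge0 ?invr_ge0 ?(ltW p0) ?(ltW N0)//.
  have -> : 2 / p ^+ 2 = 2 / p / p by field; rewrite gt_eqF.
  by rewrite ler_pM2r ?invr_gt0.
have m1 := ler_wpM2l (mulr_ge0 (ltW e0) z20) QN.
have m2 := ler_wpM2l (mulr_ge0 C00 z20) rN.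
have vz : 0 <= v * z2 / 2 by rewrite divr_ge0// mulr_ge0.
have m3 := ler_wpM2l vz dQN.
have -> : (4 / p + v * z2 * q / p ^+ 2) * `|N - p| +
  (4 * e * z2 / p + v * z2 / p) * `|Q - q| +
  4 * e * z2 / p * q + 16 * C0 * z2 / p * r =
  4 / p * `|N - p| + v * z2 / 2 * (2 / p ^+ 2 * (p * `|Q - q| + q * `|N - p|)) +
  2 * (e * z2 * (2 / p * (`|Q - q| + q)) + 4 * (C0 * z2 * (2 / p * r))).
  by field; rewrite gt_eqF.
have n4 : 0 <= 4 / p * `|N - p| by rewrite mulr_ge0// divr_ge0// ltW.
have qle : e * (c ^+ 2 * Q0) + C0 * \int[leb]_u (\1_[set u | rho < `|scaled_kernel f z G u|] u * scaled_kernel f z G u ^+ 2)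
   <= e * z2 * (2 / p * (`|Q - q| + q)) + 4 * (C0 * z2 * (2 / p * r)).
  have -> : e * (c ^+ 2 * Q0) = e * z2 * (Q / N) by rewrite cQ mulrA.
  have E4 : C0 * (4 * c ^+ 2 * r0) = 4 * (C0 * z2 * (r / N)).
    by rewrite -[4 * c ^+ 2 * r0]mulrA cr; ring.
  rewrite E4 in hmul; clear -hmul m1 m2; lra.
clear -ha hb step1 m3 n4 qle; lra.
Qed.

End cond_cf_bound.

Section sampled_cf_limit.
Context {disp} {T : measurableType disp} {R : realType} (P : probability T R) (d : nat).
Context (L : set 'rV[R]_d -> {RV P >-> R}) (Y : 'rV[int]_d -> {RV P >-> R}).
Local Notation Zd := 'rV[int]_d.
Local Notation leb := (lebesgue_rV R d).
Local Notation lat := (of_lattice R).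
Local Notation V := (vol d R).
Local Notation Gn := (sampled_fset Y).
Local Notation p := (pair_prob Y).
Local Notation intble f := (P.-integrable setT (EFin \o f)).
Hypothesis d_gt0 : (0 < d)%N.
Hypothesis Y01 : forall t w, Y t w = 0 \/ Y t w = 1.
Hypothesis stY : stationary Y.
Hypothesis mixY : alpha_field Y k 2 2 @[k --> \oo] --> 0%E.
Hypothesis indYL : independent_systems P (sigma_family [set: Zd] Y)
  (sigma_family (@bounded_borel R d) L).
Hypothesis p0_gt0 : 0 < p 0.
Hypothesis lL : is_levy_basis L.
Variables (mu v : R) (a b : R -> R).
Hypothesis lab : levy_log_cf mu v a b.
Hypothesis cfL : forall A z t, bounded_borel A -> let l := fine (leb A) in
    \int[P]_w cos (z * L A w + t) = expR (l * a z) * cos (l * b z + t).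
Variables (f : 'rV[R]_d -> R) (X : Zd -> {RV P >-> R}).
Hypothesis hf : L12 f.
Hypothesis hX : forall t, dominated_integral L (fun u => f (lat t - u)) (X t).
Local Notation beta := (mu * \int[leb]_u f u).
Local Notation kappa := (corr (fun u => `|f u|)).
Hypothesis hsum : (\esum_(t in [set: Zd]) (p t * kappa t)%:E < +oo)%E.
Variable q : R.
Hypothesis hq : forall e, 0 < e -> exists H0 : {fset Zd}, forall H : {fset Zd}, (H0 `<=` H)%fset ->
  `|\sum_(h <- H) p h * corr f h - q| <= e.

Let kappa_ge0 h : 0 <= kappa h. Proof. exact: corr_ge0. Qed.

Let pk_ge0 h : 0 <= p h * kappa h. Proof. by rewrite mulr_ge0// pair_prob_ge0. Qed.

Let quad_lim e : 0 < e -> exists N, forall n, (N <= n)%N ->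
  \int[P]_w `|quad Y (corr f) n w / V n - q| <= e.
Proof.
apply: (quad_cvg d_gt0 Y01 stY mixY (k := kappa)) => [h|e' e'0|//].
  exact: corr_abs.
exact: esum_tail pk_ge0 hsum _ e'0.
Qed.

(** On the sampled set the quadratic form is the integral of a square, and [q] is the limit in mean
    of its averages. *)
Lemma corr_limit_ge0 : 0 <= q.
Proof.
rewrite -oppr_le0; apply/ler_addgt0Pl => e e0; rewrite addr0.
have [N hN] := quad_lim e0.
have V0 : 0 < V N.+1 by exact: vol_gt0.
apply: le_trans (hN N.+1 (leqnSn N)).
have iQ : intble (fun w => `|quad Y (corr f) N.+1 w / V N.+1 - q|).
  apply: integrable_abs; apply: integrableB_real.
    by under eq_fun do rewrite mulrC; apply: integrableZ_real; exact: integrable_quad.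
  by apply: (@integrable_bounded _ _ _ P _ `|q|).
rewrite -[X in X <= _](Rintegral_prob_cst P) -subr_ge0 -RintegralB//; last first.
  by apply: (@integrable_bounded _ _ _ P _ `|- q|).
apply: Rintegral_ge0 => w _; rewrite -quad_sampled// -Rintegral_sq_shift_sum//.
set I := \int[_]_u _; have I0 : 0 <= I by apply: Rintegral_ge0 => u _; exact: sqr_ge0.
have : 0 <= I / V N.+1 by rewrite divr_ge0// ltW.
have := ler_norm (I / V N.+1 - q); lra.
Qed.

(** Lags outside a finite set are controlled by the summable majorant [p h * kappa h], uniformly in
    [K] and [n]; at the remaining lags the correlation of the rest tends to [0] as [K] grows. *)
Lemma rest_lim d' : 0 < d' -> exists K, forall n, (0 < n)%N ->
  \int[P]_w (quad Y (corr (fun u => `|rest f K u|)) n w / V n) <= d'.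
Proof.
move=> d0; have d2 : 0 < d' / 2 by lra.
have [H hH] := esum_tail pk_ge0 hsum d2.
have mr K : measurable_fun setT (fun u => `|rest f K u|).
  by apply: measurableT_comp => //; exact: measurable_rest (L12_meas hf).
have [K hK] := eventually_sum H (fun h => @corr_rest_cvg _ _ f h ^~ hf) (pair_prob_ge0 Y) d2.
exists K => n n0; have V0 := vol_gt0 d R n0.
under eq_Rintegral do rewrite mulrC.
rewrite RintegralZl//; last exact: integrable_quad.
rewrite ler_pdivrMl//; apply: (@le_trans _ _ (V n * (\sum_(h <- H) p h * corr (fun u => `|rest f K u|) h + d' / 2))).
  apply: quad_le => // [h|r ur rH]; first exact: corr_ge0.
  apply: le_trans (hH r ur rH); apply: ler_sum => h _; rewrite ler_wpM2l ?pair_prob_ge0//.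
  apply: corr_le => // [u|]; [by rewrite normr_ge0 rest_le|exact: L12_abs].
by rewrite ler_pM2l// [X in _ <= X]splitr lerD2r; exact: hK.
Qed.

(** [cond_cf_bound] is integrated over the field through [cf_mixture], with [e / 4] allotted to each
    of the four terms. The choices are made in the order [e1], [C], [K], [n]. *)
Lemma sampled_cf_cvg z th :
  \int[P]_w cos (z * normalized_sum Y X beta n w + th) @[n --> \oo] -->
  expR (- (z ^+ 2 / 2 * (v * q / p 0))) * cos th.
Proof.
apply/cvgrPdist_le => e e0; set l := expR _ * _.
have sum4 x1 x2 x3 x4 : x1 <= e / 4 -> x2 <= e / 4 -> x3 <= e / 4 -> x4 <= e / 4 ->
  x1 + x2 + x3 + x4 <= e by lra.
have q0 := corr_limit_ge0; have z20 := sqr_ge0 z; have v0 := llc_v_ge0 lab.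
(* Makes [M3 = 4 e1 z^2 q / p 0] at most [e / 4]; the added units keep the divisor positive. *)
pose e1 := e * p 0 / (16 * ((z ^+ 2 + 1) * (q + 1))).
have zq0 : 0 < (z ^+ 2 + 1) * (q + 1) by apply: mulr_gt0; lra.
have e10 : 0 < e1 by apply: divr_gt0; apply: mulr_gt0.
have [C C0 hC] := cond_cf_bound lab hf z th e10 p0_gt0 q0.
set M1 := 4 / _ + _ in hC; set M2 := 4 * e1 * z ^+ 2 / p 0 + _ in hC.
set M3 := 4 * e1 * z ^+ 2 / p 0 * q in hC.
have M10 : 0 <= M1.
  by apply: addr_ge0; rewrite divr_ge0 ?(ltW p0_gt0) ?sqr_ge0//; rewrite mulr_ge0// mulr_ge0.
have M20 : 0 <= M2.
  by apply: addr_ge0; rewrite divr_ge0 ?(ltW p0_gt0)//; rewrite mulr_ge0// mulr_ge0// ltW.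
have M3e : M3 <= e / 4.
  have -> : M3 = e / 4 * (z ^+ 2 * q / ((z ^+ 2 + 1) * (q + 1))).
    rewrite /M3 /e1; field; rewrite !gt_eqF//; lra.
  rewrite ler_piMr ?divr_ge0 ?(ltW e0)// ler_pdivrMr// mul1r ler_pM//; lra.
have e4 k : 0 <= k -> 0 < e / (4 * (k + 1)) by move=> k0; rewrite divr_gt0// mulr_gt0//; lra.
have e4P k x : 0 <= k -> 0 <= x -> x <= e / (4 * (k + 1)) -> k * x <= e / 4.
  move=> k0 x0 hx; apply: (@le_trans _ _ ((k + 1) * (e / (4 * (k + 1))))).
    by apply: ler_pM => //; lra.
  by rewrite le_eqVlt; apply/orP; left; apply/eqP; field; rewrite gt_eqF//; lra.
have [K hK] := rest_lim (e4 C C0).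
have [n0 hn0] := hC K.
have [N1 hN1] := pairs_cvg d_gt0 Y01 stY mixY 0 (e4 M1 M10).
have [N2 hN2] := quad_lim (e4 M2 M20).
exists (maxn (maxn N1 N2) (Num.truncn n0).+1) => // n /=.
rewrite !geq_max => /andP[/andP[/hN1 h1 /hN2 h2] nn].
have n_gt0 : (0 < n)%N by exact: leq_trans nn.
have V0 := vol_gt0 d R n_gt0.
have n0V : n0 <= V n.
  apply: (le_trans _ (@vol_ge R d d_gt0 n)).
  by apply: le_trans (ltW (truncnS_gt _)) _; rewrite ler_nat.
have h3 := hK n n_gt0.
rewrite distrC (cf_mixture indYL lL lab cfL hf hX).
pose dN w := `|pairs Y 0 n w / V n - p 0|.
pose dQ w := `|quad Y (corr f) n w / V n - q|.
pose r w := quad Y (corr (fun u => `|rest f K u|)) n w / V n.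
have icst (c : R) : intble (fun=> c) by apply: (@integrable_bounded _ _ _ P _ `|c|).
have iN : intble dN.
  apply: integrable_abs; apply: integrableB_real => //.
  by under eq_fun do rewrite mulrC; apply: integrableZ_real; exact: integrable_pairs.
have iQ : intble dQ.
  apply: integrable_abs; apply: integrableB_real => //.
  by under eq_fun do rewrite mulrC; apply: integrableZ_real; exact: integrable_quad.
have ir : intble r.
  by rewrite /r; under eq_fun do rewrite mulrC; apply: integrableZ_real; exact: integrable_quad.
have iF : intble (fun w => cond_cf mu a b f z th (Gn n w)).
  exact: (@integrable_sampled _ _ _ P d Y (fun G : {fset Zd} => cond_cf mu a b f z th G) n).
have ptw w : `|cond_cf mu a b f z th (Gn n w) - l| <= M1 * dN w + M2 * dQ w + M3 + C * r w.
  have := hn0 (Gn n w) (V n) V0 n0V _ _ _ erefl erefl erefl.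
  by rewrite (size_sampled Y01) !(quad_sampled Y01).
have i1 : intble (fun w => M1 * dN w) by exact: integrableZ_real.
have i2 : intble (fun w => M2 * dQ w) by exact: integrableZ_real.
have i4 : intble (fun w => C * r w) by exact: integrableZ_real.
have i12 : intble (fun w => M1 * dN w + M2 * dQ w) by exact: integrableD_real.
have i123 : intble (fun w => M1 * dN w + M2 * dQ w + M3) by exact: integrableD_real.
have -> : \int[P]_w cond_cf mu a b f z th (Gn n w) - l = \int[P]_w (cond_cf mu a b f z th (Gn n w) - l).
  by rewrite RintegralB// Rintegral_prob_cst.
apply: le_trans (Rintegral_abs_le _ ptw (integrableD_real i123 i4)) _.
  exact: integrable_real_meas (integrableB_real iF (icst l)).
rewrite RintegralD// RintegralD// RintegralD// Rintegral_prob_cst !RintegralZl//.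
have r0 : 0 <= \int[P]_w r w.
  apply: Rintegral_ge0 => w _; rewrite divr_ge0 ?(ltW V0)// -quad_sampled//.
  by apply: sumr_ge0 => s _; apply: sumr_ge0 => t _; exact: corr_ge0.
have N0 : 0 <= \int[P]_w dN w by apply: Rintegral_ge0 => w _; exact: normr_ge0.
have Q0 : 0 <= \int[P]_w dQ w by apply: Rintegral_ge0 => w _; exact: normr_ge0.
have a1 := e4P M1 _ M10 N0 h1; have a2 := e4P M2 _ M20 Q0 h2; have a3 := e4P C _ C0 r0 h3.
exact: sum4.
Qed.

End sampled_cf_limit.

(** * Covariances and the limit law *)

Section covariances.
Context {disp} {T : measurableType disp} {R : realType} (P : probability T R) (d : nat).
Context (L : set 'rV[R]_d -> {RV P >-> R}) (Y : 'rV[int]_d -> {RV P >-> R}).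
Local Notation Zd := 'rV[int]_d.
Local Notation leb := (lebesgue_rV R d).
Local Notation lat := (of_lattice R).
Local Notation p := (pair_prob Y).
Local Notation intble f := (P.-integrable setT (EFin \o f)).
Hypothesis Y01 : forall t w, Y t w = 0 \/ Y t w = 1.
Hypothesis stY : stationary Y.
Hypothesis indYL : independent_systems P (sigma_family [set: Zd] Y)
  (sigma_family (@bounded_borel R d) L).
Hypothesis lL : is_levy_basis L.
Variables (mu v : R) (a b : R -> R).
Hypothesis lab : levy_log_cf mu v a b.
Hypothesis cfL : forall A z t, bounded_borel A -> let l := fine (leb A) in
    \int[P]_w cos (z * L A w + t) = expR (l * a z) * cos (l * b z + t).
Variables (f : 'rV[R]_d -> R) (X : Zd -> {RV P >-> R}).
Hypothesis hf : L12 f.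
Hypothesis hX : forall t, dominated_integral L (fun u => f (lat t - u)) (X t).
Local Notation beta := (mu * \int[leb]_u f u).

Lemma indep_occ2 s t : indep_event L (occ2 Y s t).
Proof. by apply: (indep_sigma_family indYL); exact: sigma_occ2. Qed.

Lemma dominated_moments (D : set T) (W : T -> R) g : indep_event L D -> dominated_integral L g W ->
  let W' w := W w - mu * \int[leb]_u g u in
  [/\ intble (fun w => \1_D w * W' w ^+ 2),
      \int[P]_w (\1_D w * W' w ^+ 2) = pr P D * (v * \int[leb]_u (g u ^+ 2)),
      intble (fun w => \1_D w * W' w) &
      \int[P]_w (\1_D w * W' w) = 0].
Proof.
move=> iD dW; have [_ [_ [_ _ _ mW _]]] := dW.
apply: (moments_from_log_cf lab iD.1 mW (dominated_integral_L12 dW)) => z t.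
exact: (dominated_integral_cf lL lab cfL t (dominated_integralZ z dW) iD).
Qed.

(** Polarisation: [x y = ((x + y)^2 - (x - y)^2) / 4], where the moments of [X_t + X_0] and
    [X_t - X_0] on the event are read from their characteristic functions. Integrability of the
    product comes out at the same time. *)
Lemma centered_product t :
  intble (fun w => \1_(occ2 Y 0 t) w * ((X t w - beta) * (X 0 w - beta))) /\
  \int[P]_w (\1_(occ2 Y 0 t) w * ((X t w - beta) * (X 0 w - beta))) = p t * (v * corr f t).
Proof.
have hg s : L12 (fun u => f (lat s - u)) by exact: L12_reflect.
have mE s : \int[leb]_u f (lat s - u) = \int[leb]_u f u.
  exact: (Rintegral_reflect _ (L12_meas hf)).
have dP := dominated_integralD (hX t) (hX 0).
have dM := dominated_integralD (hX t) (dominated_integralZ (-1) (hX 0)).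
have [iP EP _ _] := dominated_moments (indep_occ2 0 t) dP.
have [iM EM _ _] := dominated_moments (indep_occ2 0 t) dM.
have mP : \int[leb]_u (f (lat t - u) + f (lat 0 - u)) = \int[leb]_u f u + \int[leb]_u f u.
  by rewrite RintegralD ?mE//; [exact: (hg t).1|exact: (hg 0).1].
have mM : \int[leb]_u (f (lat t - u) + -1 * f (lat 0 - u)) = 0.
  rewrite RintegralD//; [|exact: (hg t).1|exact: integrableZ_real (hg 0).1].
  by rewrite RintegralZl ?mE//; [rewrite mulN1r subrr|exact: (hg 0).1].
rewrite mP in iP EP; rewrite mM in iM EM.
pose F (w : T) := \1_(occ2 Y 0 t) w * ((X t w - beta) * (X 0 w - beta)).
have FE w : F w = 4^-1 * (\1_(occ2 Y 0 t) w * (X t w + X 0 w - mu * (\int[leb]_u f u + \int[leb]_u f u)) ^+ 2)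
   - 4^-1 * (\1_(occ2 Y 0 t) w * (X t w + -1 * X 0 w - mu * 0) ^+ 2).
  by rewrite /F; field.
have iP4 := integrableZ_real 4^-1 iP; have iM4 := integrableZ_real 4^-1 iM.
rewrite -/F; split.
  apply: eq_integrable (integrableB_real iP4 iM4) => // w _ /=; congr (_%:E).
  exact/esym/FE.
have -> : \int[P]_w F w = \int[P]_w (4^-1 * (\1_(occ2 Y 0 t) w * (X t w + X 0 w - mu * (\int[leb]_u f u + \int[leb]_u f u)) ^+ 2)
   - 4^-1 * (\1_(occ2 Y 0 t) w * (X t w + -1 * X 0 w - mu * 0) ^+ 2)).
  by apply: eq_Rintegral => w _; exact: FE.
rewrite RintegralB// !RintegralZl// EP EM (pr_occ2 stY) subr0.
pose g0 u := f (lat 0 - u); pose gt u := f (lat t - u).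
have ip : leb.-integrable setT (EFin \o (fun u => g0 u * gt u)) by exact: integrable_corr.
have -> : corr f t = \int[leb]_u (g0 u * gt u) by rewrite (corrE 0 t (L12_meas hf)) subr0.
have sqE c : leb.-integrable setT (EFin \o (fun u => (gt u + c * g0 u) ^+ 2)) /\
    \int[leb]_u ((gt u + c * g0 u) ^+ 2) =
    \int[leb]_u (gt u ^+ 2) + c ^+ 2 * \int[leb]_u (g0 u ^+ 2) + 2 * c * \int[leb]_u (g0 u * gt u).
  have i1 : leb.-integrable setT (EFin \o (fun u => gt u ^+ 2)) := (hg t).2.
  have i2 := integrableZ_real (c ^+ 2) (hg 0).2.
  have i3 := integrableZ_real (2 * c) ip.
  have E u : (gt u + c * g0 u) ^+ 2 = gt u ^+ 2 + c ^+ 2 * g0 u ^+ 2 + 2 * c * (g0 u * gt u) by ring.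
  have i12 := integrableD_real i1 i2.
  split.
    by apply: eq_integrable (integrableD_real i12 i3) => // u _ /=; rewrite E.
  transitivity (\int[leb]_u (gt u ^+ 2 + c ^+ 2 * g0 u ^+ 2 + 2 * c * (g0 u * gt u))).
    by apply: eq_Rintegral => u _.
  rewrite RintegralD// RintegralD// !RintegralZl//; exact: (hg 0).2.
have [_ E1] := sqE 1; have [_ E2] := sqE (-1).
have -> : \int[leb]_u ((f (lat t - u) + f (lat 0 - u)) ^+ 2) = \int[leb]_u ((gt u + 1 * g0 u) ^+ 2).
  by apply: eq_Rintegral => u _; rewrite mul1r.
rewrite E1 E2; by field.
Qed.

Lemma centered_mean t : intble (fun w => Y t w * (X t w - beta)) /\
  \int[P]_w (Y t w * (X t w - beta)) = 0.
Proof.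
have [_ _ i E] := dominated_moments (indep_occ2 t t) (hX t).
rewrite (Rintegral_reflect _ (L12_meas hf)) in i E.
have YE w : Y t w = \1_(occ2 Y t t) w.
  by rewrite -(YY_indic Y01); case: (Y01 t w) => ->; rewrite ?mulr0 ?mulr1.
split; first by apply: eq_integrable i => // w _ /=; rewrite YE.
by rewrite -[RHS]E; apply: eq_Rintegral => w _; rewrite YE.
Qed.

Lemma covariance_sampled t :
  covariance P (fun w => Y t w * (X t w - beta)) (fun w => Y 0 w * (X 0 w - beta)) =
  (p t * (v * corr f t))%:E.
Proof.
have e0 s : fine ('E_P[fun w => (Y s w * (X s w - beta))%R])%E = 0.
  by rewrite unlock -[LHS]/(\int[P]_w (Y s w * (X s w - beta))) (centered_mean s).2.
have [i E] := centered_product t.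
rewrite unlock !e0 unlock -E -Rintegral_EFin//; apply: eq_integral => w _.
congr (_%:E); rewrite -(YY_indic Y01).
transitivity ((Y t w * (X t w - beta) - 0) * (Y 0 w * (X 0 w - beta) - 0)); first by [].
by rewrite !subr0; ring.
Qed.

End covariances.

Section normal_law_cf.
Variable R : realType.

Lemma normal_law_cf (s2 z t : R) : 0 <= s2 ->
  \int[normal_law 0 s2]_x cos (z * x + t) = expR (- (z ^+ 2 / 2 * s2)) * cos t.
Proof.
move=> s20; rewrite /normal_law; case: eqP => [->|/eqP sn0].
  rewrite /Rintegral integral_dirac//; last first.
    by apply/measurable_EFinP; exact: measurable_cos_lin.
  by rewrite diracE mem_set// mul1e/= !mulr0 add0r oppr0 expR0 mul1r.
have s0 : 0 < s2 by rewrite lt_def sn0.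
rewrite (@integral_normal_prob R 0 (Num.sqrt s2) (fun x => cos (z * x + t)) 1).
- rewrite normal_cf ?sqrtr_gt0// sqr_sqrtr//.
  by congr (expR _ * _); field.
- exact: measurable_cos_lin.
- by move=> x; rewrite ler_norml cos_geN1 cos_le1.
Qed.

End normal_law_cf.

Section second_moment_clt.
Context {disp} {T : measurableType disp} {R : realType} (P : probability T R) (d : nat).
Context (L : set 'rV[R]_d -> {RV P >-> R}) (Y : 'rV[int]_d -> {RV P >-> R}).
Local Notation Zd := 'rV[int]_d.
Local Notation leb := (lebesgue_rV R d).
Local Notation lat := (of_lattice R).
Local Notation p := (pair_prob Y).
Variables (f : 'rV[R]_d -> R) (X : 'rV[R]_d -> {RV P >-> R}).
Hypothesis d_gt0 : (0 < d)%N.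
Hypothesis lL : is_levy_basis L.
Hypothesis Y01 : forall t w, Y t w = 0 \/ Y t w = 1.
Hypothesis stY : stationary Y.
Hypothesis mixY : alpha_field Y k 2 2 @[k --> \oo] --> 0%E.
Hypothesis indYL : independent_systems P (sigma_family [set: Zd] Y)
  (sigma_family (@bounded_borel R d) L).
Hypothesis Y0_gt0 : (0 < P [set w | (Y 0 w = 1)%R])%E.
Hypothesis intX : forall t, is_levy_integral L (fun u => f (t - u)) [set: 'rV[R]_d] (X t).
Hypothesis sumY : (\esum_(t in [set: Zd])
  'E_P[fun w => (Y 0 w * Y t w)%R] *
  \int[leb]_u (`|f (- u)| * `|f (lat t - u)|)%R%:E < +oo)%E.
Let L1 : {RV P >-> R} := L (@unit_cube R d).
Hypothesis L1_sq : ('E_P[fun w => (`|L1 w| ^+ 2)%R] < +oo)%E.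
Hypothesis hf : L12 f.
Let beta := fine 'E_P[L1] * \int[leb]_u f u.
Let XZ (t : Zd) : {RV P >-> R} := X (lat t).
Let cov_term (t : Zd) : \bar R :=
  (((fine 'E_P[Y 0%R])^-1)%R%:E *
   covariance P (fun w => (Y t w * (XZ t w - beta))%R)
                (fun w => (Y 0 w * (XZ 0 w - beta))%R))%E.

Let p0_gt0 : 0 < p 0.
Proof.
rewrite -lte_fin -(prE P (measurable_occ2 Y 0 0)).
by rewrite (_ : occ2 Y 0 0 = [set w | Y 0 w = 1])//; apply/seteqP; split => w //= [].
Qed.

Let EY0 : fine 'E_P[Y 0] = p 0.
Proof.
rewrite unlock -[LHS]/(\int[P]_w Y 0 w) -[in RHS](subr0 0) -(Rintegral_YY Y01 stY).
by apply: eq_Rintegral => w _; case: (Y01 0 w) => ->; rewrite ?mulr0 ?mulr1.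
Qed.

Let kappa := corr (fun u => `|f u|).

Let kappa_ge0 h : 0 <= kappa h. Proof. exact: corr_ge0. Qed.

Let pk_ge0 h : 0 <= p h * kappa h. Proof. by rewrite mulr_ge0// pair_prob_ge0. Qed.

Let hsum : (\esum_(t in [set: Zd]) (p t * kappa t)%:E < +oo)%E.
Proof.
move: sumY; congr (_ < _)%E; apply: eq_esum => t _.
rewrite EFinM unlock; congr (_ * _)%E.
  by rewrite (Rintegral_EFin (integrable_YY Y01 0 t)) (Rintegral_YY Y01 stY) subr0.
by rewrite (Rintegral_EFin (integrable_corr0 t (L12_abs hf))).
Qed.

Lemma summable_dominated (x y : Zd -> R) (c : R) : (forall t, 0 <= x t) -> 0 <= c ->
  (\esum_(t in [set: Zd]) (x t)%:E < +oo)%E -> (forall t, `|y t| <= c * x t) ->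
  summable [set: Zd] (fun t => (y t)%:E).
Proof.
move=> x0 c0 xoo yx; apply: (@le_lt_trans _ _ (c * fine (\esum_(t in [set: Zd]) (x t)%:E))%:E);
  last exact: ltry.
apply: ge_ereal_sup => _ [A [fA _] <-].
rewrite -(fset_setK fA) -fsbig_seq ?fset_uniq//.
under eq_bigr do rewrite abse_EFin.
rewrite sumEFin lee_fin; apply: (@le_trans _ _ (\sum_(t <- fset_set A) c * x t)).
  exact: ler_sum.
by rewrite -mulr_sumr ler_wpM2l//; exact: sum_le_esum.
Qed.

(** [levy_continuity] compares [sampled_cf_cvg] with the normal law, realised as the identity on the
    line. The variance is recognised from [covariance_sampled]: the covariances are
    [v p t corr f t], so their normalised lattice sum is [v q / p 0]. *)
Theorem second_moment_clt : summable [set: Zd] cov_term /\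
  cvg_in_distribution (fun n => normalized_sum Y XZ beta n : {RV P >-> R})
    (normal_law 0 (lattice_sum cov_term)).
Proof.
have [a [b [v [lab cfL]]]] := levy_basis_log_cfP lL L1_sq.
have hX t : dominated_integral L (fun u => f (lat t - u)) (XZ t).
  exact: (levy_integral_dominated lL lab cfL (L12_reflect (lat t) hf) (intX (lat t))).
have v0 := llc_v_ge0 lab.
pose c := v / p 0; have c0 : 0 <= c by rewrite divr_ge0// ltW.
have covE : cov_term = fun t => (c * (p t * corr f t))%:E.
  apply/funext => t; rewrite /cov_term EY0.
  rewrite (covariance_sampled Y01 stY indYL lL lab cfL hf hX) -EFinM; congr (_%:E).
  by rewrite /c; field; rewrite gt_eqF.
have leS t : `|p t * corr f t| <= 1 * (p t * kappa t).
  by rewrite mul1r normrM (ger0_norm (pair_prob_ge0 _ _)) ler_wpM2l ?pair_prob_ge0//; exact: corr_abs.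
have sq := summable_dominated pk_ge0 ler01 hsum leS.
have sc : summable [set: Zd] cov_term.
  rewrite covE; apply: (summable_dominated pk_ge0 c0 hsum) => t.
  by rewrite normrM (ger0_norm c0) ler_wpM2l//; have := leS t; rewrite mul1r.
split=> //.
pose q := lattice_sum (fun t => (p t * corr f t)%:E).
have hq := lattice_sum_net sq.
have sE : lattice_sum cov_term = v * q / p 0.
  rewrite [RHS](_ : _ = c * q); last by rewrite /c; field; rewrite gt_eqF.
  rewrite covE in sc *; apply: net_unique (lattice_sum_net sc) _ => e e0.
  have c1 : 0 < c + 1 by rewrite ltr_wpDl.
  have [H0 hH0] := hq _ (divr_gt0 e0 c1); exists H0 => H /hH0 h.
  rewrite -mulr_sumr -mulrBr normrM (ger0_norm c0).
  apply: (@le_trans _ _ (c * (e / (c + 1)))); first by rewrite ler_wpM2l.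
  by rewrite mulrCA ler_piMr ?(ltW e0)// ler_pdivrMr// mul1r lerDl.
have q0 : 0 <= q := corr_limit_ge0 d_gt0 Y01 stY mixY hf hsum hq.
move=> g cg [M0 [_ hM]].
apply: (@levy_continuity R _ T P (fun n => normalized_sum Y XZ beta n) _ _
  (normal_law 0 (lattice_sum cov_term)) id _ _ _ g (M0 + 1)) => //.
- move=> z t; rewrite normal_law_cf; last by rewrite sE !mulr_ge0// invr_ge0 ltW.
  rewrite sE.
  exact: (sampled_cf_cvg d_gt0 Y01 stY mixY indYL p0_gt0 lL lab cfL hf hX hsum hq).
- by move=> x; apply: (hM (M0 + 1)) => //; rewrite ltrDl.
Qed.

End second_moment_clt.

(** Below [1] the term [y] dominates the square, above [1] the power does. [y] will be [1] for the
    random variable but [|f u|] for the kernel, because constants are not integrable over space. *)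
Lemma sqr_le_powR (R : realType) (x y delta : R) : 0 <= x -> 0 < delta ->
  (x <= 1 -> x <= y) -> 0 <= y -> x ^+ 2 <= y + x `^ (2 + delta).
Proof.
move=> x0 dl xy y0; have [x1|x1] := leP x 1.
  apply: (@le_trans _ _ y); last by rewrite lerDl powR_ge0.
  by apply: le_trans (xy x1); rewrite expr2 ler_piMr.
apply: (@le_trans _ _ (x `^ (2 + delta))); last by rewrite lerDr.
by rewrite -powR_mulrn// ler_powR ?(ltW x1)// lerDl ltW.
Qed.

(** Each set of moment conditions yields a finite second moment of [L1] and a kernel in [L^1] and
    [L^2], which is the setting of [second_moment_clt]. *)
Theorem theorem3p6 (disp : measure_display) (T : measurableType disp)
    (R : realType) (P : probability T R) (d : nat)
    (L : set 'rV[R]_d -> {RV P >-> R})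
    (Y : 'rV[int]_d -> {RV P >-> R})
    (delta : R) (f : 'rV[R]_d -> R) (X : 'rV[R]_d -> {RV P >-> R}) :
  (0 < d)%N ->
  is_levy_basis L ->
  (forall t w, Y t w = 0 \/ Y t w = 1) ->
  stationary Y ->
  alpha_mixing Y ->
  independent_systems P (sigma_family [set: 'rV[int]_d] Y)
                        (sigma_family (@bounded_borel R d) L) ->
  (0 < P [set w | (Y 0 w = 1)%R])%E ->
  0 < delta ->
  (forall u v, (0 < u)%N -> (0 < v)%N ->
     (alpha_field Y k u v * (k ^ d)%N%:R%:E)%E @[k --> \oo] --> 0%E) ->
  (forall u v, (0 < u)%N -> (0 < v)%N -> (u + v <= 4)%N ->
     (\sum_(0 <= k <oo) (k ^ d.-1)%N%:R%:E * alpha_field Y k u v < +oo)%E) ->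
  (\sum_(0 <= k <oo) (k ^ d.-1)%N%:R%:E *
     alpha_field Y k 1 1 `^ (delta / (2 + delta))%R < +oo)%E ->
  (forall t, is_levy_integral L (fun u => f (t - u)) [set: 'rV[R]_d] (X t)) ->
  (\esum_(t in [set: 'rV[int]_d])
     'E_P[fun w => (Y 0 w * Y t w)%R] *
     \int[lebesgue_rV R d]_u (`|f (- u)| * `|f (of_lattice R t - u)|)%R%:E
   < +oo)%E ->
  let L1 : {RV P >-> R} := L (@unit_cube R d) in
  let beta := fine 'E_P[L1] * \int[lebesgue_rV R d]_u f u in
  let XZ (t : 'rV[int]_d) : {RV P >-> R} := X (of_lattice R t) in
  let cov_term (t : 'rV[int]_d) : \bar R :=
    (((fine 'E_P[Y 0%R])^-1)%R%:E *
     covariance P (fun w => (Y t w * (XZ t w - beta))%R)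
                  (fun w => (Y 0 w * (XZ 0 w - beta))%R))%E in
  let clt :=
    summable [set: 'rV[int]_d] cov_term /\
    cvg_in_distribution (fun n => normalized_sum Y XZ beta n : {RV P >-> R})
      (normal_law 0 (lattice_sum cov_term)) in
  ('E_P[fun w => (`|L1 w| `^ (2 + delta))%R] < +oo ->
   f \in Lfun (lebesgue_rV R d) 1 ->
   f \in Lfun (lebesgue_rV R d) (2 + delta)%R%:E ->
   clt)%E
  /\
  ((exists2 h : R, (0 < h)%R & h_dependent Y h) ->
   'E_P[fun w => (`|L1 w| ^+ 2)%R] < +oo ->
   f \in Lfun (lebesgue_rV R d) 1 ->
   f \in Lfun (lebesgue_rV R d) 2%:E ->
   clt)%E.
Proof.
move=> d0 lL Y01 stY mix indYL pY dl _ _ _ intX sumY L1 beta XZ cov_term clt.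
have mix22 := mix 2%N 2%N isT isT.
have dl1 : 1 <= 2 + delta by lra.
split=> [hL f1 f2|_ hL f1 f2]; apply: second_moment_clt => //.
- have mL : measurable_fun setT (fun w => `|L1 w|) by exact: measurableT_comp.
  move: hL; rewrite unlock => hL; apply: (@le_lt_trans _ _
    (\int[P]_w (1%:E + (`|L1 w| `^ (2 + delta))%:E))%E).
    apply: ge0_le_integral => //.
    + by apply/measurable_EFinP; exact: measurable_funX.
    + by apply: emeasurable_funD => //; apply/measurable_EFinP;
        apply: (measurableT_comp (measurable_powR _)).
    + by move=> w _; rewrite -EFinD lee_fin; apply: sqr_le_powR.
  rewrite ge0_integralD//; last first.
    by apply/measurable_EFinP; apply: (measurableT_comp (measurable_powR _)).
  rewrite integral_cst// lte_add_pinfty// mul1e.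
  exact: le_lt_trans (probability_le1 P measurableT) (ltry 1).
- have i1 := (Lfun1_integrable _ _).1 f1.
  have i2 := Lfun_integrable dl1 f2.
  split=> //; apply: (le_integrable_real _ _ (integrableD_real (integrable_abs i1) i2)) => [|u].
    by apply: measurable_funX; exact: integrable_real_meas i1.
  rewrite normrX; exact: sqr_le_powR.
- by split; [exact: (Lfun1_integrable _ _).1 f1|exact: Lfun2_integrable_sqr f2].
Qed.
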